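(* Let $C_1,C_2\subset\Sigma$ be closed oriented generic pseudo-classical curves, with $C_1\cap C_2$ finite and each $x\in C_1\cap C_2$ a transversal intersection of exactly two branches, and set $$[C_1,C_2]=\sum_{x\in C_1\cap C_2}\operatorname{sign}^{f}_{2}(x)\,[C(x)]\in\mathcal{A}_1 .$$ For fixed labelings of $C_1,C_2$ (carried along by the moves), $[C_1,C_2]$ is invariant under flat Reidemeister moves. Moreover, relabeling changes all coefficients of the terms simultaneously as follows, where $S(a+ib)=b+ia$: relabeling of $C_1$ replaces each $\operatorname{sign}^f_2(x)$ by $S(-\operatorname{sign}^f_2(x))$; relabeling of $C_2$ replaces it by $S(\operatorname{sign}^f_2(x))$; simultaneous relabeling of $C_1$ and $C_2$ replaces it by $-\operatorname{sign}^f_2(x)$.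
   Context: Setting. $\Sigma$ is a compact non-orientable surface, possibly with boundary. A closed curve on $\Sigma$ is pseudo-classical if it is an orientation-preserving path. Flat Reidemeister moves are the Reidemeister moves $R_1,R_2,R_3$ with over/under information forgotten. Labeling. The $2$-cabling (doubled curve) of an oriented pseudo-classical curve $C_j$ consists of two components, oriented in agreement with $C_j$; a labeling of $C_j$ is a choice of which is called $\operatorname{L}(C_j)$ and which $\operatorname{R}(C_j)$; relabeling of $C_j$ means interchanging these two names. Labelings of $C_1$ and $C_2$ are chosen independently. Sign. Each $x\in C_1\cap C_2$ becomes a pattern of $4$ crossings of the doubled curves. The input crossing $\operatorname{inp}(x)$ is the crossing of this pattern which, with respect to the orientations, is the first crossing of the pattern met on each of the two parallel strands through it. For the ordered pair $(C_1,C_2)$, $\operatorname{sign}^{f}_{2}(x)$ is $1$ if the copies of $C_1,C_2$ through $\operatorname{inp}(x)$ are $\operatorname{R}(C_1),\operatorname{L}(C_2)$; $-1$ if they are $\operatorname{L}(C_1),\operatorname{R}(C_2)$; $i$ if they are $\operatorname{R}(C_1),\operatorname{R}(C_2)$; $-i$ if they are $\operatorname{L}(C_1),\operatorname{L}(C_2)$. Smoothing. $C(x)$ is the oriented loop on $\Sigma$ obtained by smoothing $x$ along the orientation, i.e. so that the orientation of the resulting single loop agrees everywhere with those of $C_1$ and $C_2$. $[C(x)]$ is its free homotopy class. Algebra. $\mathcal{R}=\{a+ib:a,b\in\mathbb{Z}\}\subset\mathbb{C}$. $\mathcal{A}$ is the polynomial algebra over $\mathcal{R}$ generated by free homotopy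 classes of oriented closed non-contractible curves on $\Sigma$, and $\mathcal{A}_1$ is its degree $1$ component, i.e. the free $\mathcal{R}$-module on these classes; the class of a contractible loop is set to be $0$. *)

(* Defs.v *)
From HB Require Import structures.
From mathcomp Require Import all_boot all_order all_algebra.
From mathcomp Require Import ring.
From mathcomp Require Import all_classical all_reals all_analysis.
From mathcomp.multinomials Require monalg.
Import (canonicals, coercions) monalg.

Set Implicit Arguments.
Unset Strict Implicit.
Unset Printing Implicit Defensive.

Import Order.TTheory GRing.Theory Num.Theory.
Import numFieldNormedType.Exports.

Local Open Scope classical_set_scope.
Local Open Scope ring_scope.

(** * The ring of Gaussian integers *)

Record gaussInt := Gauss { gre : int; gim : int }.

Definition gauss_pair (z : gaussInt) := (gre z, gim z).
Definition pair_gauss (p : int * int) := Gauss p.1 p.2.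
Lemma gauss_pairK : cancel gauss_pair pair_gauss. Proof. by case. Qed.

HB.instance Definition _ := Choice.copy gaussInt (can_type gauss_pairK).

Definition gauss_add (x y : gaussInt) := Gauss (gre x + gre y) (gim x + gim y).
Definition gauss_opp (x : gaussInt) := Gauss (- gre x) (- gim x).
Definition gauss_mul (x y : gaussInt) :=
  Gauss (gre x * gre y - gim x * gim y) (gre x * gim y + gim x * gre y).

Lemma gauss_addA : associative gauss_add.
Proof. by move=> x y z; rewrite /gauss_add /= !addrA. Qed.
Lemma gauss_addC : commutative gauss_add.
Proof. by move=> x y; rewrite /gauss_add addrC [gim x + _]addrC. Qed.
Lemma gauss_add0 : left_id (Gauss 0 0) gauss_add.
Proof. by case=> a b; rewrite /gauss_add /= !add0r. Qed.
Lemma gauss_addN : left_inverse (Gauss 0 0) gauss_opp gauss_add.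
Proof. by case=> a b; rewrite /gauss_add /= !addNr. Qed.

HB.instance Definition _ :=
  GRing.isZmodule.Build gaussInt gauss_addA gauss_addC gauss_add0 gauss_addN.

Lemma gauss_mulA : associative gauss_mul.
Proof. by move=> x y z; rewrite /gauss_mul /=; congr Gauss; ring. Qed.
Lemma gauss_mulC : commutative gauss_mul.
Proof. by move=> x y; rewrite /gauss_mul /=; congr Gauss; ring. Qed.
Lemma gauss_mul1 : left_id (Gauss 1 0) gauss_mul.
Proof. by case=> a b; rewrite /gauss_mul /=; congr Gauss; ring. Qed.
Lemma gauss_mulD : left_distributive gauss_mul gauss_add.
Proof. by move=> x y z; rewrite /gauss_mul /gauss_add /=; congr Gauss; ring. Qed.
Lemma gauss_1neq0 : Gauss 1 0 != Gauss 0 0.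
Proof. by apply/eqP => -[]. Qed.

HB.instance Definition _ := GRing.Zmodule_isComNzRing.Build gaussInt
  gauss_mulA gauss_mulC gauss_mul1 gauss_mulD gauss_1neq0.

Definition gauss_i : gaussInt := Gauss 0 1.

(* S (a + i b) = b + i a *)
Definition gauss_swap (z : gaussInt) : gaussInt := Gauss (gim z) (gre z).

(** * Surfaces

  Surfaces carry a C^1 structure; this is the regularity needed for
  transversality and local orientations. *)

Section Plane.
Variable R : realType.

Definition plane := 'rV[R]_2.
Definition pt (x y : R) : plane := \row_(j < 2) if j == 0 then x else y.

Definition halfplane : set plane := [set p | 0 <= p 0 0].

(* C^1 on an arbitrary subset of the plane: local extendability to C^1 maps
   defined on open sets. *)
Definition C1_on (V : set plane) (f : plane -> plane) : Prop :=
  forall p, V p -> exists g : plane -> plane,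
    (\forall q \near p, V q -> g q = f q) /\
    (\forall q \near p,
       differentiable g q /\ {for q, continuous (fun z => 'J g z)}).

(* Only the values of [cmap] on [cdom], and of [cinv] on the image of [cdom],
   are meaningful. *)
Record chart (T : topologicalType) := Chart {
  cdom : set T;
  cmap : T -> plane;
  cinv : plane -> T }.

Definition cimg (T : topologicalType) (c : chart T) : set plane :=
  cmap c @` cdom c.

Definition is_chart (T : topologicalType) (c : chart T) : Prop :=
  [/\ open (cdom c),
      (exists O : set plane, open O /\
         (cimg c = O \/ cimg c = O `&` halfplane)),
      (forall x, cdom c x -> cinv c (cmap c x) = x),
      {within cdom c, continuous (cmap c)} &
      {within cimg c, continuous (cinv c)}].

Definition overlap (T : topologicalType) (c d : chart T) : set plane :=
  cmap c @` (cdom c `&` cdom d).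

Definition transition (T : topologicalType) (c d : chart T) : plane -> plane :=
  cmap d \o cinv c.

Definition compatible (T : topologicalType) (c d : chart T) : Prop :=
  C1_on (overlap c d) (transition c d) /\ C1_on (overlap d c) (transition d c).

(* Compact surfaces, possibly with boundary.  Connectedness is not imposed. *)
Record surface := Surface {
  points :> topologicalType;
  atlas : set (chart points);
  atlas_chart : forall c, atlas c -> is_chart c;
  atlas_cover : forall x, exists2 c, atlas c & cdom c x;
  atlas_compatible : forall c d, atlas c -> atlas d -> compatible c d;
  atlas_maximal : forall c, is_chart c ->
    (forall d, atlas d -> compatible c d) -> atlas c;
  surface_compact : compact [set: points];
  surface_hausdorff : hausdorff_space points }.

End Plane.

Section Surfaces.
Variables (R : realType) (M : surface R).

Definition orientable : Prop := exists A : set (chart R M),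
  [/\ A `<=` @atlas R M,
      (forall x : M, exists2 c, A c & cdom c x) &
      forall c d, A c -> A d -> forall p, (overlap c d)^° p ->
        0 < \det ('J (transition c d) p)].

Definition interior_point (x : M) : Prop := exists c : chart R M,
  [/\ atlas c, cdom c x & (cimg c)^° (cmap c x)].

Definition C1_map (f : M -> M) : Prop :=
  continuous f /\
  forall c d : chart R M, atlas c -> atlas d ->
    C1_on (cmap c @` (cdom c `&` f @^-1` cdom d)) (cmap d \o f \o cinv c).

Definition diffeo (f : M -> M) : Prop := exists g : M -> M,
  [/\ cancel f g, cancel g f, C1_map f & C1_map g].

(** * Closed curves

  A closed curve is a 1-periodic map on the real line. *)

Definition loop (c : R -> M) : Prop :=
  continuous c /\ forall s, c (s + 1) = c s.

Definition freely_homotopic (c d : R -> M) : Prop :=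
  exists H : R * R -> M,
    [/\ continuous H,
        forall u s, H (u, s + 1) = H (u, s),
        forall s, H (0, s) = c s &
        forall s, H (1, s) = d s].

Definition contractible (c : R -> M) : Prop :=
  exists x : M, freely_homotopic c (fun=> x).

Definition free_class (c : R -> M) : set (R -> M) :=
  [set d | loop d /\ freely_homotopic c d].

Definition noncontractible_class (K : set (R -> M)) : bool :=
  `[< exists c, [/\ loop c, ~ contractible c & K = free_class c] >].

Record hclass := HClass {
  hclass_set : set (R -> M);
  _ : noncontractible_class hclass_set }.

HB.instance Definition _ := [isSub for hclass_set].
HB.instance Definition _ := gen_eqMixin hclass.
HB.instance Definition _ := gen_choiceMixin hclass.

(* The degree 1 component of the polynomial algebra on [hclass] *)
Definition A1 := monalg.malg hclass gaussInt.

(* [insub] fails exactly on the class of a contractible loop. *)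
Definition cls (c : R -> M) : A1 :=
  if insub (free_class c) is Some k then monalg.mkmalgU k 1 else 0.

(* Velocity read in a chart *)
Definition velocity (c : chart R M) (C : R -> M) (s : R) : plane R :=
  derive1 (cmap c \o C : R -> 'rV[R]_2) s.

Definition C1_immersion (C : R -> M) : Prop :=
  continuous C /\
  forall c : chart R M, atlas c -> forall s, cdom c (C s) ->
    [/\ derivable (cmap c \o C) s 1,
        {for s, continuous (velocity c C)} &
        velocity c C s != 0].

Definition transverse (C D : R -> M) (s t : R) : Prop :=
  forall c : chart R M, atlas c -> cdom c (C s) ->
    row_free (col_mx (velocity c C s) (velocity c D t)).

(* Closed immersed curve in the interior of the surface whose only
   self-intersections are finitely many transversal double points *)
Definition generic (C : R -> M) : Prop :=
  [/\ loop C, C1_immersion C, forall s, interior_point (C s),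
      finite_set [set st : R * R |
        0 <= st.1 /\ st.1 < st.2 /\ st.2 < 1 /\ C st.1 = C st.2] &
      (forall s t, 0 <= s < 1 -> 0 <= t < 1 -> s != t -> C s = C t ->
         transverse C C s t /\
         forall r, 0 <= r < 1 -> C r = C s -> r = s \/ r = t)].

(* [o c s] tells whether the chart [c] agrees at [C s] with a local orientation
   of the surface transported along [C]; periodicity says that the local
   orientation comes back to itself. *)
Definition pseudo_classical (C : R -> M) : Prop :=
  exists o : chart R M -> R -> bool,
    [/\ forall c d, atlas c -> atlas d -> forall s,
          cdom c (C s) -> cdom d (C s) ->
          (o c s == o d s) = (0 < \det ('J (transition c d) (cmap c (C s)))),
        forall c, atlas c -> forall s, cdom c (C s) ->
          \forall u \near s, o c u = o c s &
        forall c, atlas c -> forall s, cdom c (C s) -> o c (s + 1) = o c s].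

(** * Doubled curves and labelings *)

Definition strip : set (plane R) := [set p | `|p 0 1| < 1].

(* [B] is an immersed annulus with core [C].  The 2-cabling of [C] at distance
   e consists of the curves s |-> B (s, - e) and s |-> B (s, e) *)
Definition cabling (C : R -> M) (B : plane R -> M) : Prop :=
  [/\ forall p, strip p -> {for p, continuous B},
      forall s y, `|y| < 1 -> B (pt (s + 1) y) = B (pt s y),
      forall s, B (pt s 0) = C s &
      forall c : chart R M, atlas c -> forall p, strip p -> cdom c (B p) ->
        [/\ differentiable (cmap c \o B) p,
            {for p, continuous (fun q => 'J (cmap c \o B) q)} &
            \det ('J (cmap c \o B) p) != 0]].

Inductive label := Lft | Rgt.

Definition swap_label (a : label) : label :=
  match a with Lft => Rgt | Rgt => Lft end.

Definition level (a : label) (e : R) : R :=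
  match a with Lft => - e | Rgt => e end.

(* A curve with a labeling of its 2-cabling: L(C) is s |-> band (s, - e) and
   R(C) is s |-> band (s, e), for small e > 0 *)
Record lcurve := LCurve {
  crv :> R -> M;
  band : plane R -> M }.

Definition strand (C : lcurve) (a : label) (e : R) : R -> M :=
  fun s => band C (pt s (level a e)).

Definition relabel (C : lcurve) : lcurve :=
  LCurve (crv C) (fun p => band C (pt (p 0 0) (- p 0 1))).

Definition labeled_curve (C : lcurve) : Prop :=
  [/\ generic (crv C), pseudo_classical (crv C) & cabling (crv C) (band C)].

(** * Signs and the bracket *)

Definition crossings (C1 C2 : R -> M) : set M := range C1 `&` range C2.

(* The parameter in [0, 1) at which [C] passes through [x] *)
Definition param (C : R -> M) (x : M) : R :=
  xget 0 [set s | 0 <= s < 1 /\ C s = x].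

Definition admissible (C1 C2 : lcurve) : Prop :=
  [/\ labeled_curve C1, labeled_curve C2, finite_set (crossings C1 C2) &
      forall s t, 0 <= s < 1 -> 0 <= t < 1 -> C1 s = C2 t ->
        [/\ transverse C1 C2 s t,
            forall s', 0 <= s' < 1 -> C1 s' = C1 s -> s' = s &
            forall t', 0 <= t' < 1 -> C2 t' = C2 t -> t' = t]].

(* Within parameter distance d of (s0, t0), the doubled curves at distance e
   meet in exactly four crossings: strand a of C1 meets strand b of C2 once, at
   the parameters S a b and T a b *)
Definition pattern (C1 C2 : lcurve) (s0 t0 d e : R)
    (S T : label -> label -> R) : Prop :=
  forall a b,
    [set st : R * R | [/\ `|st.1 - s0| < d, `|st.2 - t0| < d &
       strand C1 a e st.1 = strand C2 b e st.2]] = [set (S a b, T a b)].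

(* inp(x) is the crossing of strand a of C1 with strand b of C2: it comes first
   along strand a of C1, and first along strand b of C2 *)
Definition input (C1 C2 : lcurve) (x : M) (a b : label) : Prop :=
  \forall d \near 0^'+, \forall e \near 0^'+, exists S T,
    [/\ pattern C1 C2 (param C1 x) (param C2 x) d e S T,
        S a b < S a (swap_label b) & T a b < T (swap_label a) b].

Definition sign2f (C1 C2 : lcurve) (x : M) : gaussInt :=
  if `[< input C1 C2 x Rgt Lft >] then 1
  else if `[< input C1 C2 x Lft Rgt >] then -1
  else if `[< input C1 C2 x Rgt Rgt >] then gauss_i
  else if `[< input C1 C2 x Lft Lft >] then - gauss_i
  else 0.

(* Run once along C1 from x, then once along C2 from x *)
Definition smoothing (C1 C2 : R -> M) (x : M) : R -> M := fun u =>
  let f := u - (Num.floor u)%:~R in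
  if f < 2^-1 then C1 (param C1 x + 2 * f)
  else C2 (param C2 x + (2 * f - 1)).

Definition bracket (C1 C2 : lcurve) : A1 :=
  \sum_(x \in crossings C1 C2) sign2f C1 C2 x *: cls (smoothing C1 C2 x).

(** * Flat Reidemeister moves *)

Definition bump (t : R) : R := if `|t| <= 1 then (1 - t ^+ 2) ^+ 2 else 0.

(* Local pictures in the square [-2,2]^2, before and after the move.  Each
   strand is parametrized by [-2,2]; the two pictures agree for |t| >= 1. *)
Definition tangle n := n.-tuple (R -> plane R).

(* a straight arc and a kink with its only double point at (0, 1/3) *)
Definition R1_before : tangle 1 := [tuple (fun t => pt t 0)].
Definition R1_after : tangle 1 :=
  [tuple (fun t => pt (t - 3 * t * bump t) (bump t))].

(* two disjoint arcs and two arcs bounding a bigon *)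
Definition R2_before : tangle 2 :=
  [tuple (fun t => pt t 0); (fun t => pt t 2^-1)].
Definition R2_after : tangle 2 :=
  [tuple (fun t => pt t 0); (fun t => pt t (2^-1 - bump t))].

(* the third arc passes above or below the crossing of the diagonals *)
Definition R3_before : tangle 3 :=
  [tuple (fun t => pt t t); (fun t => pt t (- t));
         (fun t => pt t (bump t / 2))].
Definition R3_after : tangle 3 :=
  [tuple (fun t => pt t t); (fun t => pt t (- t));
         (fun t => pt t (- (bump t / 2)))].

Definition square : set (plane R) :=
  [set p | `|p 0 0| <= 2 /\ `|p 0 1| <= 2].

(* R(D) runs, near D s, on the same side as R(C); here C and D pass through the
   same point at parameter s. *)
Definition same_side (C D : lcurve) (s : R) : Prop :=
  forall d, 0 < d -> \forall e \near 0^'+, exists s' e',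
    [/\ `|s' - s| < d, 0 < e' < d & band D (pt s e) = band C (pt s' e')].

Definition on_arc (p q s : R) : Prop :=
  exists m : int, p <= s + m%:~R <= q.

(* The pair (C 0, C 1) meets a disc, the preimage of [square] under a chart, in
   the tangle U, and (C' 0, C' 1) is obtained by substituting U' for U.  The
   i-th strand is carried by the arc [p i, q i] of the curve C (k i); it is
   traversed in the increasing or decreasing direction according to th i.
   Labels are kept outside the disc. *)
Definition local_move n (U U' : tangle n) (C C' : 'I_2 -> lcurve) : Prop :=
  exists (c : chart R M) (k : 'I_n -> 'I_2) (p q : 'I_n -> R)
         (th : 'I_n -> R -> R),
    [/\ atlas c /\ square `<=` cimg c,
        (forall i, p i < q i < p i + 1) /\
        (forall i j s, k i = k j ->
           on_arc (p i) (q i) s -> on_arc (p j) (q j) s -> i = j),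
        (forall i, {within `[p i, q i], continuous (th i)} /\
           set_bij `[p i, q i] `[- 2, 2] (th i)),
        (forall j s, (cinv c @` square) (C j s) ->
           exists2 i, k i = j & on_arc (p i) (q i) s) &
        (forall i s, p i <= s <= q i ->
           C (k i) s = cinv c (tnth U i (th i s)) /\
           C' (k i) s = cinv c (tnth U' i (th i s))) /\
        (forall j s, (forall i, k i = j -> ~ on_arc (p i) (q i) s) ->
           C' j s = C j s /\ same_side (C j) (C' j) s)].

(* Ambient isotopy and orientation-preserving reparametrization: C' j is
   h 1 o C j o r j, and the labels are transported. *)
Definition isotopy_move (C C' : 'I_2 -> lcurve) : Prop :=
  exists (h : R * M -> M) (r : 'I_2 -> R -> R),
    [/\ continuous h, forall x, h (0, x) = x,
        forall u : R, 0 <= u <= 1 -> diffeo (fun x => h (u, x)),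
        forall j s, [/\ r j (s + 1) = r j s + 1, derivable (r j) s 1 &
          0 < derive1 (r j) s] &
        forall j s,
          C' j s = h (1, C j (r j s)) /\
          same_side
            (LCurve (fun u => h (1, C j (r j u)))
               (fun z => h (1, band (C j) (pt (r j (z 0 0)) (z 0 1)))))
            (C' j) s].

Definition pair_of (C1 C2 : lcurve) (j : 'I_2) : lcurve :=
  if j == 0 then C1 else C2.

Variant flat_move (C1 C2 C1' C2' : lcurve) : Prop :=
  | flat_isotopy of isotopy_move (pair_of C1 C2) (pair_of C1' C2')
  | flat_R1 of local_move R1_before R1_after (pair_of C1 C2) (pair_of C1' C2')
  | flat_R1V of local_move R1_after R1_before (pair_of C1 C2) (pair_of C1' C2')
  | flat_R2 of local_move R2_before R2_after (pair_of C1 C2) (pair_of C1' C2')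
  | flat_R2V of local_move R2_after R2_before (pair_of C1 C2) (pair_of C1' C2')
  | flat_R3 of local_move R3_before R3_after (pair_of C1 C2) (pair_of C1' C2')
  | flat_R3V of local_move R3_after R3_before (pair_of C1 C2) (pair_of C1' C2').

End Surfaces.

(* Main.v *)
From HB Require Import structures.
Require Import Defs.
From mathcomp Require Import all_boot all_order all_algebra.
From mathcomp Require Import zify ring lra.
From mathcomp Require Import all_classical all_reals all_analysis.

From mathcomp.multinomials Require monalg.
Import (canonicals, coercions) monalg.

Set Implicit Arguments.
Unset Strict Implicit.
Unset Printing Implicit Defensive.

Import Order.TTheory GRing.Theory Num.Theory.
Import numFieldNormedType.Exports.
Local Open Scope classical_set_scope.
Local Open Scope ring_scope.

(** Read in a chart around a crossing [x], the cabled strands form a parallelogram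
up to first order. The input crossing is therefore determined by the signs of
three determinants: [X], of the velocities of [C1] and [C2] at [x], and [D1], [D2],
of the velocity of each curve and the transverse direction of its band. Exactly one
pair of labels is compatible with the signs of [D1 * X] and [D2 * X], which gives
the relabeling rules.

A diffeomorphism multiplies the three determinants by the same factor, and an
isotopy carries the smoothed loops along. In a local move, a crossing outside the
disc keeps its determinants, because the labels are kept there, and its smoothed
loop changes by the straight-line homotopy inside the disc. For two crossings inside
the disc of the same two strands, before and after the move, dragging the crossing
along the strands is a free homotopy of the smoothed loops, while the signs of [D1]
and [D2] are constant along arcs; so only the signs of [X] have to be compared. The
half turn of the square exchanges the two pictures of [R3] and preserves [X]; the
reflection in the vertical axis exchanges the two crossings of the bigon of [R2] and
reverses [X], so that these cancel. *)

(** * Calculus in the plane *)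

(** All data are only $C^1$, so the four crossings of a pattern are found by a contraction argument,
    and their order is read off from a linear estimate in which both compared points vary. This is
    why strict differentiability, with two free points, is the basic tool. The definition of [input]
    asks for every small [d] and then every small [e], so the estimates must be uniform in the
    heights of the strands.

    In a local move the bands before and after are compared only off the arcs, and the
    parametrization [th] is merely a continuous bijection. The sides inside are therefore carried in
    from a point just before each arc. Monotonicity of [th] gives only weak signs for the speeds;
    strictness is recovered from the transversality contained in [admissible].

    The parameter [param] is normalized to $[0,1)$, whereas arcs and reparametrizations live on the
    real line. Signs and smoothed loops are therefore first expressed at arbitrary parameters of a
    crossing, which differ from [param] by integers. *)

Section PlaneCalculus.
Variable R : realType.
Implicit Types (p q r v w : plane R) (x y z : R).

Lemma ptE0 x y : pt x y 0 0 = x. Proof. by rewrite mxE. Qed.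
Lemma ptE1 x y : pt x y 0 1 = y. Proof. by rewrite mxE. Qed.

Lemma ord2P (P : 'I_2 -> Prop) : P 0 -> P 1 -> forall i, P i.
Proof.
move=> P0 P1; case=> -[|[|//]] Hi.
  by rewrite (_ : Ordinal Hi = 0) //; apply: val_inj.
by rewrite (_ : Ordinal Hi = 1) //; apply: val_inj.
Qed.

Lemma plane_ext p q : p 0 0 = q 0 0 -> p 0 1 = q 0 1 -> p = q.
Proof. by move=> h0 h1; apply/rowP; elim/ord2P. Qed.

Lemma pt_eta p : pt (p 0 0) (p 0 1) = p.
Proof. by apply: plane_ext; rewrite ?ptE0 ?ptE1. Qed.

Lemma ptB x y x' y' : pt x y - pt x' y' = pt (x - x') (y - y').
Proof. by apply: plane_ext; rewrite !mxE. Qed.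

Lemma ptD x y x' y' : pt x y + pt x' y' = pt (x + x') (y + y').
Proof. by apply: plane_ext; rewrite !mxE. Qed.

Lemma ptZ k x y : k *: pt x y = pt (k * x) (k * y).
Proof. by apply: plane_ext; rewrite !mxE. Qed.

Lemma entry_le_norm m n (A : 'M[R]_(m, n)) i j : `|A i j| <= `|A|.
Proof.
rewrite [leRHS]/Num.norm /= mx_normrE.
by apply: (@le_bigmax _ _ _ 0 (fun ij : 'I_m * 'I_n => `|A ij.1 ij.2|) (i, j)).
Qed.

Lemma mx_norm_le m n (A : 'M[R]_(m, n)) e :
  0 <= e -> (forall i j, `|A i j| <= e) -> `|A| <= e.
Proof.
move=> e0 Ae; rewrite [leLHS]/Num.norm /= mx_normrE.
by apply/bigmax_leP; split => // -[i j] _ /=.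
Qed.

Lemma plane_norm_le p e : `|p 0 0| <= e -> `|p 0 1| <= e -> `|p| <= e.
Proof.
move=> h0 h1; apply: mx_norm_le; first exact: le_trans h0.
by move=> i j; rewrite ord1; elim/ord2P: j.
Qed.

Lemma plane_norm_lt p e : `|p 0 0| < e -> `|p 0 1| < e -> `|p| < e.
Proof.
move=> h0 h1; apply: (@le_lt_trans _ _ (Num.max `|p 0 0| `|p 0 1|)).
  by apply: plane_norm_le; rewrite le_max lexx ?orbT.
by rewrite gt_max h0.
Qed.

Lemma norm_mulmx_le m n (v : 'rV[R]_m) (A : 'M[R]_(m, n)) :
  `|v *m A| <= m%:R * `|v| * `|A|.
Proof.
apply: mx_norm_le => [|i j]; first by rewrite !mulr_ge0.
rewrite mxE; apply: le_trans (ler_norm_sum _ _ _) _.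
apply: (@le_trans _ _ (\sum_(k < m) `|v| * `|A|)).
  by apply: ler_sum => k _; rewrite normrM ler_pM // entry_le_norm.
by rewrite sumr_const card_ord -mulrA mulr_natl.
Qed.

Lemma is_derive_entry (f : R -> plane R) (t : R) (df : plane R) (j : 'I_2) :
  is_derive t 1 f df -> is_derive t 1 (fun u => f u 0 j) (df 0 j).
Proof.
move=> h; have df1 : derivable f t 1 by [].
apply: DeriveDef; first by have /derivable_mxP := df1; exact.
have <- : 'D_1 f t = df by exact: derive_val.
by rewrite derive_mx // mxE.
Qed.

Lemma is_derive_comp_plane (g : plane R -> plane R) (f : R -> plane R) (t : R) (df : plane R) :
  is_derive t 1 f df -> differentiable g (f t) ->
  is_derive t 1 (g \o f) (df *m 'J g (f t)).
Proof.
move=> h dg; have df1 : differentiable f t by apply/derivable1_diffP.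
have dgf : differentiable (g \o f) t by exact: differentiable_comp.
apply: DeriveDef; first exact/derivable1_diffP.
have <- : 'd f t 1 = df by rewrite -deriveE // derive_val.
rewrite /jacobian mul_rV_lin1 deriveE //.
by have /(congr1 (fun F => F 1)) := diff_comp df1 dg.
Qed.

Lemma is_derive_line v w (t : R) : is_derive t 1 (fun u : R => v + u *: w) w.
Proof.
have dl : is_diff t (fun u : R => v + u *: w) (0 + *:%R^~ w) by apply: is_diffD.
apply: DeriveDef; first exact/derivable1_diffP.
by rewrite deriveE // diff_val /GRing.add /= add0r scale1r.
Qed.

(** The mean value theorem is applied, entry by entry, to [f] minus its linear part along the
    segment from [q] to [r], which stays in the ball. Both points are free, as a contraction
    estimate requires. *)
Lemma strict_differentiability (f : plane R -> plane R) p :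
  (\forall q \near p, differentiable f q) ->
  {for p, continuous (fun q => 'J f q)} ->
  forall eta, 0 < eta -> exists2 d, 0 < d &
    forall q r, `|q - p| < d -> `|r - p| < d ->
      `|f r - f q - (r - q) *m 'J f p| <= eta * `|r - q|.
Proof.
move=> df cf eta eta0.
(* Half of [eta], because [norm_mulmx_le] costs the dimension, 2, as a factor in the sup norm. *)
have e20 : 0 < eta / 2 by rewrite divr_gt0.
have /cvgrPdist_lt /(_ _ e20) cJ := cf.
have /nbhs_normP [d d0 Hd] : \forall q \near p,
    differentiable f q /\ `|'J f p - 'J f q| < eta / 2.
  by near=> q; split; near: q.
exists d => // q r qd rd.
have seg (t : R) : 0 <= t <= 1 -> `|q + t *: (r - q) - p| < d.
  move=> /andP[t0 t1].
  have -> : q + t *: (r - q) - p = (1 - t) *: (q - p) + t *: (r - p).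
    by apply: plane_ext; rewrite !mxE; ring.
  have [->|tn0] := eqVneq t 0; first by rewrite subr0 scale1r scale0r addr0.
  apply: le_lt_trans (ler_normD _ _) _.
  rewrite !normrZ ger0_norm ?subr_ge0 // ger0_norm //.
  have : (1 - t) * `|q - p| <= (1 - t) * d.
    by rewrite ler_wpM2l ?subr_ge0 // ltW.
  have : t * `|r - p| < t * d by rewrite ltr_pM2l // lt_neqAle eq_sym tn0.
  lra.
apply: mx_norm_le => [|i j]; first by rewrite mulr_ge0 // ltW.
rewrite ord1 {i}.
pose psi (t : R) : R := (f (q + t *: (r - q)) - t *: ((r - q) *m 'J f p)) 0 j.
pose dpsi (t : R) : R :=
  ((r - q) *m 'J f (q + t *: (r - q)) - (r - q) *m 'J f p) 0 j.
have near_seg (t : R) : 0 <= t <= 1 -> differentiable f (q + t *: (r - q)) /\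
    `|'J f p - 'J f (q + t *: (r - q))| < eta / 2.
  by move=> t01; apply: Hd; rewrite /= distrC seg.
have dline t v w := is_derive_line v w t.
have dpsiP (t : R) : 0 <= t <= 1 -> is_derive t 1 psi (dpsi t).
  move=> t01; apply: is_derive_entry; apply: is_deriveB.
    have [dft _] := near_seg t t01.
    exact: (is_derive_comp_plane (dline t q (r - q)) dft).
  by have := dline t 0 ((r - q) *m 'J f p); under eq_fun do rewrite add0r.
have psic : {within `[0, 1], continuous psi}.
  apply: derivable_within_continuous => t; rewrite in_itv /= => t01.
  by have [] := dpsiP t t01.
have [|c c01 cE] := MVT_segment ler01 _ psic (df := dpsi).
  by move=> t; rewrite in_itv /= => /andP[t0 t1]; apply: dpsiP; rewrite !ltW.
have -> : (f r - f q - (r - q) *m 'J f p) 0 j = dpsi c.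
  transitivity (dpsi c * (1 - 0)); last by rewrite subr0 mulr1.
  rewrite -cE /psi scale0r scale1r addr0 subrKC.
  by rewrite !mxE; ring.
rewrite /dpsi -mulmxBr; apply: le_trans (entry_le_norm _ _ _) _.
apply: le_trans (norm_mulmx_le _ _) _.
have {}c01 : 0 <= c <= 1 by move: c01; rewrite in_itv.
have [_ cJc] := near_seg c c01.
have {}cJc : `|'J f (q + c *: (r - q)) - 'J f p| <= eta / 2.
  by rewrite -normrN opprB ltW.
have := ler_wpM2l (normr_ge0 (r - q)) cJc.
set a := `|r - q|; set b := `|'J f _ - _|; lra.
Unshelve. all: by end_near. Qed.
End PlaneCalculus.

(** Completeness of the plane, for the Banach fixed point theorem in [crossing_solution]. *)
HB.instance Definition _ (R : realType) m n :=
  Uniform_isComplete.Build 'M[R]_(m, n) (@mx_complete R m n).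

(** * Crossings of two bands: existence, uniqueness and order *)

Section CrossingEquation.
Variable R : realType.
Implicit Types (p q u v w : plane R) (s t x y e d : R).

Definition det2 u v : R := u 0 0 * v 0 1 - u 0 1 * v 0 0.

Lemma det2_abs_le u v : `|det2 u v| <= 2 * `|u| * `|v|.
Proof.
have h i j : `|u 0 i * v 0 j| <= `|u| * `|v|.
  by rewrite normrM ler_pM // entry_le_norm.
apply: le_trans (ler_normB _ _) _.
have := h 0 1; have := h 1 0; lra.
Qed.

Lemma det2Dl u u' v : det2 (u + u') v = det2 u v + det2 u' v.
Proof. by rewrite /det2 !mxE; ring. Qed.
Lemma det2Dr u v v' : det2 u (v + v') = det2 u v + det2 u v'.
Proof. by rewrite /det2 !mxE; ring. Qed.
Lemma det2Zl k u v : det2 (k *: u) v = k * det2 u v.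
Proof. by rewrite /det2 !mxE; ring. Qed.
Lemma det2Zr k u v : det2 u (k *: v) = k * det2 u v.
Proof. by rewrite /det2 !mxE; ring. Qed.
Lemma det2C u v : det2 u v = - det2 v u.
Proof. by rewrite /det2; ring. Qed.
Lemma det2vv u : det2 u u = 0.
Proof. by rewrite /det2; ring. Qed.

Lemma mulmx_pt x y (J : 'M[R]_2) : pt x y *m J = x *: row 0 J + y *: row 1 J.
Proof.
apply/rowP => j; rewrite mxE big_ord_recl big_ord1 !mxE /=.
by congr (_ + _ * J _ _); apply: val_inj.
Qed.

Lemma det_rows (J : 'M[R]_2) : \det J = det2 (row 0 J) (row 1 J).
Proof.
rewrite (expand_det_row _ 0) big_ord_recl big_ord1 /cofactor !det_mx11 !mxE.
rewrite /det2 !mxE /= expr0 expr1 mul1r mulN1r mulrN.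
by congr (J _ _ * J _ _ - J _ _ * J _ _); apply: val_inj.
Qed.

(** Strict differentiability; the derivative is given by the images [v] and [w] of the basis
    vectors, that is, the velocity of a curve and the transverse direction of its band. *)
Definition strict_diff (f : plane R -> plane R) p v w :=
  forall eta, 0 < eta -> exists2 d, 0 < d &
    forall q r, `|q - p| < d -> `|r - p| < d ->
      `|f r - f q - ((r - q) 0 0 *: v + (r - q) 0 1 *: w)| <= eta * `|r - q|.

Lemma C1_strict_diff (f : plane R -> plane R) p :
  (\forall q \near p, differentiable f q) ->
  {for p, continuous (fun q => 'J f q)} ->
  strict_diff f p (row 0 ('J f p)) (row 1 ('J f p)).
Proof.
move=> df cf eta eta0; have [d d0 H] := strict_differentiability df cf eta0.
by exists d => // q r qd rd; rewrite -mulmx_pt pt_eta; exact: H.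
Qed.

Section Solve.
Variables (f g : plane R -> plane R) (s0 t0 : R) (v1 w1 v2 w2 : plane R).
Hypothesis fs : strict_diff f (pt s0 0) v1 w1.
Hypothesis gs : strict_diff g (pt t0 0) v2 w2.
Hypothesis X0 : det2 v1 v2 != 0.

(* Cramer's rule for [x *: v1 - y *: v2 = u]. *)
Let L u : plane R := pt (det2 u v2 / det2 v1 v2) (- (det2 v1 u / det2 v1 v2)).

Let LB u v : L (u - v) = L u - L v.
Proof. by apply: plane_ext; rewrite !mxE /= /det2 !mxE; ring. Qed.

Let LE x y : L (x *: v1 - y *: v2) = pt x y.
Proof.
rewrite /L -scaleNr; congr pt; apply: (mulIf X0).
  by rewrite divfK // det2Dl !det2Zl det2vv; ring.
by rewrite mulNr divfK // det2Dr !det2Zr det2vv; ring.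
Qed.

Let L_eq0 u : L u = 0 -> u = 0.
Proof.
move=> L0; have /eqP := congr1 (fun p => p 0 0) L0.
have /eqP := congr1 (fun p => p 0 1) L0.
rewrite /L ptE0 ptE1 !mxE oppr_eq0 !mulf_eq0 !invr_eq0 !(negbTE X0) !orbF.
move=> /eqP b /eqP a.
have : det2 v1 v2 *: u = det2 u v2 *: v1 + det2 v1 u *: v2.
  by apply: plane_ext; rewrite !mxE /det2; ring.
move=> /eqP; rewrite a b !scale0r addr0 scaler_eq0 (negbTE X0).
by move=> /eqP.
Qed.

(** A bound for the operator norm of [L], obtained from [det2_abs_le]. *)
Let c : R := 2 * (`|v1| + `|v2|) / `|det2 v1 v2|.

Let c_ge0 : 0 <= c. Proof. by rewrite divr_ge0 // mulr_ge0 // addr_ge0. Qed.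

Let L_le u : `|L u| <= c * `|u|.
Proof.
have X1 : 0 < `|det2 v1 v2| by rewrite normr_gt0.
have nu : 0 <= `|u| by [].
have n1 : 0 <= `|v1| * `|u| by rewrite mulr_ge0.
have n2 : 0 <= `|v2| * `|u| by rewrite mulr_ge0.
apply: plane_norm_le; rewrite ?ptE0 ?ptE1 ?normrN normf_div /c mulrAC
  ler_pM2r ?invr_gt0 //; apply: le_trans (det2_abs_le _ _) _; lra.
Qed.

Let Phi s t y y' : plane R := f (pt s y) - g (pt t y').

Let norm_ptB s t x d : `|s - t| < d -> `|x| < d -> `|pt s x - pt t 0| < d.
Proof. by move=> h1 h2; rewrite ptB subr0; apply: plane_norm_lt; rewrite ?ptE0 ?ptE1. Qed.

Let norm_pt x y : `|pt x y| <= `|x| + `|y|.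
Proof. by apply: plane_norm_le; rewrite ?ptE0 ?ptE1 ?lerDl ?lerDr. Qed.

(** All four variables move at once: the same bound gives the contraction (equal heights), the size
    of the first Newton step (from height zero) and the shift of a crossing (one height changed). *)
Let Phi_lin eta : 0 < eta -> exists2 d, 0 < d & forall s t y y' s' t' x x',
  `|s - s0| < d -> `|t - t0| < d -> `|y| < d -> `|y'| < d ->
  `|s' - s0| < d -> `|t' - t0| < d -> `|x| < d -> `|x'| < d ->
  `|Phi s t y y' - Phi s' t' x x' - ((s - s') *: v1 - (t - t') *: v2
    + (y - x) *: w1 - (y' - x') *: w2)|
  <= eta * (`|s - s'| + `|t - t'| + `|y - x| + `|y' - x'|).
Proof.
move=> eta0; have [d1 d10 H1] := fs eta0; have [d2 d20 H2] := gs eta0.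
exists (Num.min d1 d2); first by rewrite lt_min d10.
move=> s t y y' s' t' x x'; rewrite !lt_min.
move=> /andP[a1 a2] /andP[b1 b2] /andP[a3 a4] /andP[b3 b4].
move=> /andP[a5 a6] /andP[b5 b6] /andP[a7 a8] /andP[b7 b8].
have := H1 (pt s' x) (pt s y) (norm_ptB a5 a7) (norm_ptB a1 a3).
have := H2 (pt t' x') (pt t y') (norm_ptB b6 b8) (norm_ptB b2 b4).
rewrite !ptB !ptE0 !ptE1.
set E2 := (X in `|X| <= _ -> _); set E1 := (X in _ -> `|X| <= _ -> _).
move=> h2 h1.
set E := (X in `|X| <= _); have -> : E = E1 - E2.
  by rewrite /E /E1 /E2 /Phi; apply: plane_ext; rewrite !mxE; ring.
apply: le_trans (ler_normB _ _) _.
have k1 := ler_wpM2l (ltW eta0) (norm_pt (s - s') (y - x)).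
have k2 := ler_wpM2l (ltW eta0) (norm_pt (t - t') (y' - x')).
lra.
Qed.

(** Each of the two coordinates contributes at most [c * eta0 <= 1/4], so that the contraction
    factor is one half. *)
Let eta0 : R := (4 * (c + 1))^-1.
Let eta0_gt0 : 0 < eta0. Proof. by rewrite invr_gt0 mulr_gt0 // ltr_wpDl. Qed.
Let c_eta : c * eta0 <= 4^-1.
Proof.
rewrite /eta0 invfM mulrCA ler_piMr // ler_pdivrMr ?ltr_wpDl //.
by rewrite mul1r lerDl.
Qed.

(* Newton's map for the equation [Phi s t y y' = 0], with the derivative frozen at
   the crossing, is a contraction of a small ball around [(s0, t0)]. *)
Lemma crossing_solution : f (pt s0 0) = g (pt t0 0) ->
  exists2 d0, 0 < d0 & forall d, 0 < d < d0 ->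
  exists2 e0, 0 < e0 & forall y y', `|y| < e0 -> `|y'| < e0 -> exists s t,
    [set st : R * R | [/\ `|st.1 - s0| < d, `|st.2 - t0| < d &
       f (pt st.1 y) = g (pt st.2 y')]] = [set (s, t)].
Proof.
move=> fg0; have [d0 d00 H] := Phi_lin eta0_gt0.
exists d0 => // d /andP[d_gt0 dd0].
pose K := `|w1| + `|w2| + 2 * eta0.
have K0 : 0 < K by rewrite ltr_wpDl ?addr_ge0 // mulr_gt0.
(* [K] bounds [Phi s0 t0 y y'] per unit of height. For heights below this value the first Newton
   step from [(s0, t0)] has length at most [d / 4]. *)
exists (Num.min d0 (d / (4 * (c + 1) * K))).
  by rewrite lt_min d00 divr_gt0 // mulr_gt0 // mulr_gt0 // ltr_wpDl.
move=> y y'; rewrite !lt_min => /andP[yd ye] /andP[y'd y'e].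
pose N (z : plane R) : plane R := z - L (Phi (z 0 0) (z 0 1) y y').
pose z0 := pt s0 t0.
have zdist (z : plane R) r : `|z - z0| < r ->
    `|z 0 0 - s0| < r /\ `|z 0 1 - t0| < r.
  move=> zr; split; apply: le_lt_trans zr.
    by have := entry_le_norm (z - z0) 0 0; rewrite !mxE.
  by have := entry_le_norm (z - z0) 0 1; rewrite !mxE.
have Ncontr (z z' : plane R) : `|z - z0| < d0 -> `|z' - z0| < d0 ->
    `|N z - N z'| <= 2^-1 * `|z - z'|.
  move=> /zdist[z1 z2] /zdist[z3 z4].
  have := H _ _ y y' _ _ y y' z1 z2 yd y'd z3 z4 yd y'd.
  rewrite !subrr !scale0r addr0 subr0 normr0 !addr0.
  set E := Phi _ _ _ _ - Phi _ _ _ _ - _ => hE.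
  (* [L] inverts the linear part exactly, so only the linearization error survives. *)
  have -> : N z - N z' = - L E.
    rewrite /E LB LE LB /N; apply: plane_ext; rewrite !mxE /=; ring.
  rewrite normrN; apply: le_trans (L_le _) _.
  apply: le_trans (ler_wpM2l c_ge0 hE) _.
  have k1 := entry_le_norm (z - z') 0 0; have k2 := entry_le_norm (z - z') 0 1.
  rewrite !mxE in k1 k2; rewrite mulrA.
  apply: (@le_trans _ _ (4^-1 * (2 * `|z - z'|))); last by lra.
  apply: ler_pM => //; rewrite ?mulr_ge0 ?addr_ge0 // ?(ltW eta0_gt0) //; lra.
have Nz0 : `|N z0 - z0| <= d / 4.
  have yz : `|0 : R| < d0 by rewrite normr0.
  have sz : `|s0 - s0| < d0 by rewrite subrr normr0.
  have tz : `|t0 - t0| < d0 by rewrite subrr normr0.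
  have := H _ _ y y' _ _ 0 0 sz tz yd y'd sz tz yz yz.
  rewrite !subrr !scale0r !subr0 normr0 !add0r.
  have -> : Phi s0 t0 0 0 = 0 by rewrite /Phi fg0 subrr.
  rewrite subr0 => hE.
  have -> : N z0 - z0 = - L (Phi s0 t0 y y').
    by rewrite /N /z0 ptE0 ptE1; apply: plane_ext; rewrite !mxE; ring.
  rewrite normrN; apply: le_trans (L_le _) _.
  pose e1 := d / (4 * (c + 1) * K).
  have PK : `|Phi s0 t0 y y'| <= K * e1.
    rewrite -[X in `|X|](subrK (y *: w1 - y' *: w2)).
    apply: le_trans (ler_normD _ _) _.
    apply: le_trans (lerD hE (ler_normB _ _)) _; rewrite !normrZ.
    have k1 : `|y| * `|w1| <= e1 * `|w1|.
      by rewrite ler_wpM2r // ltW.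
    have k2 : `|y'| * `|w2| <= e1 * `|w2| by rewrite ler_wpM2r // ltW.
    have k3 := ler_wpM2l (ltW eta0_gt0) (lerD (ltW ye) (ltW y'e)).
    rewrite -/e1 in k3; rewrite /K; lra.
  apply: le_trans (ler_wpM2l c_ge0 PK) _.
  have -> : K * e1 = d / 4 / (c + 1).
    rewrite /e1 !invfM; field.
    by rewrite (gt_eqF K0) /= gt_eqF // ltr_wpDl.
  rewrite mulrCA ler_piMr ?divr_ge0 ?(ltW d_gt0) // ler_pdivrMr ?ltr_wpDl //.
  by rewrite mul1r lerDl.
(* A closed ball is preserved: [d / 4] from the contraction and [d / 4] from the first step. The
   fixed point is then strictly inside the window of size [d], and uniqueness in the whole window
   holds because the contraction is valid up to [d0]. *)
pose U := [set z : plane R | `|z - z0| <= d / 2].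
have UN : set_fun U U N.
  move=> z; rewrite /U /= => Uz.
  have -> : N z - z0 = (N z - N z0) + (N z0 - z0) by rewrite subrKA.
  apply: le_trans (ler_normD _ _) _.
  have h : `|z - z0| < d0 by lra.
  have h0 : `|z0 - z0| < d0 by rewrite subrr normr0.
  by have := Ncontr _ _ h h0; lra.
have clU : closed U.
  rewrite (_ : U = (fun z : plane R => `|z - z0|) @^-1` [set x | x <= d / 2]) //.
  apply: preimage_closed; last exact: closed_le.
  move=> z _; apply: (@continuous_comp _ _ _ (fun u : plane R => u - z0)).
    apply: (@continuousB _ _ _ id (cst z0)); last exact: cst_continuous.
    by move=> ?.
  exact: norm_continuous.
have [|//||z Uz zE] := @banach_fixed_point R ('rV[R]_2) U (mkfun UN).
- exists (2^-1)%:nng; split; first by rewrite /= invf_lt1 // ltr1n.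
  move=> -[z z'] [/= Uz Uz']; apply: Ncontr.
    by apply: le_lt_trans Uz _; lra.
  by apply: le_lt_trans Uz' _; lra.
- by exists z0; rewrite /U /= subrr normr0 divr_ge0 // ltW.
have {}zE : z = N z := zE.
have solP (x : plane R) : `|x - z0| < d0 ->
    f (pt (x 0 0) y) = g (pt (x 0 1) y') <-> x = N x.
  move=> xd; split=> [|xN].
    move=> fgx; rewrite /N /Phi fgx subrr -[in L 0](subrr (0 : plane R)) LB.
    by rewrite subrr subr0.
  have L0 : L (Phi (x 0 0) (x 0 1) y y') = 0.
    by apply: (addrI (N x)); rewrite {1}/N subrK addr0.
  by apply/eqP; rewrite -subr_eq0 -/(Phi _ _ _ _) (L_eq0 L0).
have zd : `|z - z0| < d by apply: le_lt_trans Uz _; lra.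
exists (z 0 0), (z 0 1); apply/seteqP; split=> [[s t] /= [sd td fgst]|_ ->] /=.
  have zst : pt s t = z.
    have std : `|pt s t - z0| < d0.
      apply: lt_trans dd0; rewrite ptB; apply: plane_norm_lt.
        by rewrite ptE0. by rewrite ptE1.
    have zd0 := lt_trans zd dd0.
    have /(solP _ std) Nst : f (pt (pt s t 0 0) y) = g (pt (pt s t 0 1) y').
      by rewrite ptE0 ptE1.
    have := Ncontr _ _ std zd0; rewrite -Nst -{1}zE => h.
    apply/eqP; rewrite -subr_eq0 -normr_eq0 eq_le normr_ge0 andbT.
    move: h; set a := `|_|; lra.
  by rewrite -zst ptE0 ptE1.
have [h1 h2] := zdist _ _ zd; split=> //.
by apply/solP => //; apply: lt_trans dd0.
Qed.

(** The two crossings satisfy [(s - s') *: v1 - (t - t') *: v2 = (x - x') *: w2] up to an error.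
    Taking [det2] with [v2] eliminates [t - t'] and leaves [(s - s') * det2 v1 v2 = - (x - x') *
    det2 v2 w2] plus an error too small to change the sign. *)
Lemma crossing_shift : det2 v2 w2 != 0 ->
  exists2 d, 0 < d & forall s s' t t' y x x',
  `|s - s0| < d -> `|s' - s0| < d -> `|t - t0| < d -> `|t' - t0| < d ->
  `|y| < d -> `|x| < d -> `|x'| < d ->
  f (pt s y) = g (pt t x) -> f (pt s' y) = g (pt t' x') -> x != x' ->
  ((s - s') * det2 v1 v2) * ((x - x') * det2 v2 w2) < 0.
Proof.
move=> D0; pose K := 4 * c * `|w2| + 2.
have K0 : 0 < K by rewrite ltr_wpDl // !mulr_ge0.
have V0 : 0 < `|v2| + 1 by rewrite ltr_wpDl.
(* [K] bounds the total displacement [B] in units of [|x - x'|]. This [eta1] makes [2 * |E| * |v2|]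
   at most half of the main term; the [+ 1] keeps the denominator positive. *)
pose eta1 := `|det2 v2 w2| / (4 * (`|v2| + 1) * K).
have eta10 : 0 < eta1 by rewrite divr_gt0 ?normr_gt0 // !mulr_gt0.
pose eta := Num.min eta0 eta1.
have eta_gt0 : 0 < eta by rewrite lt_min eta0_gt0.
have [d d0 H] := Phi_lin eta_gt0.
exists d => // s s' t t' y x x' sd s'd td t'd yd xd x'd fg fg' xx'.
have := H s t y x s' t' y x' sd td yd xd s'd t'd yd x'd.
rewrite /Phi fg fg' !subrr sub0r normrN scale0r addr0 normr0 addr0.
set E := _ - _ *: w2; set B := _ + _ + _ => hE.
have dE : (s - s') *: v1 - (t - t') *: v2 = (x - x') *: w2 + E.
  by rewrite [RHS]addrC /E subrK.
clearbody E.
have cE : `|L E| <= 4^-1 * B.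
  apply: le_trans (L_le _) _; apply: le_trans (ler_wpM2l c_ge0 hE) _.
  rewrite mulrA ler_wpM2r ?addr_ge0 // (le_trans _ c_eta) // ler_wpM2l //.
  by rewrite ge_min lexx.
have LD : pt (s - s') (t - t') = L E - L (- ((x - x') *: w2)).
  by rewrite -LB opprK [E + _]addrC -dE LE.
have nLD : `|pt (s - s') (t - t')| <= 4^-1 * B + c * (`|x - x'| * `|w2|).
  rewrite LD; apply: le_trans (ler_normB _ _) _; apply: lerD => //.
  by apply: le_trans (L_le _) _; rewrite normrN normrZ.
have h0 := le_trans (entry_le_norm _ 0 0) nLD.
have h1 := le_trans (entry_le_norm _ 0 1) nLD.
rewrite ptE0 in h0; rewrite ptE1 in h1.
have BK : B <= K * `|x - x'|.
  rewrite /K; move: h0 h1; rewrite /B.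
  set a := `|s - s'|; set b := `|t - t'|; set m := `|x - x'|; lra.
have m0 : 0 < `|x - x'| by rewrite normr_gt0 subr_eq0.
have sX : (s - s') * det2 v1 v2 = - ((x - x') * det2 v2 w2) + det2 E v2.
  have := congr1 (det2 ^~ v2) dE.
  rewrite -scaleNr !det2Dl !det2Zl det2vv mulr0 addr0 => ->.
  by rewrite [det2 w2 v2]det2C mulrN.
have dl : `|det2 E v2| < `|(x - x') * det2 v2 w2|.
  apply: le_lt_trans (det2_abs_le _ _) _.
  have E1 : `|E| <= eta1 * (K * `|x - x'|).
    apply: le_trans hE _; apply: (ler_pM (ltW eta_gt0) _ _ BK).
      by rewrite !addr_ge0.
    by rewrite /eta ge_min lexx orbT.
  have e1 : eta1 * (K * `|x - x'|) = `|det2 v2 w2| * `|x - x'| / (4 * (`|v2| + 1)).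
    by rewrite /eta1; field; rewrite (gt_eqF K0) (gt_eqF V0).
  rewrite e1 in E1.
  have D1 : 0 < `|det2 v2 w2| * `|x - x'| by rewrite mulr_gt0 // normr_gt0.
  have k1 : `|E| * (4 * (`|v2| + 1)) <= `|det2 v2 w2| * `|x - x'|.
    by rewrite -ler_pdivlMr // mulr_gt0.
  have nE : 0 <= `|E| by [].
  rewrite normrM [`|x - x'| * _]mulrC; nra.
move: dl; rewrite sX; set a := (x - x') * _; set b := det2 E v2 => dl.
have a0 : a != 0 by apply: contraTneq dl => ->; rewrite normr0 -leNgt.
have : `|b| * `|a| < `|a| * `|a| by rewrite ltr_pM2r ?normr_gt0.
rewrite -[ltRHS]expr2 real_normK ?num_real // -normrM expr2 => ba.
clearbody a b; have := ler_norm (b * a).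
have -> : (- a + b) * a = b * a - a * a by ring.
lra.
Qed.

End Solve.
End CrossingEquation.

(** * The sign formula *)

Section SignFormula.
Variables (R : realType) (M : surface R).
Implicit Types (C : lcurve M) (c : chart R M) (x : M) (s t d e : R).
Implicit Types (a b : label).

Lemma swap_labelK : involutive swap_label. Proof. by case. Qed.

Definition label_sign a b : gaussInt :=
  match a, b with
  | Rgt, Lft => 1 | Lft, Rgt => -1 | Rgt, Rgt => gauss_i | Lft, Lft => - gauss_i
  end.

(** Uniqueness of the input labels makes the order of the tests in [sign2f] immaterial and excludes
    its default value 0. *)
Lemma sign2f_input (C1 C2 : lcurve M) x a b :
  (forall a' b', input C1 C2 x a' b' <-> a' = a /\ b' = b) ->
  sign2f C1 C2 x = label_sign a b.
Proof.
move=> H; have F a' b' : `[< input C1 C2 x a' b' >] = `[< a' = a /\ b' = b >].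
  by apply/asboolP/asboolP => /H.
have T : `[< a = a /\ b = b >] by apply/asboolP.
have E (a' b' : label) : a' = swap_label a \/ b' = swap_label b ->
    `[< a' = a /\ b' = b >] = false.
  by move=> h; apply/asboolP => -[ea eb]; move: h; rewrite ea eb;
    case: (a) => -[] //; case: (b).
rewrite /sign2f !F {F H}; case: a b T E => -[] T E;
  rewrite ?T ?(E Rgt Lft) ?(E Lft Rgt) ?(E Rgt Rgt) ?(E Lft Lft) //=; auto.
Qed.

(* The sign of [side c C s] tells on which side of [C], in the chart [c], the
   component R(C) runs. *)
Definition side c C s : R := \det ('J (cmap c \o band C) (pt s 0)).
Definition transversal_dir c C s : plane R :=
  row 1 ('J (cmap c \o band C) (pt s 0)).

Section Band.
Variables (C : lcurve M) (c : chart R M) (s0 : R).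
Hypothesis Cc : cabling (crv C) (band C).
Hypothesis ac : atlas c.
Hypothesis cs : cdom c (C s0).

Lemma strip_axis s : @strip R (pt s 0).
Proof. by rewrite /strip /= ptE1 normr0. Qed.

Lemma near_strip s : \forall q \near pt s 0, @strip R q.
Proof.
apply/nbhs_normP; exists 1 => //= q qs; rewrite /strip /=.
apply: le_lt_trans qs.
by have := entry_le_norm (pt s 0 - q) 0 1; rewrite !mxE /= sub0r normrN.
Qed.

Lemma near_cdom : \forall q \near pt s0 0, strip q /\ cdom c (band C q).
Proof.
have [Bc _ B0 _] := Cc; near=> q; split; near: q; first exact: near_strip.
have [oc _ _ _ _] := atlas_chart ac.
apply: (Bc _ (strip_axis s0)); apply: open_nbhs_nbhs; split=> //.
by rewrite B0.
Unshelve. all: by end_near. Qed.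

Lemma is_derive_axis s : is_derive s 1 (fun u : R => pt u 0) (pt 1 0).
Proof.
rewrite (_ : (fun _ => _) = (fun u : R => pt 0 0 + u *: pt 1 0)).
  exact: is_derive_line.
by apply/funext => u; rewrite ptZ ptD; congr pt; ring.
Qed.

Lemma is_derive_velocity :
  is_derive s0 1 (cmap c \o C : R -> plane R) (row 0 ('J (cmap c \o band C) (pt s0 0))).
Proof.
have [_ _ B0 Bd] := Cc.
have cB : cdom c (band C (pt s0 0)) by rewrite B0.
have [df _ _] := Bd c ac _ (strip_axis s0) cB.
have := is_derive_comp_plane (is_derive_axis s0) df.
rewrite mulmx_pt scale1r scale0r addr0.
rewrite (_ : _ \o _ = cmap c \o C) //.
by apply/funext => u /=; rewrite B0.
Qed.

Lemma velocityE : velocity c C s0 = row 0 ('J (cmap c \o band C) (pt s0 0)).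
Proof. by have := is_derive_velocity; rewrite /velocity derive1E => /@derive_val. Qed.

Lemma sideE : side c C s0 = det2 (velocity c C s0) (transversal_dir c C s0).
Proof. by rewrite velocityE /side det_rows. Qed.

Lemma side_neq0 : side c C s0 != 0.
Proof.
have [_ _ B0 Bd] := Cc.
have cB : cdom c (band C (pt s0 0)) by rewrite B0.
by have [] := Bd c ac _ (strip_axis s0) cB.
Qed.

Lemma band_strict_diff : strict_diff (cmap c \o band C) (pt s0 0)
  (velocity c C s0) (transversal_dir c C s0).
Proof.
have [_ _ B0 Bd] := Cc.
have cB : cdom c (band C (pt s0 0)) by rewrite B0.
have [_ cf _] := Bd c ac _ (strip_axis s0) cB.
rewrite velocityE; apply: C1_strict_diff => //.
by apply: filterS near_cdom => q [sq cq]; have [] := Bd c ac q sq cq.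
Qed.

Lemma near_cdom_ball : exists2 d, 0 < d & forall s y, `|s - s0| < d -> `|y| < d ->
  cdom c (band C (pt s y)).
Proof.
have /nbhs_normP [d d0 H] := near_cdom; exists d => // s y sd yd.
apply: (proj2 (H (pt s y) _)); rewrite /= ptB sub0r.
by apply: plane_norm_lt; rewrite ?ptE0 ?ptE1 ?normrN // distrC.
Qed.

End Band.

Lemma det_col_mx2 (u v : plane R) : \det (col_mx u v : 'M[R]_2) = det2 u v.
Proof.
rewrite det_rows; congr det2; apply/rowP => j; rewrite !mxE.
  by case: split_ordP => k; rewrite ord1 // => /(congr1 val).
by case: split_ordP => k; rewrite ord1 // => /(congr1 val).
Qed.

Lemma transverse_det2 (C D : R -> M) c s t : atlas c -> cdom c (C s) ->
  transverse C D s t -> det2 (velocity c C s) (velocity c D t) != 0.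
Proof.
move=> ac cs /(_ c ac cs); rewrite -det_col_mx2 -unitfE -unitmxE.
by rewrite -row_free_unit.
Qed.

Lemma chart_inj c x y : atlas c -> cdom c x -> cdom c y -> cmap c x = cmap c y -> x = y.
Proof.
by move=> /atlas_chart[_ _ K _ _] cx cy e; rewrite -(K x cx) e K.
Qed.

(** As in a parallelogram, strand [b] of [C2] comes first along both strands of [C1], and strand [a]
    of [C1] first along both strands of [C2]. This rules out a second input crossing. *)
Definition labeled_pattern (C1 C2 : lcurve M) s0 t0 (a b : label) d e S T :=
  pattern C1 C2 s0 t0 d e S T /\
  forall a' b', (S a' b' < S a' (swap_label b') <-> b' = b) /\
               (T a' b' < T (swap_label a') b' <-> a' = a).

Definition label_of (p : bool) := if p then Rgt else Lft.

(** Turns the inequality of [crossing_shift] into a label: the two heights differ by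
    [2 * level b e], so the strand at positive height comes first exactly when [D * X] is
    positive. *)
Lemma shift_label e k X D b : 0 < e -> D * X != 0 ->
  (k * X) * ((level b e - level (swap_label b) e) * D) < 0 ->
  k < 0 <-> b = label_of (0 < D * X).
Proof.
move=> e0 DX0.
have -> : (k * X) * ((level b e - level (swap_label b) e) * D) =
    (level b e - level (swap_label b) e) * (k * (D * X)) by ring.
move: DX0; set P := D * X => P0.
have -> : level b e - level (swap_label b) e = 2 * level b e by case: b => /=; ring.
rewrite -mulrA pmulr_rlt0 //.
have [Pp|Pn|PE] := ltrgtP 0 P; last by rewrite PE eqxx in P0.
  case: b => /=; last by rewrite pmulr_rlt0 // pmulr_llt0 // => k0; split.
  rewrite mulNr oppr_lt0 pmulr_rgt0 // pmulr_lgt0 // => k0.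
  by split=> // /(lt_trans k0); rewrite ltxx.
case: b => /=.
  by rewrite mulNr oppr_lt0 pmulr_rgt0 // nmulr_lgt0 // => k0; split.
rewrite pmulr_rlt0 // nmulr_llt0 // => k0.
by split=> // /(lt_trans k0); rewrite ltxx.
Qed.

(** [crossing_solution] gives one crossing for each pair of labels, with a bound on [e] common to
    all heights, and [crossing_shift], used once along each curve, orders them. Taking [d] below the
    radii of [near_cdom_ball] keeps the bands in the chart, where an equality of images is an
    equality of points. *)
Lemma pattern_exists (C1 C2 : lcurve M) c s0 t0 :
  cabling (crv C1) (band C1) -> cabling (crv C2) (band C2) ->
  atlas c -> cdom c (C1 s0) -> C1 s0 = C2 t0 ->
  let X := det2 (velocity c C1 s0) (velocity c C2 t0) in
  X != 0 ->
  \forall d \near 0^'+, \forall e \near 0^'+, exists S T,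
    labeled_pattern C1 C2 s0 t0 (label_of (side c C1 s0 * X < 0))
      (label_of (0 < side c C2 t0 * X)) d e S T.
Proof.
move=> cC1 cC2 ac cs st X X0.
have ct : cdom c (C2 t0) by rewrite -st.
have f1 := band_strict_diff cC1 ac cs; have f2 := band_strict_diff cC2 ac ct.
have D1 := side_neq0 cC1 ac cs; have D2 := side_neq0 cC2 ac ct.
rewrite (sideE cC1 ac cs) in D1 *; rewrite (sideE cC2 ac ct) in D2 *.
have fg0 : (cmap c \o band C1) (pt s0 0) = (cmap c \o band C2) (pt t0 0).
  have [_ _ B1 _] := cC1; have [_ _ B2 _] := cC2.
  by rewrite /= B1 B2 st.
move: f1 f2 D1 D2 X0; rewrite {}/X.
move: (velocity c C1 s0) (velocity c C2 t0) (transversal_dir c C1 s0)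
  (transversal_dir c C2 t0) => v1 v2 w1 w2 f1 f2 D1 D2 X0.
have X0' : det2 v2 v1 != 0 by rewrite det2C oppr_eq0.
have [d0 d00 H0] := crossing_solution f1 f2 X0 fg0.
have [d1 d10 H1] := crossing_shift f1 f2 X0 D2.
have [d2 d20 H2] := crossing_shift f2 f1 X0' D1.
have [d3 d30 H3] := near_cdom_ball cC1 ac cs.
have [d4 d40 H4] := near_cdom_ball cC2 ac ct.
near=> d.
have d_gt0 : 0 < d by [].
have dd0 : d < d0 by near: d; apply: nbhs_right_lt.
have dd1 : d < d1 by near: d; apply: nbhs_right_lt.
have dd2 : d < d2 by near: d; apply: nbhs_right_lt.
have dd3 : d < d3 by near: d; apply: nbhs_right_lt.
have dd4 : d < d4 by near: d; apply: nbhs_right_lt.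
have [|e0 e00 He] := H0 d; first by rewrite d_gt0.
near=> e.
have e_gt0 : 0 < e by [].
have ee0 : e < e0 by near: e; apply: nbhs_right_lt.
have ed : e < d by near: e; apply: nbhs_right_lt.
have lev a : `|level a e| = e by case: a; rewrite /= ?normrN gtr0_norm.
have sol (ab : label * label) : exists st : R * R,
    [set st : R * R | [/\ `|st.1 - s0| < d, `|st.2 - t0| < d &
       strand C1 ab.1 e st.1 = strand C2 ab.2 e st.2]] = [set st].
  have [||s [t stE]] := He (level ab.1 e) (level ab.2 e); rewrite ?lev //.
  exists (s, t); rewrite -stE; apply/seteqP.
  split=> -[s' t'] /= [s'd t'd e']; split=> //; first by rewrite -/(strand C1 ab.1 e s') e'.
  apply: (chart_inj ac _ _ e').
    by apply: H3; [exact: lt_trans dd3|rewrite lev (lt_trans ed)].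
  by apply: H4; [exact: lt_trans dd4|rewrite lev (lt_trans ed)].
have [F FE] := choice sol.
pose S a b := (F (a, b)).1; pose T a b := (F (a, b)).2.
have patt : pattern C1 C2 s0 t0 d e S T.
  by move=> a b; rewrite (FE (a, b)) /S /T; case: (F _).
have FP a b : [/\ `|S a b - s0| < d, `|T a b - t0| < d &
    (cmap c \o band C1) (pt (S a b) (level a e)) =
    (cmap c \o band C2) (pt (T a b) (level b e))].
  have : [set st : R * R | [/\ `|st.1 - s0| < d, `|st.2 - t0| < d &
       strand C1 a e st.1 = strand C2 b e st.2]] (S a b, T a b) by rewrite patt.
  by move=> /= [h1 h2 h3]; split=> //=; congr cmap.
have eNe : - e < e by rewrite (@lt_trans _ _ 0) ?oppr_lt0.
have lev_neq a : level a e != level (swap_label a) e.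
  by case: a => /=; [rewrite lt_eqF|rewrite gt_eqF].
have levd1 a : `|level a e| < d1 by rewrite lev (lt_trans ed).
have levd2 a : `|level a e| < d2 by rewrite lev (lt_trans ed).
exists S, T; split=> // a b; have [p1 p2 p3] := FP a b; split.
  have [q1 q2 q3] := FP a (swap_label b).
  rewrite -subr_lt0; apply: (shift_label e_gt0); first by rewrite mulf_neq0.
  exact: (H1 _ _ _ _ _ _ _ (lt_trans p1 dd1) (lt_trans q1 dd1) (lt_trans p2 dd1)
    (lt_trans q2 dd1) (levd1 _) (levd1 _) (levd1 _) p3 q3 (lev_neq b)).
have [q1 q2 q3] := FP (swap_label a) b.
(* Exchanging the roles of the curves reverses the determinant of the velocities; hence the opposite
   inequality in the label of [C1]. *)
rewrite -subr_lt0 (_ : (_ * _ < 0) = (0 < det2 v1 w1 * det2 v2 v1)); last first.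
  by rewrite [det2 v2 v1]det2C mulrN oppr_gt0.
apply: (shift_label e_gt0); first by rewrite mulf_neq0.
exact: (H2 _ _ _ _ _ _ _ (lt_trans p2 dd2) (lt_trans q2 dd2) (lt_trans p1 dd2)
  (lt_trans q1 dd2) (levd2 _) (levd2 _) (levd2 _) (esym p3) (esym q3) (lev_neq a)).
Unshelve. all: by end_near. Qed.

Lemma input_iff (C1 C2 : lcurve M) c x :
  cabling (crv C1) (band C1) -> cabling (crv C2) (band C2) ->
  atlas c -> cdom c x -> C1 (param C1 x) = x -> C2 (param C2 x) = x ->
  let X := det2 (velocity c C1 (param C1 x)) (velocity c C2 (param C2 x)) in
  X != 0 -> forall a b, input C1 C2 x a b <->
    a = label_of (side c C1 (param C1 x) * X < 0) /\
    b = label_of (0 < side c C2 (param C2 x) * X).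
Proof.
move=> cC1 cC2 ac cx e1 e2 X X0 a b.
have cs : cdom c (C1 (param C1 x)) by rewrite e1.
have P := pattern_exists cC1 cC2 ac cs (etrans e1 (esym e2)) X0.
split=> [inp|[-> ->]]; last first.
  apply: filterS P => d; apply: filterS => e [S [T [P H]]].
  by exists S, T; split=> //; apply H.
(* A single common pair [(d, e)] suffices, because [pattern] determines [S] and [T]: the witnesses
   of [input] are those of [pattern_exists]. *)
near (0 : R)^'+ => d.
near (0 : R)^'+ => e.
have [S [T [P' H]]] : exists S T, labeled_pattern C1 C2 (param C1 x) (param C2 x)
    (label_of (side c C1 (param C1 x) * X < 0))
    (label_of (0 < side c C2 (param C2 x) * X)) d e S T.
  by near: e; near: d.
have [S' [T' [Q h1 h2]]] : exists S T,
    [/\ pattern C1 C2 (param C1 x) (param C2 x) d e S T,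
        S a b < S a (swap_label b) & T a b < T (swap_label a) b].
  by near: e; near: d.
have ST a' b' : (S a' b', T a' b') = (S' a' b', T' a' b').
  have : [set (S a' b', T a' b')] (S' a' b', T' a' b') by rewrite -P' Q.
  by move=> /= <-.
have SE a' b' : S a' b' = S' a' b' by have [] := ST a' b'.
have TE a' b' : T a' b' = T' a' b' by have [] := ST a' b'.
by rewrite -!SE in h1; rewrite -!TE in h2; have [Hb Ha] := H a b; split; [apply/Ha|apply/Hb].
Unshelve. all: by end_near. Qed.

Lemma sign2fE (C1 C2 : lcurve M) c x :
  cabling (crv C1) (band C1) -> cabling (crv C2) (band C2) ->
  atlas c -> cdom c x -> C1 (param C1 x) = x -> C2 (param C2 x) = x ->
  let X := det2 (velocity c C1 (param C1 x)) (velocity c C2 (param C2 x)) in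
  X != 0 -> sign2f C1 C2 x =
    label_sign (label_of (side c C1 (param C1 x) * X < 0))
               (label_of (0 < side c C2 (param C2 x) * X)).
Proof.
by move=> *; apply: sign2f_input => a b; apply: input_iff.
Qed.

Lemma loop_int (C : R -> M) s (m : int) : loop C -> C (s + m%:~R) = C s.
Proof.
move=> [_ p]; have pn n : forall s, C (s + n%:R) = C s.
  elim: n => [|n IH] u; first by rewrite addr0.
  by rewrite -natr1 addrA p IH.
case: m => n; first by rewrite -pmulrn pn.
by rewrite NegzE mulrNz -{2}(subrK (n.+1%:R) s) pn.
Qed.

Lemma floor_itv01 s : 0 <= s - (Num.floor s)%:~R < 1.
Proof. by rewrite subr_ge0 ltrBlDr floor_le addrC -intrD1 floorD1_gt. Qed.

Lemma param_spec (C : R -> M) x : loop C -> range C x ->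
  0 <= param C x < 1 /\ C (param C x) = x.
Proof.
move=> lC [s _ sx]; apply: (@xgetPex _ 0 [set s | 0 <= s < 1 /\ C s = x]).
exists (s - (Num.floor s)%:~R); split; first exact: floor_itv01.
by rewrite -mulrNz loop_int.
Qed.

Lemma lcurve_loop C : labeled_curve C -> loop C.
Proof. by move=> [[]]. Qed.
Lemma lcurve_cabling C : labeled_curve C -> cabling (crv C) (band C).
Proof. by move=> []. Qed.

Section Crossing.
Variables (C1 C2 : lcurve M) (x : M).
Hypothesis A : admissible C1 C2.
Hypothesis xX : crossings C1 C2 x.

Lemma crossing_param :
  [/\ 0 <= param C1 x < 1, C1 (param C1 x) = x, 0 <= param C2 x < 1 &
      C2 (param C2 x) = x].
Proof.
have [/lcurve_loop l1 /lcurve_loop l2 _ _] := A; have [r1 r2] := xX.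
by have [? ?] := param_spec l1 r1; have [? ?] := param_spec l2 r2.
Qed.

Lemma crossing_transverse c : atlas c -> cdom c x ->
  det2 (velocity c C1 (param C1 x)) (velocity c C2 (param C2 x)) != 0.
Proof.
move=> ac cx; have [p1 e1 p2 e2] := crossing_param.
have [_ _ _ T] := A; have [tr _ _] := T _ _ p1 p2 (etrans e1 (esym e2)).
by apply: (transverse_det2 ac) tr; rewrite e1.
Qed.

(** By [admissible], a crossing of the two curves is not a double point of either one, so its
    parameter is unique modulo 1. *)
Lemma crossing_param1 s : C1 s = x -> exists m : int, s = param C1 x + m%:~R.
Proof.
move=> sx; have [p1 e1 p2 e2] := crossing_param; have [L1 _ _ T] := A.
have [_ u _] := T _ _ p1 p2 (etrans e1 (esym e2)).
exists (Num.floor s); rewrite -(u (s - (Num.floor s)%:~R)) ?subrK ?floor_itv01 //.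
by rewrite -mulrNz (loop_int _ _ (lcurve_loop L1)) sx.
Qed.

Lemma crossing_param2 s : C2 s = x -> exists m : int, s = param C2 x + m%:~R.
Proof.
move=> sx; have [p1 e1 p2 e2] := crossing_param; have [_ L2 _ T] := A.
have [_ _ u] := T _ _ p1 p2 (etrans e1 (esym e2)).
exists (Num.floor s); rewrite -(u (s - (Num.floor s)%:~R)) ?subrK ?floor_itv01 //.
by rewrite -mulrNz (loop_int _ _ (lcurve_loop L2)) sx.
Qed.

Lemma crossing_sign c : atlas c -> cdom c x ->
  let X := det2 (velocity c C1 (param C1 x)) (velocity c C2 (param C2 x)) in
  sign2f C1 C2 x =
    label_sign (label_of (side c C1 (param C1 x) * X < 0))
               (label_of (0 < side c C2 (param C2 x) * X)).
Proof.
move=> ac cx; have [p1 e1 p2 e2] := crossing_param; have [L1 L2 _ _] := A.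
apply: sign2fE => //; try exact: lcurve_cabling.
exact: crossing_transverse.
Qed.

Lemma crossing_input : exists a b,
  forall a' b', input C1 C2 x a' b' <-> a' = a /\ b' = b.
Proof.
have [c ac cx] := atlas_cover x.
have [p1 e1 p2 e2] := crossing_param; have [L1 L2 _ _] := A.
eexists; eexists => a b; apply: (input_iff _ _ ac cx e1 e2);
  [exact: lcurve_cabling..|exact: crossing_transverse].
Qed.

End Crossing.

Lemma strand_relabel C a e s : strand (relabel C) a e s = strand C (swap_label a) e s.
Proof.
by rewrite /strand /= ptE0 ptE1; case: a => //=; rewrite opprK.
Qed.

(** Relabeling renames the strands without moving them, so the witnesses are merely reindexed. One
    implication is proved directly; the other follows because relabeling is an involution. *)
Lemma input_relabel1 (C1 C2 : lcurve M) x a b :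
  input (relabel C1) C2 x a b <-> input C1 C2 x (swap_label a) b.
Proof.
have H (D1 D2 : lcurve M) a' b' : input D1 D2 x a' b' ->
    input (relabel D1) D2 x (swap_label a') b'.
  move=> h; apply: filterS h => d; apply: filterS => e [S [T [P h1 h2]]].
  exists (fun a => S (swap_label a)), (fun a => T (swap_label a)).
  rewrite !swap_labelK; split=> // a'' b''.
  by rewrite -P; apply/eq_set => st; rewrite strand_relabel.
split=> [/H|h]; last by rewrite -[a]swap_labelK; exact: H.
suff -> : relabel (relabel C1) = C1 by [].
case: C1 {H} => C B; congr LCurve; apply/funext => p /=.
by rewrite ptE0 ptE1 opprK pt_eta.
Qed.

Lemma input_relabel2 (C1 C2 : lcurve M) x a b :
  input C1 (relabel C2) x a b <-> input C1 C2 x a (swap_label b).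
Proof.
have H (D1 D2 : lcurve M) a' b' : input D1 D2 x a' b' ->
    input D1 (relabel D2) x a' (swap_label b').
  move=> h; apply: filterS h => d; apply: filterS => e [S [T [P h1 h2]]].
  exists (fun a b => S a (swap_label b)), (fun a b => T a (swap_label b)).
  rewrite !swap_labelK; split=> // a'' b''.
  by rewrite -P; apply/eq_set => st; rewrite strand_relabel.
split=> [/H|h]; last by rewrite -[b]swap_labelK; exact: H.
suff -> : relabel (relabel C2) = C2 by [].
case: C2 {H} => C B; congr LCurve; apply/funext => p /=.
by rewrite ptE0 ptE1 opprK pt_eta.
Qed.

(** The input crossing stays where it is and only its labels change, so each rule is a check on four
    values: swapping the first label exchanges $1$ with $-i$ and $-1$ with $i$, swapping the second
    exchanges $1$ with $i$ and $-1$ with $-i$. *)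
Lemma sign2f_relabel (C1 C2 : lcurve M) x :
  admissible C1 C2 -> crossings C1 C2 x ->
  [/\ sign2f (relabel C1) C2 x = gauss_swap (- sign2f C1 C2 x),
      sign2f C1 (relabel C2) x = gauss_swap (sign2f C1 C2 x) &
      sign2f (relabel C1) (relabel C2) x = - sign2f C1 C2 x].
Proof.
move=> A xX; have [a [b ab]] := crossing_input A xX.
have swapE a' b' : swap_label a' = b' <-> a' = swap_label b'.
  by split=> [<-|->]; rewrite swap_labelK.
rewrite (sign2f_input ab).
rewrite (@sign2f_input (relabel C1) C2 x (swap_label a) b); last first.
  by move=> a' b'; rewrite input_relabel1 ab swapE.
rewrite (@sign2f_input C1 (relabel C2) x a (swap_label b)); last first.
  by move=> a' b'; rewrite input_relabel2 ab swapE.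
rewrite (@sign2f_input (relabel C1) (relabel C2) x (swap_label a) (swap_label b)).
  by case: a b {ab} => -[]; split.
by move=> a' b'; rewrite input_relabel1 input_relabel2 ab !swapE.
Qed.

End SignFormula.

(** * From the set-theoretic side of a band to the sign of a determinant *)

Section SameSide.
Variable R : realType.
Implicit Types (p q u v w : plane R) (s t e d : R).

Lemma differentiable_bound (f : plane R -> plane R) p : differentiable f p ->
  forall eta, 0 < eta -> exists2 d, 0 < d & forall q, `|q - p| < d ->
    `|f q - f p - (q - p) *m 'J f p| <= eta * `|q - p|.
Proof.
move=> /diff_locallyP[_ /eqaddoP H] eta eta0.
have /nbhs_normP[d d0 Hd] := H eta eta0.
exists d => // q qd; have := Hd (q - p); rewrite /= sub0r normrN => /(_ qd).
rewrite /jacobian mul_rV_lin1 /=.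
rewrite -![(_ - _) _]/(_ - _) -![(_ + _) _]/(_ + _) /= subrK opprD addrA.
by [].
Qed.

(* The curve [e |-> G (s1, e)] enters the half of the immersed strip [F] above
   its axis, hence its velocity points to that side. *)
Lemma side_transport (F G : plane R -> plane R) s0 s1 k :
  differentiable F (pt s0 0) -> differentiable G (pt s1 0) ->
  F (pt s0 0) = G (pt s1 0) ->
  (forall d, 0 < d -> \forall e \near 0^'+, exists s' e',
     [/\ `|s' - s0| < d, 0 < e' < d & G (pt s1 e) = F (pt s' e')]) ->
  0 < k -> row 0 ('J G (pt s1 0)) = k *: row 0 ('J F (pt s0 0)) ->
  \det ('J F (pt s0 0)) != 0 -> \det ('J G (pt s1 0)) != 0 ->
  0 < \det ('J F (pt s0 0)) * \det ('J G (pt s1 0)).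
Proof.
move=> /differentiable_bound dF /differentiable_bound dG FG H k0.
move: ('J F (pt s0 0)) ('J G (pt s1 0)) dF dG => JF JG dF dG.
rewrite !det_rows => ->; rewrite det2Zl.
have {}dF eta : 0 < eta -> exists2 d, 0 < d & forall s e,
    `|s - s0| < d -> `|e| < d ->
    `|F (pt s e) - F (pt s0 0) - ((s - s0) *: row 0 JF
       + e *: row 1 JF)| <= eta * (`|s - s0| + `|e|).
  move=> eta0; have [d d0 Hd] := dF eta eta0; exists d => // s e sd ed.
  have := Hd (pt s e); rewrite ptB subr0 mulmx_pt => Hs.
  apply: le_trans (Hs _) _; first by apply: plane_norm_lt; rewrite ?ptE0 ?ptE1.
  rewrite ler_wpM2l ?(ltW eta0) //.
  by apply: plane_norm_le; rewrite ?ptE0 ?ptE1 ?lerDl ?lerDr.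
have {}dG eta : 0 < eta -> exists2 d, 0 < d & forall e, `|e| < d ->
    `|G (pt s1 e) - G (pt s1 0) - e *: row 1 JG| <= eta * `|e|.
  move=> eta0; have [d d0 Hd] := dG eta eta0; exists d => // e ed.
  have := Hd (pt s1 e); rewrite ptB subr0 subrr mulmx_pt scale0r add0r => Hs.
  apply: le_trans (Hs _) _.
    by apply: plane_norm_lt; rewrite ?ptE0 ?ptE1 ?normr0 // (le_lt_trans _ ed).
  rewrite ler_wpM2l ?(ltW eta0) //.
  by apply: plane_norm_le; rewrite ?ptE0 ?ptE1 ?normr0.
move: (row 0 JF) (row 1 JF) (row 1 JG) dF dG => v w w' dF dG.
move=> D0; rewrite mulf_eq0 (gt_eqF k0) /= => D0'.
rewrite mulrCA pmulr_rgt0 //.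
(* If [D = det2 v w] and [D' = det2 v w'] had opposite signs, then [|e * D' - e' * D| >= e * |D'|],
   since [e'] is positive. But equating the two expansions of the common point shows that
   [e * D' - e' * D] is an error of size at most [K * eta * e]. *)
rewrite lt_neqAle eq_sym mulf_neq0 //= leNgt; apply/negP => neg.
pose D := det2 v w; pose D' := det2 v w'.
pose c : R := 2 * (`|v| + `|w|) / `|D|.
have absD : 0 < `|D| by rewrite normr_gt0.
have absD' : 0 < `|D'| by rewrite normr_gt0.
have c0 : 0 <= c by rewrite divr_ge0 // mulr_ge0 // addr_ge0.
pose K := 2 * (`|v| + 1) * (1 + 4 * c * (`|w'| + 1)).
have K0 : 0 < K.
  have : 0 <= 4 * c * (`|w'| + 1) by rewrite mulr_ge0 ?mulr_ge0 ?addr_ge0.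
  move=> h; apply: mulr_gt0; last by lra.
  by rewrite mulr_gt0 // ltr_wpDl.
(* The first bound controls the error along [G], the second lets [Q] be absorbed in its own
   estimate, and the third gives the final contradiction. *)
pose eta := Num.min (Num.min 1 (4 * (c + 1))^-1) (`|D'| / (2 * K)).
have c10 : 0 < 4 * (c + 1) by rewrite mulr_gt0 // ltr_wpDl.
have eta0 : 0 < eta by rewrite !lt_min ltr01 invr_gt0 c10 divr_gt0 // mulr_gt0.
have eta1 : eta <= 1 by rewrite /eta !ge_min lexx.
have ceta : c * eta <= 4^-1.
  have : eta <= (4 * (c + 1))^-1 by rewrite /eta !ge_min lexx orbT.
  move=> /(ler_wpM2l c0) /le_trans; apply.
  rewrite invfM mulrCA ler_piMr // ler_pdivrMr ?ltr_wpDl //; lra.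
have Keta : K * eta < `|D'|.
  have : eta <= `|D'| / (2 * K) by rewrite /eta ge_min lexx orbT.
  move=> /(ler_wpM2l (ltW K0)) /le_lt_trans; apply.
  have -> : K * (`|D'| / (2 * K)) = `|D'| / 2 by field; rewrite gt_eqF.
  lra.
have [d1 d10 HF] := dF eta eta0; have [d2 d20 HG] := dG eta eta0.
near (0 : R)^'+ => e.
have e0 : 0 < e by [].
have ed2 : `|e| < d2 by rewrite gtr0_norm //; near: e; apply: nbhs_right_lt.
have [s' [e' [sd /andP[e'0 e'd] GF]]] : exists s' e',
     [/\ `|s' - s0| < d1, 0 < e' < d1 & G (pt s1 e) = F (pt s' e')].
  by near: e; exact: H.
have := HG e ed2; rewrite GF -FG.
have := HF s' e' sd; rewrite gtr0_norm // => /(_ e'd).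
move: (F (pt s' e') - F (pt s0 0)) => P; rewrite (gtr0_norm e0).
set E1 := P - _; set E2 := P - e *: w' => hE1 hE2.
have PE1 : P = (s' - s0) *: v + e' *: w + E1 by rewrite /E1 addrC subrK.
have PE2 : P = e *: w' + E2 by rewrite /E2 addrC subrK.
clearbody E1 E2.
have eq : (s' - s0) *: v + e' *: w = e *: w' + E2 - E1.
  by rewrite -PE2 PE1 addrK.
pose Q := `|s' - s0| + e'.
have nU : `|e *: w' + E2 - E1| <= (`|w'| + 1) * e + eta * Q.
  apply: le_trans (ler_normB _ _) _; apply: lerD => //.
  apply: le_trans (ler_normD _ _) _; rewrite normrZ (gtr0_norm e0).
  have : eta * e <= 1 * e by rewrite ler_wpM2r // ltW.
  lra.
have a1 : (s' - s0) * D = det2 (e *: w' + E2 - E1) w.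
  by rewrite -eq det2Dl !det2Zl det2vv mulr0 addr0.
have a2 : e' * D = det2 v (e *: w' + E2 - E1).
  by rewrite -eq det2Dr !det2Zr det2vv mulr0 add0r.
have Qc : Q <= c * ((`|w'| + 1) * e + eta * Q).
  have h1 := det2_abs_le (e *: w' + E2 - E1) w.
  have h2 := det2_abs_le v (e *: w' + E2 - E1).
  rewrite -a1 normrM in h1; rewrite -a2 normrM (gtr0_norm e'0) in h2.
  rewrite /c mulrAC ler_pdivlMr // [in leLHS]/Q mulrDl.
  have v0 : 0 <= `|v| by []. have w0 : 0 <= `|w| by [].
  have := ler_wpM2l v0 nU; have := ler_wpM2l w0 nU.
  move: h1 h2; clearbody Q.
  move: `|_ + _ - _| => U; lra.
have Q0 : 0 <= Q by rewrite addr_ge0 // ltW.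
have Q1 : Q <= 2 * c * (`|w'| + 1) * e.
  have := ler_wpM2r Q0 ceta; lra.
have lin : e * D' - e' * D = det2 v (E1 - E2).
  by rewrite a2 /D' /det2 !mxE; ring.
have bnd : `|e * D' - e' * D| <= 2 * `|v| * (eta * (Q + e)).
  rewrite lin; apply: le_trans (det2_abs_le _ _) _.
  rewrite ler_wpM2l ?mulr_ge0 //; apply: le_trans (ler_normB _ _) _.
  by rewrite mulrDr lerD.
have low : e * `|D'| <= `|e * D' - e' * D|.
  have e'D : 0 <= e' * `|D| by rewrite mulr_ge0 // ltW.
  move: neg; rewrite -/D -/D'.
  have [Dp|Dn|DE] := ltrgtP 0 D; last by move: absD; rewrite -DE normr0 ltxx.
    rewrite pmulr_rlt0 // => D'n; rewrite (ltr0_norm D'n) (gtr0_norm Dp) in e'D *.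
    rewrite -normrN; apply: le_trans (ler_norm _); lra.
  rewrite nmulr_rlt0 // => D'p; rewrite (gtr0_norm D'p) (ltr0_norm Dn) in e'D *.
  apply: le_trans (ler_norm _); lra.
have : 2 * `|v| * (eta * (Q + e)) <= K * eta * e.
  rewrite /K.
  pose Z := 1 + 4 * c * (`|w'| + 1).
  have cw0 : 0 <= c * (`|w'| + 1) by rewrite mulr_ge0 ?addr_ge0.
  have q1 : Q + e <= Z * e.
    have := mulr_ge0 cw0 (ltW e0); rewrite /Z; lra.
  have ev0 : 0 <= eta * `|v| by rewrite mulr_ge0 // ltW.
  have := ler_wpM2l ev0 q1.
  have : 0 <= eta * (Z * e).
    by rewrite !mulr_ge0 ?(ltW eta0) ?(ltW e0) //; rewrite /Z; lra.
  rewrite -/Z; lra.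
have : K * eta * e < `|D'| * e by rewrite ltr_pM2r.
lra.
Unshelve. all: by end_near. Qed.

End SameSide.

(** * Homotopies of smoothed loops *)

Section Pasting.
Variable R : realType.

Lemma continuous_paste (S T : topologicalType) (A B : S -> T) (phi : S -> R) r :
  continuous A -> continuous B -> continuous phi ->
  (forall z, phi z = r -> A z = B z) ->
  continuous (fun z => if phi z < r then A z else B z).
Proof.
move=> cA cB cphi AB z W Wz.
suff: \forall z' \near z, W (if phi z' < r then A z' else B z') by [].
move: Wz => /=.
have nA : nbhs (A z) W -> \forall z' \near z, W (A z') by exact: cA.
have nB : nbhs (B z) W -> \forall z' \near z, W (B z') by exact: cB.
have [zr|rz|zr] := ltrgtP (phi z) r => Wz.
- have lt : \forall z' \near z, phi z' < r.
    by apply: (cphi z [set x | x < r]); apply: open_nbhs_nbhs; split=> //; exact: open_lt.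
  by near=> z'; rewrite ifT; near: z'; [exact: nA|].
- have lt : \forall z' \near z, r < phi z'.
    by apply: (cphi z [set x | r < x]); apply: open_nbhs_nbhs; split=> //; exact: open_gt.
  by near=> z'; rewrite ltNge ltW /=; near: z'; [exact: nB|].
- have WA : \forall z' \near z, W (A z') by apply: nA; rewrite (AB _ zr).
  have WB := nB Wz.
  by near=> z'; case: ifP => _; near: z'.
Unshelve. all: by end_near. Qed.

Lemma continuous_pair_fun (S T U : topologicalType) (f : S -> T) (g : S -> U) :
  continuous f -> continuous g -> continuous (fun z => (f z, g z)).
Proof. by move=> cf cg z; apply: cvg_pair; [exact: cf|exact: cg]. Qed.

Lemma continuous_addR (S : topologicalType) (f g : S -> R) :
  continuous f -> continuous g -> continuous (fun z => f z + g z).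
Proof. by move=> cf cg z; apply: cvgD; [exact: cf|exact: cg]. Qed.

Lemma continuous_subR (S : topologicalType) (f g : S -> R) :
  continuous f -> continuous g -> continuous (fun z => f z - g z).
Proof. by move=> cf cg z; apply: cvgB; [exact: cf|exact: cg]. Qed.

Lemma continuous_mulR (S : topologicalType) (f g : S -> R) :
  continuous f -> continuous g -> continuous (fun z => f z * g z).
Proof. by move=> cf cg z; apply: cvgM; [exact: cf|exact: cg]. Qed.

Lemma continuous_composition (S T U : topologicalType) (f : S -> T) (g : T -> U) :
  continuous f -> continuous g -> continuous (fun z => g (f z)).
Proof. by move=> cf cg z; apply: continuous_comp; [exact: cf|exact: cg]. Qed.

Lemma continuous_fst (S T : topologicalType) : continuous (fun z : S * T => z.1).
Proof. by move=> z; exact: cvg_fst. Qed.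

Lemma continuous_snd (S T : topologicalType) : continuous (fun z : S * T => z.2).
Proof. by move=> z; exact: cvg_snd. Qed.

Definition clamp (a b x : R) : R := Num.max a (Num.min b x).

Lemma clamp_id a b x : a <= x <= b -> clamp a b x = x.
Proof. by move=> /andP[ax xb]; rewrite /clamp min_r // max_r. Qed.

Lemma clamp_itv a b x : a <= b -> a <= clamp a b x <= b.
Proof. by move=> ab; rewrite /clamp le_max lexx /= ge_max ab ge_min lexx. Qed.

Lemma continuous_clamp (S : topologicalType) a b (f : S -> R) :
  continuous f -> continuous (fun z => clamp a b (f z)).
Proof.
move=> cf z.
have ca y : {for z, continuous (cst y : S -> R^o)} by exact: cst_continuous.
have cfz : {for z, continuous (f : S -> R^o)} by exact: cf.
exact: (continuous_max (ca a) (continuous_min (ca b) cfz)).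
Qed.

(** A map on the fundamental domain [[p, p + 1]] with matching ends extends periodically. At a jump
    of the floor, the nearby points use one of two consecutive translates, and the matching ends
    give both the same limit. *)
Lemma continuous_frac (T : topologicalType) (F : R * R -> T) p :
  continuous F -> (forall u, F (u, p) = F (u, p + 1)) ->
  continuous (fun z : R * R => F (z.1, z.2 - (Num.floor (z.2 - p))%:~R)).
Proof.
move=> cF Fp z W Wz.
suff: \forall z' \near z, W (F (z'.1, z'.2 - (Num.floor (z'.2 - p))%:~R)) by [].
pose m := Num.floor (z.2 - p).
have cshift (k : R) : continuous (fun z : R * R => F (z.1, z.2 - k)).
  apply: (@continuous_composition _ _ _ (fun z : R * R => (z.1, z.2 - k)) F) => //.
  apply: continuous_pair_fun; first exact: continuous_fst.
  apply: continuous_subR; first exact: continuous_snd.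
  exact: cst_continuous.
have c2 : continuous (fun z : R * R => z.2) by exact: continuous_snd.
have Wm : \forall z' \near z, W (F (z'.1, z'.2 - m%:~R)) by exact: (cshift m%:~R z W).
have fm : m%:~R <= z.2 - p < (m + 1)%:~R by rewrite floor_le floorD1_gt.
have lt1 : \forall z' \near z, z'.2 - p < (m + 1)%:~R.
  apply: (c2 z [set x | x - p < (m + 1)%:~R]).
  near=> x; rewrite /= ltrBlDr; near: x.
  apply: open_nbhs_nbhs; split; first exact: open_lt.
  by rewrite /= -ltrBlDr; case/andP: fm.
have [mz|mz|mE] := ltrgtP (m%:~R) (z.2 - p).
- have gt1 : \forall z' \near z, m%:~R < z'.2 - p.
    apply: (c2 z [set x | m%:~R < x - p]).
    near=> x; rewrite /= ltrBrDr; near: x.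
    apply: open_nbhs_nbhs; split; first exact: open_gt.
    by rewrite /= -ltrBrDr.
  near=> z'; rewrite (@floor_def _ _ m); first by near: z'.
  by rewrite ltW /=; near: z'.
- by move: fm; rewrite leNgt mz.
have W1 : \forall z' \near z, W (F (z'.1, z'.2 - (m - 1)%:~R)).
  apply: (cshift (m - 1)%:~R z W) => /=; move: Wz => /=.
  rewrite -/m; have -> : z.2 - m%:~R = p by rewrite mE; ring.
  have -> : z.2 - (m - 1)%:~R = p + 1 by rewrite intrB mE; ring.
  by rewrite Fp.
have gt1 : \forall z' \near z, (m - 1)%:~R < z'.2 - p.
  apply: (c2 z [set x | (m - 1)%:~R < x - p]).
  near=> x; rewrite /= ltrBrDr; near: x.
  apply: open_nbhs_nbhs; split; first exact: open_gt.
  by rewrite /= -ltrBrDr -mE ltr_int; lia.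
near=> z'; have [h|h] := leP m%:~R (z'.2 - p).
  rewrite (@floor_def _ _ m); first by near: z'.
  by rewrite h /=; near: z'.
rewrite (@floor_def _ _ (m - 1)); first by near: z'.
by rewrite subrK h andbT ltW //; near: z'.
Unshelve. all: by end_near. Qed.

End Pasting.

Section Homotopy.
Variables (R : realType) (M : surface R).
Implicit Types (c d e : R -> M).

Lemma freely_homotopic_sym c d : freely_homotopic c d -> freely_homotopic d c.
Proof.
move=> [H [cH pH H0 H1]]; exists (fun z => H (1 - z.1, z.2)); split=> //=.
- apply: (@continuous_composition _ _ _ (fun z : R * R => (1 - z.1, z.2)) H) => //.
  apply: continuous_pair_fun; last exact: continuous_snd.
  apply: continuous_subR; last exact: continuous_fst.
  exact: cst_continuous.
- by move=> s; rewrite subr0.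
- by move=> s; rewrite subrr.
Qed.

Lemma freely_homotopic_trans c d e :
  freely_homotopic c d -> freely_homotopic d e -> freely_homotopic c e.
Proof.
move=> [H [cH pH H0 H1]] [G [cG pG G0 G1]].
exists (fun z => if z.1 < 2^-1 then H (2 * z.1, z.2) else G (2 * z.1 - 1, z.2)).
have c21 : continuous (fun z : R * R => 2 * z.1).
  by apply: continuous_mulR; [exact: cst_continuous|exact: continuous_fst].
split.
- apply: (@continuous_paste _ _ _ (fun z : R * R => H (2 * z.1, z.2))
    (fun z : R * R => G (2 * z.1 - 1, z.2)) (fun z => z.1)).
  + apply: (@continuous_composition _ _ _ (fun z : R * R => (2 * z.1, z.2)) H) => //.
    by apply: continuous_pair_fun => //; exact: continuous_snd.
  + apply: (@continuous_composition _ _ _ (fun z : R * R => (2 * z.1 - 1, z.2)) G) => //.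
    apply: continuous_pair_fun => //; last exact: continuous_snd.
    by apply: continuous_subR => //; exact: cst_continuous.
  + exact: continuous_fst.
  + by move=> z ->; rewrite divff // subrr H1 G0.
- by move=> u s /=; case: ifP; rewrite ?pH ?pG.
- by move=> s /=; rewrite invr_gt0 ltr0n mulr0 H0.
- by move=> s /=; rewrite ltNge invf_le1 // ler1n /= mulr1 addrK G1.
Qed.

Lemma freely_homotopic_cls c d : freely_homotopic c d -> cls c = cls d.
Proof.
move=> cd; rewrite /cls; have -> // : free_class c = free_class d.
apply/seteqP; split=> e [le h]; split=> //.
  exact: freely_homotopic_trans (freely_homotopic_sym cd) h.
exact: freely_homotopic_trans cd h.
Qed.

(* [smoothing] with base parameters made explicit *)
Definition figure_eight c d (s t : R) : R -> M := fun u =>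
  let f := u - (Num.floor u)%:~R in
  if f < 2^-1 then c (s + 2 * f) else d (t + (2 * f - 1)).

(** The two homotopies may move the crossing, provided that [sigma] and [tau] follow it: the meeting
    condition is what pastes the two halves at the middle and closes the loop. *)
Lemma figure_eight_homotopy (K L : R * R -> M) (sigma tau : R -> R) :
  continuous K -> continuous L -> continuous sigma -> continuous tau ->
  (forall u s, K (u, s + 1) = K (u, s)) -> (forall u s, L (u, s + 1) = L (u, s)) ->
  (forall u, 0 <= u <= 1 -> K (u, sigma u) = L (u, tau u)) ->
  freely_homotopic
    (figure_eight (fun s => K (0, s)) (fun s => L (0, s)) (sigma 0) (tau 0))
    (figure_eight (fun s => K (1, s)) (fun s => L (1, s)) (sigma 1) (tau 1)).
Proof.
move=> cK cL cs ct pK pL KL.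
(* The loops are known to meet only for times in [0, 1], whereas [freely_homotopic] asks for
   continuity at all real times. *)
pose v (u : R) := clamp 0 1 u.
have cv : continuous (fun z : R * R => v z.1).
  by apply: continuous_clamp; exact: continuous_fst.
have v01 u : 0 <= v u <= 1 by exact: clamp_itv.
pose A (z : R * R) := K (v z.1, sigma (v z.1) + 2 * z.2).
pose B (z : R * R) := L (v z.1, tau (v z.1) + (2 * z.2 - 1)).
pose G (z : R * R) := if z.2 < 2^-1 then A z else B z.
have c22 : continuous (fun z : R * R => 2 * z.2).
  by apply: continuous_mulR; [exact: cst_continuous|exact: continuous_snd].
have cG : continuous G.
  apply: continuous_paste.
  - apply: (@continuous_composition _ _ _
      (fun z : R * R => (v z.1, sigma (v z.1) + 2 * z.2)) K) => //.
    apply: continuous_pair_fun => //; apply: continuous_addR => //.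
    exact: (continuous_composition cv cs).
  - apply: (@continuous_composition _ _ _
      (fun z : R * R => (v z.1, tau (v z.1) + (2 * z.2 - 1))) L) => //.
    apply: continuous_pair_fun => //; apply: continuous_addR.
      exact: (continuous_composition cv ct).
    by apply: continuous_subR => //; exact: cst_continuous.
  - exact: continuous_snd.
  - by move=> [u s] /= ->; rewrite /A /B /= divff // subrr addr0 pK KL.
have GP u : G (u, 0) = G (u, 0 + 1).
  rewrite /G /= invr_gt0 ltr0n add0r ltNge invf_le1 // ler1n /= /A /B /=.
  by rewrite mulr0 mulr1 addr0 addrK pL KL.
have fl0 : forall s : R, Num.floor (s - 0) = Num.floor s by move=> s; rewrite subr0.
exists (fun z => G (z.1, z.2 - (Num.floor (z.2 - 0))%:~R)); split.
- exact: continuous_frac.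
- move=> u s /=; rewrite !fl0.
  have -> : s + 1 - (Num.floor (s + 1))%:~R = s - (Num.floor s)%:~R.
    by rewrite floorDrz ?rpred1 // floor1 intrD; ring.
  by [].
- by move=> s; rewrite /G /A /B /figure_eight /= /v clamp_id ?lexx ?ler01 // subr0.
- by move=> s; rewrite /G /A /B /figure_eight /= /v clamp_id ?lexx ?ler01 // subr0.
Qed.

End Homotopy.

(** * Isotopies *)

Section Isotopy.
Variables (R : realType) (M : surface R).
Implicit Types (c d : chart R M) (x : M).

Lemma det2_mulmx (u v : plane R) (A : 'M[R]_2) :
  det2 (u *m A) (v *m A) = \det A * det2 u v.
Proof.
have -> : u *m A = u 0 0 *: row 0 A + u 0 1 *: row 1 A.
  by rewrite -mulmx_pt pt_eta.
have -> : v *m A = v 0 0 *: row 0 A + v 0 1 *: row 1 A.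
  by rewrite -mulmx_pt pt_eta.
by rewrite det_rows /det2 !mxE; ring.
Qed.

Lemma jacobian_comp (f g : plane R -> plane R) p : differentiable f p ->
  differentiable g (f p) -> 'J (g \o f) p = 'J f p *m 'J g (f p).
Proof.
move=> df dg; apply/row_matrixP => i.
have mulJ (h : plane R -> plane R) q v : v *m 'J h q = 'd h q v.
  by rewrite /jacobian mul_rV_lin1.
rewrite row_mul; set v := delta_mx 0 i : plane R.
have e1 := etrans (rowE i ('J (g \o f) p)) (mulJ (g \o f) p v).
have e2 := etrans (rowE i ('J f p)) (mulJ f p v).
have e3 := mulJ g (f p) ('d f p v).
have e4 := congr1 (fun F => F v) (diff_comp df dg).
apply: (etrans e1); apply: (etrans e4); apply: esym.
exact: (etrans (congr1 (fun w => w *m 'J g (f p)) e2) e3).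
Qed.

(** Absorbs the base parameters into the curves, so that an isotopy can be followed with both base
    parameters equal to 0. *)
Lemma figure_eight_shift (C D : R -> M) s t :
  figure_eight C D s t = figure_eight (fun u => C (u + s)) (fun u => D (u + t)) 0 0.
Proof.
by apply/funext => u; rewrite /figure_eight; case: ifP => _;
  rewrite add0r addrC.
Qed.

Section Branch.
Variables (C C' : lcurve M) (phi : M -> M) (r : R -> R) (s s' : R).
Variables (c d : chart R M) (g : plane R -> plane R).
Let p := cmap c (C s).
Hypothesis Cc : cabling (crv C) (band C).
Hypothesis Cc' : cabling (crv C') (band C').
Hypothesis ac : atlas c.
Hypothesis ad : atlas d.
Hypothesis cs : cdom c (C s).
Hypothesis phic : continuous phi.
Hypothesis ds : cdom d (phi (C s)).
Hypothesis rs : r s' = s.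
Hypothesis rd : derivable r s' 1.
Hypothesis r'0 : 0 < derive1 r s'.
Hypothesis C'E : forall u, C' u = phi (C (r u)).
Hypothesis gd : differentiable g p.
Hypothesis gE : \forall q \near p, (cmap c @` (cdom c `&` phi @^-1` cdom d)) q ->
  g q = (cmap d \o phi \o cinv c) q.
Hypothesis CC' : forall e0, 0 < e0 -> \forall e \near 0^'+, exists s2 e2,
  [/\ `|s2 - s| < e0, 0 < e2 < e0 & band C' (pt s' e) = phi (band C (pt s2 e2))].

Let C's : C' s' = phi (C s). Proof. by rewrite C'E rs. Qed.
Let C0 u : band C (pt u 0) = C u. Proof. by have [_ _ ->] := Cc. Qed.
Let C'0 u : band C' (pt u 0) = C' u. Proof. by have [_ _ ->] := Cc'. Qed.

Let dcB : differentiable (cmap c \o band C) (pt s 0).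
Proof.
have [_ _ B0 Bd] := Cc.
have cB : cdom c (band C (pt s 0)) by rewrite B0.
by have [] := Bd c ac _ (strip_axis s) cB.
Qed.

Let dcB' : differentiable (cmap d \o band C') (pt s' 0).
Proof.
have [_ _ B0 Bd] := Cc'.
have cB : cdom d (band C' (pt s' 0)) by rewrite B0 C's.
by have [] := Bd d ad _ (strip_axis s') cB.
Qed.

(** [g] is a local extension and agrees with the chart expression of [phi] only on the image of the
    chart. Near its axis the band stays in that image. *)
Let near_transition : \forall q \near pt s 0,
  g (cmap c (band C q)) = cmap d (phi (band C q)).
Proof.
have [_ _ K _ _] := atlas_chart ac; have [od _ _ _ _] := atlas_chart ad.
have [Bc _ _ _] := Cc.
have n1 : \forall q \near pt s 0, cdom d (phi (band C q)).
  have cphiB : {for pt s 0, continuous (phi \o band C)}.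
    by apply: continuous_comp; [apply: (Bc _ (strip_axis s))|exact: phic].
  by apply: cphiB; apply: open_nbhs_nbhs; split=> //=; rewrite C0.
have n2 : \forall q \near pt s 0, (cmap c @` (cdom c `&` phi @^-1` cdom d))
    (cmap c (band C q)) -> g (cmap c (band C q)) =
      (cmap d \o phi \o cinv c) (cmap c (band C q)).
  have cc : {for pt s 0, continuous (cmap c \o band C)}.
    exact: differentiable_continuous.
  apply: (cc [set q | (cmap c @` (cdom c `&` phi @^-1` cdom d)) q ->
    g q = (cmap d \o phi \o cinv c) q]).
  by rewrite /= C0; exact: gE.
have n3 := near_cdom Cc ac cs.
near=> q.
have [_ cq] : strip q /\ cdom c (band C q) by near: q.
have -> : g (cmap c (band C q)) = (cmap d \o phi \o cinv c) (cmap c (band C q)).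
  have : (cmap c @` (cdom c `&` phi @^-1` cdom d)) (cmap c (band C q)).
    by exists (band C q) => //; split=> //=; near: q.
  by near: q.
by rewrite /= K.
Unshelve. all: by end_near. Qed.

Lemma branch_velocity : velocity d C' s' = derive1 r s' *: (velocity c C s *m 'J g p).
Proof.
have drs : is_derive s' 1 r (derive1 r s').
  by apply: DeriveDef => //; rewrite derive1E.
have dC : is_derive (r s') 1 (cmap c \o C : R -> plane R) (velocity c C s).
  by rewrite rs velocityE //; exact: is_derive_velocity.
have dgC : is_derive (r s') 1 (g \o (cmap c \o C) : R -> plane R)
    (velocity c C s *m 'J g p).
  have := @is_derive_comp_plane _ g (cmap c \o C) (r s') _ dC.
  by rewrite /= rs; apply.
have drv : is_derive s' 1 ((g \o (cmap c \o C)) \o r : R -> plane R)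
    (derive1 r s' *: (velocity c C s *m 'J g p)).
  have d1 : differentiable (g \o (cmap c \o C) : R -> plane R) (r s').
    exact/derivable1_diffP.
  have d2 : differentiable r s' by exact/derivable1_diffP.
  have d3 : differentiable ((g \o (cmap c \o C)) \o r : R -> plane R) s'.
    exact: differentiable_comp.
  apply: DeriveDef; first exact/derivable1_diffP.
  have e1 := congr1 (fun F => F (1 : R)) (diff_comp d2 d1).
  have e2 := @deriveE _ _ _ _ _ (1 : R) d3.
  have e3 : 'd r s' 1 = derive1 r s' *: (1 : R).
    by rewrite -deriveE // derive1E; rewrite /GRing.scale /= mulr1.
  have e4 : 'd (g \o (cmap c \o C) : R -> plane R) (r s') 1 = velocity c C s *m 'J g p.
    by rewrite -deriveE // derive_val.
  apply: (etrans e2); apply: (etrans e1) => /=.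
  by rewrite e3 linearZ /= e4.
have eqn : \near s', ((g \o (cmap c \o C)) \o r) s' = (cmap d \o C') s'.
  have cr : {for s', continuous r}.
    by apply: differentiable_continuous; exact/derivable1_diffP.
  have cpt : {for s, continuous (fun u : R => pt u 0)}.
    have := is_derive_axis s => h.
    by apply: differentiable_continuous; apply/derivable1_diffP.
  have n1 : \forall u \near s, g (cmap c (band C (pt u 0))) =
      cmap d (phi (band C (pt u 0))).
    exact: (cpt _ near_transition).
  rewrite -rs in n1.
  have n2 : \forall u \near s', g (cmap c (band C (pt (r u) 0))) =
      cmap d (phi (band C (pt (r u) 0))) by exact: (cr _ n1).
  apply: filterS n2 => u /=.
  by rewrite C0 C'E.
have h := near_eq_is_derive eqn drv.
by rewrite /velocity derive1E; exact: derive_val.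
Qed.

(** [side_transport] compares the band of [C'] with the image under [g] of the band of [C]; the
    chain rule turns the determinant of the latter into [side c C s * \det ('J g p)]. *)
Lemma branch_side : side d C' s' != 0 -> \det ('J g p) != 0 ->
  0 < side c C s * \det ('J g p) * side d C' s'.
Proof.
move=> D'0 g0.
have dF : differentiable (g \o (cmap c \o band C)) (pt s 0).
  apply: differentiable_comp; first exact: dcB.
  by rewrite /= C0; exact: gd.
have JF : 'J (g \o (cmap c \o band C)) (pt s 0) =
    'J (cmap c \o band C) (pt s 0) *m 'J g p.
  have := @jacobian_comp (cmap c \o band C) g (pt s 0) dcB.
  by rewrite /= C0 => /(_ gd).
have side0 := side_neq0 Cc ac cs.
have rF : row 0 ('J (g \o (cmap c \o band C)) (pt s 0)) = velocity c C s *m 'J g p.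
  apply: (etrans (congr1 (fun A => row 0 A) JF)); apply: (etrans (row_mul _ _ _)).
  exact: (congr1 (fun w => w *m 'J g p) (esym (velocityE Cc ac cs))).
have ds' : cdom d (C' s') by rewrite C's.
have rG : row 0 ('J (cmap d \o band C') (pt s' 0)) =
    derive1 r s' *: row 0 ('J (g \o (cmap c \o band C)) (pt s 0)).
  apply: (etrans (esym (velocityE Cc' ad ds'))); apply: (etrans branch_velocity).
  exact: (congr1 (fun w => derive1 r s' *: w) (esym rF)).
have dJF : \det ('J (g \o (cmap c \o band C)) (pt s 0)) =
    side c C s * \det ('J g p).
  exact: (etrans (congr1 determinant JF) (det_mulmx _ _)).
have dF0 : \det ('J (g \o (cmap c \o band C)) (pt s 0)) != 0.
  exact: (eq_ind_r (fun z => z != 0) (mulf_neq0 side0 g0) dJF).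
have FG : (g \o (cmap c \o band C)) (pt s 0) = (cmap d \o band C') (pt s' 0).
  by have /= -> := nbhs_singleton near_transition; rewrite C0 C'0 C's.
have strip_in e0 : 0 < e0 -> \forall e \near 0^'+, exists s2 e2,
   [/\ `|s2 - s| < e0, 0 < e2 < e0 & (cmap d \o band C') (pt s' e) =
     (g \o (cmap c \o band C)) (pt s2 e2)].
  move=> e00; have /nbhs_normP[e1 e10 Ht] := near_transition.
  have e2 : 0 < Num.min e0 e1 by rewrite lt_min e00.
  apply: filterS (CC' e2) => e [s2 [e3 [+ /andP[e30] + E]]].
  rewrite !lt_min => /andP[s20 s21] /andP[e31 e32].
  exists s2, e3; rewrite e30 e31; split=> //=.
  rewrite E; apply/esym/Ht; rewrite /= -normrN opprB ptB subr0.
  by apply: plane_norm_lt; rewrite ?ptE0 ?ptE1 // gtr0_norm.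
have key := side_transport dF dcB' FG strip_in r'0 rG dF0 D'0.
exact: (eq_ind _ (fun z => 0 < z * side d C' s') key _ dJF).
Qed.

End Branch.
Lemma same_sign_lt0 (a b X : R) : 0 < a * b -> (a * X < 0) = (b * X < 0).
Proof.
move=> ab; have b2 : 0 < b * b.
  by rewrite -expr2 exprn_even_gt0 //=; apply: contraTneq ab => ->; rewrite mulr0 ltxx.
rewrite -(pmulr_rlt0 _ b2) -[in RHS](pmulr_rlt0 _ ab).
by congr (_ < 0); ring.
Qed.

Lemma same_sign_gt0 (a b X : R) : 0 < a * b -> (0 < a * X) = (0 < b * X).
Proof.
by move=> ab; rewrite -oppr_lt0 -mulrN (same_sign_lt0 _ ab) mulrN oppr_lt0.
Qed.

Lemma equivariant_int (r : R -> R) : (forall s, r (s + 1) = r s + 1) ->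
  forall s (m : int), r (s + m%:~R) = r s + m%:~R.
Proof.
move=> p s m; have pn n : forall s, r (s + n%:R) = r s + n%:R.
  elim: n => [|n IH] u; first by rewrite !addr0.
  by rewrite -natr1 addrA p IH addrA.
case: m => n; first by rewrite -!pmulrn pn.
by rewrite NegzE mulrNz -[in RHS](subrK (n.+1%:R) s) pn addrK.
Qed.

Lemma band_int (C : R -> M) (B : plane R -> M) s y (m : int) :
  cabling C B -> `|y| < 1 -> B (pt (s + m%:~R) y) = B (pt s y).
Proof.
move=> [_ p _ _] y1; have pn n : forall s, B (pt (s + n%:R) y) = B (pt s y).
  elim: n => [|n IH] u; first by rewrite !addr0.
  by rewrite -natr1 addrA p // IH.
case: m => n; first by rewrite -!pmulrn pn.
by rewrite NegzE mulrNz -[in RHS](subrK (n.+1%:R) s) pn.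
Qed.

(** Intermediate values between two consecutive integers; this is how every crossing is seen to
    survive the reparametrization. *)
Lemma equivariant_surj (r : R -> R) : continuous r ->
  (forall s, r (s + 1) = r s + 1) -> forall y, exists s, r s = y.
Proof.
move=> cr p y; pose n := Num.floor (y - r 0).
have rn (m : int) : r m%:~R = r 0 + m%:~R by rewrite -(equivariant_int p) add0r.
have nn : n%:~R <= (n + 1)%:~R :> R by rewrite ler_int; lia.
have [|| s _ sy] := @IVT R r n%:~R (n + 1)%:~R y nn; last by exists s.
  exact: continuous_subspaceT.
have n1 : n%:~R <= y - r 0 by rewrite floor_le.
have n2 : y - r 0 < (n + 1)%:~R by rewrite floorD1_gt.
by rewrite !rn ge_min le_max; apply/andP; split; apply/orP; [left|right]; lra.
Qed.

Section IsotopyCurve.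
Variables (C C' : lcurve M) (phi : M -> M) (r : R -> R).
Hypothesis LC : labeled_curve C.
Hypothesis LC' : labeled_curve C'.
Hypothesis phic : continuous phi.
Hypothesis rp : forall s, r (s + 1) = r s + 1.
Hypothesis rd : forall s, derivable r s 1.
Hypothesis r'0 : forall s, 0 < derive1 r s.
Hypothesis C'E : forall s, C' s = phi (C (r s)).
Hypothesis CC' : forall s, same_side
  (LCurve (fun u => phi (C (r u)))
     (fun z => phi (band C (pt (r (z 0 0)) (z 0 1))))) C' s.

Lemma isotopy_continuous_repar : continuous r.
Proof. by move=> s; apply: differentiable_continuous; apply/derivable1_diffP. Qed.

Variables (s s' : R) (m : int) (c d : chart R M) (g : plane R -> plane R).
Hypothesis rs : r s' = s + m%:~R.
Hypothesis ac : atlas c.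
Hypothesis ad : atlas d.
Hypothesis cs : cdom c (C s).
Hypothesis ds : cdom d (phi (C s)).
Hypothesis gd : differentiable g (cmap c (C s)).
Hypothesis gE : \forall q \near cmap c (C s),
  (cmap c @` (cdom c `&` phi @^-1` cdom d)) q -> g q = (cmap d \o phi \o cinv c) q.

(** The integer shift makes [s'] go exactly to [s], since the parameters chosen by [param] on the
    two curves correspond only modulo 1. *)
Let r' u := r u - m%:~R.

Let dr' : is_derive s' 1 r' (derive1 r s').
Proof.
have h1 : is_derive s' 1 r (derive1 r s') by apply: DeriveDef; rewrite ?derive1E.
have h2 : is_derive s' 1 (cst (m%:~R : R)) 0 by exact: is_derive_cst.
by have := is_deriveB h1 h2; rewrite subr0.
Qed.

Let dr'E : derive1 r' s' = derive1 r s'.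
Proof. by rewrite [LHS]derive1E; exact: derive_val. Qed.

Let r's : r' s' = s. Proof. by rewrite /r' rs addrK. Qed.

Let C'E' u : C' u = phi (C (r' u)).
Proof. by rewrite C'E /r' -mulrNz (loop_int _ _ (lcurve_loop LC)). Qed.

Let CC'' : forall e0, 0 < e0 -> \forall e \near 0^'+, exists s2 e2,
  [/\ `|s2 - s| < e0, 0 < e2 < e0 & band C' (pt s' e) = phi (band C (pt s2 e2))].
Proof.
move=> e0 e00; have cr := @isotopy_continuous_repar s'.
have /cvgrPdist_lt /(_ _ e00) /nbhs_normP[d1 d10 Hd] := cr.
(* The bound 1 keeps the heights in the strip, where the band is periodic. *)
have dm : 0 < Num.min (Num.min e0 d1) 1 by rewrite !lt_min e00 ltr01 andbT.
apply: filterS (CC' s' dm) => e [s2 [e2 [+ /andP[e20] + E]]].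
rewrite !lt_min => /andP[/andP[a1 a2] _] /andP[/andP[b1 b2] b3].
exists (r' s2), e2; rewrite e20 b1; split=> //.
  rewrite /r' (_ : _ - s = r s2 - r s'); last by rewrite rs; ring.
  by rewrite distrC; apply: Hd; rewrite /= distrC.
rewrite E /= ptE0 ptE1 /r' -mulrNz (band_int _ _ (lcurve_cabling LC)) //.
by rewrite gtr0_norm.
Qed.

Lemma isotopy_velocity :
  velocity d C' s' = derive1 r s' *: (velocity c C s *m 'J g (cmap c (C s))).
Proof.
rewrite -dr'E; apply: (branch_velocity (phi := phi)) => //.
- exact: lcurve_cabling.
- exact: (@ex_derive _ _ _ _ _ _ _ dr').
Qed.

Lemma isotopy_side : \det ('J g (cmap c (C s))) != 0 ->
  0 < side c C s * \det ('J g (cmap c (C s))) * side d C' s'.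
Proof.
move=> g0; have ds' : cdom d (C' s') by rewrite C'E' r's.
have d0 := side_neq0 (lcurve_cabling LC') ad ds'.
have r'1 : 0 < derive1 r' s' by rewrite dr'E.
have rd' := @ex_derive _ _ _ _ _ _ _ dr'.
exact: (branch_side (lcurve_cabling LC) (lcurve_cabling LC') ac ad cs phic ds
  r's rd' r'1 C'E' gd gE CC'' d0 g0).
Qed.

End IsotopyCurve.

(** While [h] runs, the parameter is interpolated linearly from [z + s] to [r (z + s') - m]. A
    convex combination of two lifts of degree one has degree one, so every stage is periodic; at
    [z = 0] both ends are [s], so the crossing is carried by [h] alone. *)
Lemma isotopy_smoothing (C1 C2 C1' C2' : R -> M) (h : R * M -> M) (r1 r2 : R -> R)
    s t s' t' (m n : int) :
  loop C1 -> loop C2 -> loop C1' -> loop C2' ->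
  continuous h -> (forall x, h (0, x) = x) -> continuous r1 -> continuous r2 ->
  (forall u, r1 (u + 1) = r1 u + 1) -> (forall u, r2 (u + 1) = r2 u + 1) ->
  (forall u, C1' u = h (1, C1 (r1 u))) -> (forall u, C2' u = h (1, C2 (r2 u))) ->
  C1 s = C2 t -> r1 s' = s + m%:~R -> r2 t' = t + n%:~R ->
  freely_homotopic (figure_eight C1 C2 s t) (figure_eight C1' C2' s' t').
Proof.
move=> l1 l2 l1' l2' ch h0 c1 c2 p1 p2 E1 E2 st rs rt.
pose K (C : R -> M) (r : R -> R) s s' (m : int) (z : R * R) :=
  h (z.1, C ((1 - z.1) * (z.2 + s) + z.1 * (r (z.2 + s') - m%:~R))).
have cK C r u u' k : continuous C -> continuous r -> continuous (K C r u u' k).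
  move=> cC cr; have cf := @continuous_fst R R; have cs := @continuous_snd R R.
  have ck y := @cst_continuous (R * R)%type R y.
  apply: (@continuous_composition _ _ _ (fun z : R * R => (z.1, _)) h) => //.
  apply: continuous_pair_fun => //.
  apply: (@continuous_composition _ _ _ (fun z : R * R =>
    (1 - z.1) * (z.2 + u) + z.1 * (r (z.2 + u') - k%:~R)) C) => //.
  apply: continuous_addR; apply: continuous_mulR => //.
  - exact: continuous_subR.
  - exact: continuous_addR.
  - apply: continuous_subR => //.
    by apply: continuous_composition cr; exact: continuous_addR.
have pK C r u u' k : (forall u, C (u + 1) = C u) -> (forall u, r (u + 1) = r u + 1) ->
    forall v w, K C r u u' k (v, w + 1) = K C r u u' k (v, w).
  move=> pC pr v w; rewrite /K /= [w + 1 + u']addrAC pr.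
  by rewrite -[in RHS]pC; congr (h (_, C _)); ring.
have [l1c l1p] := l1; have [l2c l2p] := l2.
rewrite (figure_eight_shift C1) (figure_eight_shift C1').
have := @figure_eight_homotopy R M (K C1 r1 s s' m) (K C2 r2 t t' n) (cst 0) (cst 0)
  (cK _ _ _ _ _ l1c c1) (cK _ _ _ _ _ l2c c2) (@cst_continuous _ _ _)
  (@cst_continuous _ _ _) (pK _ _ _ _ _ l1p p1) (pK _ _ _ _ _ l2p p2).
have K0 C r u u' k : (fun w => K C r u u' k (0, w)) = (fun w => C (w + u)).
  by apply/funext => w; rewrite /K /= h0; congr C; ring.
have K1 (C C' : R -> M) r u u' k : loop C -> (forall u, C' u = h (1, C (r u))) ->
    (fun w => K C r u u' k (1, w)) = (fun w => C' (w + u')).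
  move=> lC CE; apply/funext => w; rewrite /K /= CE; congr (h (_, _)).
  by rewrite subrr mul0r add0r mul1r -mulrNz loop_int.
rewrite !K0 (K1 _ C1') // (K1 _ C2') //; apply.
move=> u _; rewrite /K /= !add0r rs rt !addrK -!mulrDl !subrK !mul1r.
by rewrite st.
Qed.

Lemma isotopy_bracket (C1 C2 C1' C2' : lcurve M) :
  admissible C1 C2 -> admissible C1' C2' ->
  isotopy_move (pair_of C1 C2) (pair_of C1' C2') ->
  bracket C1 C2 = bracket C1' C2'.
Proof.
move=> A A' [h [r [ch h0 hd rP CP]]].
pose phi := fun x => h (1, x).
have [|phi' [phiK _ [phic phiC1] _]] := hd 1; first by rewrite ler01 lexx.
have phi_inj : injective phi := can_inj phiK.
have [LC1 LC2 _ _] := A; have [LC1' LC2' _ _] := A'.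
have p1 s : r 0 (s + 1) = r 0 s + 1 by have [] := rP 0 s.
have p2 s : r 1 (s + 1) = r 1 s + 1 by have [] := rP 1 s.
have d1 s : derivable (r 0) s 1 by have [] := rP 0 s.
have d2 s : derivable (r 1) s 1 by have [] := rP 1 s.
have q1 s : 0 < derive1 (r 0) s by have [] := rP 0 s.
have q2 s : 0 < derive1 (r 1) s by have [] := rP 1 s.
have E1 s : C1' s = phi (C1 (r 0 s)) by have [] := CP 0 s.
have E2 s : C2' s = phi (C2 (r 1 s)) by have [] := CP 1 s.
have S1 s := proj2 (CP 0 s).
have S2 s := proj2 (CP 1 s).
have cr1 := isotopy_continuous_repar d1; have cr2 := isotopy_continuous_repar d2.
have XE : crossings C1' C2' = phi @` crossings C1 C2.
  apply/seteqP; split=> [x [[s _ sx] [t _ tx]]|_ [x [[s _ sx] [t _ tx]] <-]].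
    exists (C1 (r 0 s)); last by rewrite -E1.
    split; first by exists (r 0 s).
    by exists (r 1 t) => //; apply: phi_inj; rewrite -E1 -E2 sx.
  have [s' s'E] := equivariant_surj cr1 p1 s.
  have [t' t'E] := equivariant_surj cr2 p2 t.
  by split; [exists s'|exists t'] => //; rewrite ?E1 ?E2 ?s'E ?t'E ?sx ?tx.
rewrite /bracket XE fsbig_image; last by move=> x y _ _; exact: phi_inj.
apply: eq_fsbigr => x /set_mem xX.
have xX' : crossings C1' C2' (phi x) by rewrite XE; exists x.
have [_ e1 _ e2] := crossing_param A xX.
have [_ e1' _ e2'] := crossing_param A' xX'.
have [m rs] : exists m : int, r 0 (param C1' (phi x)) = param C1 x + m%:~R.
  by apply: (crossing_param1 A xX); apply: phi_inj; rewrite -E1.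
have [n rt] : exists n : int, r 1 (param C2' (phi x)) = param C2 x + n%:~R.
  by apply: (crossing_param2 A xX); apply: phi_inj; rewrite -E2.
congr (_ *: _); last first.
  apply: freely_homotopic_cls.
  apply: (isotopy_smoothing (lcurve_loop LC1) (lcurve_loop LC2) (lcurve_loop LC1')
    (lcurve_loop LC2') ch h0 cr1 cr2 p1 p2 E1 E2 _ rs rt).
  by rewrite e1 e2.
have [c ac cx] := atlas_cover x; have [d ad dx] := atlas_cover (phi x).
have cs : cdom c (C1 (param C1 x)) by rewrite e1.
have ct : cdom c (C2 (param C2 x)) by rewrite e2.
have ds : cdom d (phi (C1 (param C1 x))) by rewrite e1.
have dt : cdom d (phi (C2 (param C2 x))) by rewrite e2.
have [|g [gE gd]] := phiC1 c d ac ad (cmap c x); first by exists x.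
have {}gd := proj1 (nbhs_singleton gd).
have {}gE : \forall q \near cmap c x, (cmap c @` (cdom c `&` phi @^-1` cdom d)) q ->
  g q = (cmap d \o phi \o cinv c) q by [].
have g1 : differentiable g (cmap c (C1 (param C1 x))) by rewrite e1.
have g2 : differentiable g (cmap c (C2 (param C2 x))) by rewrite e2.
have h1 : \forall q \near cmap c (C1 (param C1 x)),
  (cmap c @` (cdom c `&` phi @^-1` cdom d)) q -> g q = (cmap d \o phi \o cinv c) q.
  by rewrite e1.
have h2 : \forall q \near cmap c (C2 (param C2 x)),
  (cmap c @` (cdom c `&` phi @^-1` cdom d)) q -> g q = (cmap d \o phi \o cinv c) q.
  by rewrite e2.
have v1 := isotopy_velocity LC1 phic d1 E1 rs ac ad cs ds g1 h1.
have v2 := isotopy_velocity LC2 phic d2 E2 rt ac ad ct dt g2 h2.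
have s1 := isotopy_side LC1 LC1' phic d1 q1 E1 S1 rs ac ad cs ds g1 h1.
have s2 := isotopy_side LC2 LC2' phic d2 q2 E2 S2 rt ac ad ct dt g2 h2.
rewrite e1 in v1 s1; rewrite e2 in v2 s2.
have X0 := crossing_transverse A' xX' ad dx.
rewrite (crossing_sign A xX ac cx) (crossing_sign A' xX' ad dx).
move: X0; rewrite v1 v2 det2Zl det2Zr det2_mulmx.
move: (q1 (param C1' (phi x))) (q2 (param C2' (phi x))) s1 s2.
move: (derive1 (r 0) _) (derive1 (r 1) _) (\det ('J g _)) (det2 _ _)
  (side c C1 _) (side c C2 _) (side d C1' _) (side d C2' _).
move=> k1 k2 delta X D1 D2 D1' D2' k10 k20 s1 s2 X0.
(* The Jacobian determinant is nonzero because the image crossing is transverse. *)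
have delta0 : delta != 0.
  by apply: contraNneq X0 => ->; rewrite mul0r !mulr0.
have kk : 0 < k1 * k2 by rewrite mulr_gt0.
(* The factor [k1 * k2 * delta] acquired by the determinant of the velocities is moved onto [D'];
   the result has the sign of [D], because [delta] then occurs twice. *)
have P D D' : 0 < D * delta * D' -> 0 < D * (D' * (k1 * k2 * delta)).
  move=> DD.
  have -> : D * (D' * (k1 * k2 * delta)) = (k1 * k2) * (D * delta * D') by ring.
  by rewrite mulr_gt0.
have Q D' : D' * (k1 * (k2 * (delta * X))) = D' * (k1 * k2 * delta) * X by ring.
rewrite !Q -(same_sign_lt0 X (P _ _ (s1 delta0))).
by rewrite -(same_sign_gt0 X (P _ _ (s2 delta0))).
Qed.

End Isotopy.

(** * Homotopies supported in a disc *)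

Section ClampSquare.
Variable R : realType.

(** Retraction onto the square: it keeps corrected strands where [cinv c] is defined, without an
    estimate on the correction. *)
Definition clampsq (z : plane R) : plane R :=
  pt (clamp (-2) 2 (z 0 0)) (clamp (-2) 2 (z 0 1)).

Lemma clampsq_square z : square (clampsq z).
Proof.
by rewrite /square /= ptE0 ptE1 !ler_norml !clamp_itv //; lra.
Qed.

Lemma clampsq_id z : square z -> clampsq z = z.
Proof.
by move=> [h0 h1]; rewrite /clampsq !clamp_id -?ler_norml // pt_eta.
Qed.

Lemma continuous_pt (S : topologicalType) (f g : S -> R) :
  continuous f -> continuous g -> continuous (fun z => pt (f z) (g z)).
Proof.
move=> cf cg z; apply/cvgrPdist_lt => e e0.
have /cvgrPdist_lt /(_ _ e0) h1 := cf z.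
have /cvgrPdist_lt /(_ _ e0) h2 := cg z.
near=> u; rewrite ptB; apply: plane_norm_lt; rewrite ?ptE0 ?ptE1; near: u.
  exact: h1.
exact: h2.
Unshelve. all: by end_near. Qed.

Lemma continuous_entry (S : topologicalType) (f : S -> plane R) j :
  continuous f -> continuous (fun z => f z 0 j).
Proof.
move=> cf z; apply: (@continuous_comp _ _ _ f (fun M : plane R => M 0 j)).
  exact: cf.
exact: coord_continuous.
Qed.

Lemma continuous_clampsq (S : topologicalType) (f : S -> plane R) :
  continuous f -> continuous (fun z => clampsq (f z)).
Proof.
by move=> cf; apply: continuous_pt; apply: continuous_clamp;
  exact: continuous_entry.
Qed.

Lemma continuous_scale (S : topologicalType) (a : S -> R) (f : S -> plane R) :
  continuous a -> continuous f -> continuous (fun z => a z *: f z).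
Proof. by move=> ca cf z; apply: cvgZ; [exact: ca|exact: cf]. Qed.

Lemma continuous_planeD (S : topologicalType) (f g : S -> plane R) :
  continuous f -> continuous g -> continuous (fun z => f z + g z).
Proof. by move=> cf cg z; apply: cvgD; [exact: cf|exact: cg]. Qed.

Lemma continuous_planeB (S : topologicalType) (f g : S -> plane R) :
  continuous f -> continuous g -> continuous (fun z => f z - g z).
Proof. by move=> cf cg z; apply: cvgB; [exact: cf|exact: cg]. Qed.

Lemma continuous_plane_sum (S : topologicalType) (I : Type) (r : seq I)
    (P : pred I) (F : I -> S -> plane R) :
  (forall i, continuous (F i)) -> continuous (fun z => \sum_(i <- r | P i) F i z).
Proof.
move=> cF; elim: r => [|i r IH].
  by under eq_fun do rewrite big_nil; exact: cst_continuous.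
under eq_fun do rewrite big_cons.
by case: (P i) => //; exact: continuous_planeD.
Qed.

Lemma continuous_minR (S : topologicalType) (f g : S -> R) :
  continuous f -> continuous g -> continuous (fun z => Num.min (f z) (g z)).
Proof.
move=> cf cg z.
have cfz : {for z, continuous (f : S -> R^o)} by exact: cf.
have cgz : {for z, continuous (g : S -> R^o)} by exact: cg.
exact: (continuous_min cfz cgz).
Qed.

End ClampSquare.

(** * Moving the arcs of curves inside a disc *)

Section ArcSystems.
Variables (R : realType) (M : surface R) (n : nat).
Variables (c : chart R M) (k : 'I_n -> 'I_2) (p q : 'I_n -> R) (th : 'I_n -> R -> R).

Definition arc_system : Prop :=
  [/\ atlas c, @square R `<=` cimg c, forall i, p i < q i < p i + 1,
      forall i j s, k i = k j ->
        on_arc (p i) (q i) s -> on_arc (p j) (q j) s -> i = j &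
      forall i, {within `[p i, q i], continuous (th i)} /\
        set_bij `[p i, q i] `[- 2, 2] (th i)].

Definition off_arcs (j : 'I_2) (s : R) : Prop :=
  forall i, k i = j -> ~ on_arc (p i) (q i) s.

(** One half of [local_move], so that the pictures before and after the move are treated
    symmetrically. *)
Definition carries (C : 'I_2 -> R -> M) (U : tangle R n) : Prop :=
  [/\ forall j, loop (C j),
      forall j s, (cinv c @` @square R) (C j s) ->
        exists2 i, k i = j & on_arc (p i) (q i) s &
      forall i s, p i <= s <= q i -> C (k i) s = cinv c (tnth U i (th i s))].

Definition tangle_in_square (U : tangle R n) : Prop := forall i,
  continuous (tnth U i) /\ forall t, `|t| <= 2 -> square (tnth U i t).

Section OnArc.
Variables (a b : R).
Hypothesis ab : a < b < a + 1.

(** Among the integer translates of [s] that are at least [a], this one is the smallest. *)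
Lemma on_arcP s : on_arc a b s <-> s - (Num.floor (s - a))%:~R <= b.
Proof.
split=> [[m /andP[am mb]]|h].
  have := floor_le (s - a); have := floorD1_gt (s - a); rewrite intrD.
  move: (Num.floor _) => f f1 f0; suff : (- m <= f)%R.
    by rewrite -(ler_int R) mulrNz => h; lra.
  rewrite -ltzD1 -(ltr_int R) intrD mulrNz; lra.
exists (- Num.floor (s - a)); rewrite mulrNz h andbT.
have := floor_le (s - a); lra.
Qed.

(** The point lies in an open gap [(b + m, a + m + 1)] between consecutive translates of the arc. *)
Lemma off_arc_near s : ~ on_arc a b s -> \forall u \near s, ~ on_arc a b u.
Proof.
move=> /on_arcP/negP; rewrite -ltNge => bs.
have := floorD1_gt (s - a); rewrite intrD.
move: (Num.floor (s - a)) bs => m bs sa.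
near=> u; move=> [l /andP[al lb]].
have u1 : b + m%:~R < u.
  by near: u; apply: open_nbhs_nbhs; split; [exact: open_gt|rewrite /=; lra].
have u2 : u < a + m%:~R + 1.
  by near: u; apply: open_nbhs_nbhs; split; [exact: open_lt|rewrite /=; lra].
have h1 : (l + m)%:~R < (0 : int)%:~R :> R by rewrite intrD; lra.
have h2 : (- 1 : int)%:~R < (l + m)%:~R :> R by rewrite intrD mulrNz; lra.
move: h1 h2; rewrite !ltr_int; lia.
Unshelve. all: by end_near. Qed.

Lemma frac_on_arc s : a <= s <= b -> s - (Num.floor (s - a))%:~R = s.
Proof.
move=> /andP[as_ sb]; rewrite (@floor_def _ _ 0) ?subr0 //.
by rewrite add0r subr_ge0 as_ /=; case/andP: ab => _; lra.
Qed.

(** Off its arc, a displacement is thus evaluated at the end [b], where it vanishes. *)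
Lemma clamp_frac_off s : ~ on_arc a b s ->
  clamp a b (s - (Num.floor (s - a))%:~R) = b.
Proof.
move=> /on_arcP/negP; rewrite -ltNge => bs.
by rewrite /clamp min_l ?ltW // max_r // ltW //; case/andP: ab.
Qed.

End OnArc.

Lemma on_arc_itv (a b s : R) : a <= s <= b -> on_arc a b s.
Proof. by exists 0; rewrite addr0. Qed.

Lemma off_or_on j s : off_arcs j s \/
  exists i (m : int), k i = j /\ p i <= s + m%:~R <= q i.
Proof.
have [[i [ki [m h]]]|no] := pselect (exists i, k i = j /\ on_arc (p i) (q i) s).
  by right; exists i, m.
by left=> i ki oi; apply: no; exists i.
Qed.

Section System.
Hypothesis S : arc_system.

Let ac : atlas c. Proof. by have [] := S. Qed.
Let sq : @square R `<=` cimg c. Proof. by have [] := S. Qed.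
Let pq i : p i < q i < p i + 1. Proof. by have [_ _] := S. Qed.

Lemma arc_ltW i : p i <= q i. Proof. by have /andP[/ltW] := pq i. Qed.

(** A chart whose image contains the square is not a boundary chart, since [(-2, 0)] is outside the
    half-plane. *)
Lemma cimg_open : open (cimg c).
Proof.
have [_ [W [oW [OE|OE]]] _ _ _] := atlas_chart ac; first by rewrite OE.
have : cimg c (pt (-2) 0) by apply: sq; rewrite /square /= ptE0 ptE1 normrN normr0 ger0_norm.
by rewrite OE => -[_]; rewrite /halfplane /= ptE0; lra.
Qed.

Lemma cinvP z : cimg c z -> cdom c (cinv c z) /\ cmap c (cinv c z) = z.
Proof. by have [_ _ K _ _] := atlas_chart ac; move=> [x cx <-]; rewrite K. Qed.

Lemma cinv_continuous z : cimg c z -> {for z, continuous (cinv c)}.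
Proof.
move=> cz; have [_ _ _ _ ic] := atlas_chart ac.
have /subspace_continuousP/(_ z cz) := ic.
by rewrite within_interior //; exact: (open_nbhs_nbhs (conj cimg_open cz)).
Qed.

Lemma cmap_continuous x : cdom c x -> {for x, continuous (cmap c)}.
Proof.
move=> cx; have [oc _ _ mc _] := atlas_chart ac.
have /subspace_continuousP/(_ x cx) := mc.
by rewrite within_interior //; exact: (open_nbhs_nbhs (conj oc cx)).
Qed.

Lemma th_itv i s : p i <= s <= q i -> `|th i s| <= 2.
Proof.
move=> ps; have [_ _ _ _ /(_ i)[_ [thi _ _]]] := S.
by have := thi s; rewrite /= !in_itv /= ler_norml; apply.
Qed.

Lemma th_continuous i : continuous (fun s => th i (clamp (p i) (q i) s)).
Proof.
have [_ _ _ _ /(_ i)[ct _]] := S; move/subspace_continuousP: ct => ct s.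
have cl := clamp_itv s (arc_ltW i).
have := ct (clamp (p i) (q i) s); rewrite /= in_itv /= => /(_ cl) ch.
have cc : continuous (fun s => clamp (p i) (q i) s).
  by apply: continuous_clamp => x.
move=> W /ch Wn.
have h : \forall u \near s, `[p i, q i]%classic (clamp (p i) (q i) u) ->
    W (th i (clamp (p i) (q i) u)) by exact: (cc s _ Wn).
apply: filterS h => u /=; apply; rewrite in_itv /=.
exact: (clamp_itv u (arc_ltW i)).
Qed.

Lemma off_arcs_near j s : off_arcs j s ->
  \forall u \near s, off_arcs j u.
Proof.
move=> off.
have : forall i, \forall u \near s, k i = j -> ~ on_arc (p i) (q i) u.
  move=> i; have [/eqP ki|nki] := boolP (k i == j).
    by apply: filterS (off_arc_near (pq i) (off i ki)) => u.
  by near=> u => /eqP; rewrite (negbTE nki).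
move=> /filter_forall; apply: filterS => u h i; exact: h.
Unshelve. all: by end_near. Qed.

Section Homotopy.
Variables (C : 'I_2 -> R -> M) (U : tangle R n) (E : 'I_n -> R * R -> plane R).
Hypothesis CU : carries C U.
Hypothesis Ec : forall i, continuous (E i).
Hypothesis E0 : forall i s, p i <= s <= q i -> E i (0, s) = tnth U i (th i s).
Hypothesis Ep : forall i u, E i (u, p i) = E i (0, p i).
Hypothesis Eq : forall i u, E i (u, q i) = E i (0, q i).
Hypothesis Esq : forall i u s, p i <= s <= q i -> square (E i (u, s)).

Let fr i (s : R) := s - (Num.floor (s - p i))%:~R.
Let cl i (s : R) := clamp (p i) (q i) s.
Let dlt i (z : R * R) : plane R := E i (z.1, cl i z.2) - E i (0, cl i z.2).
(** The arcs of one curve are disjoint, so at most one summand is nonzero at a given parameter. The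
    sum spares the choice of an arc and is continuous term by term. *)
Let disp (j : 'I_2) (z : R * R) : plane R :=
  \sum_(i | k i == j) dlt i (z.1, fr i z.2).
(* The displacement vanishes off the arcs, so that both branches agree there and
   no gluing along the ends of the arcs is needed. *)
Let K (j : 'I_2) (z : R * R) : M :=
  if `[< cdom c (C j z.2) >] then cinv c (cmap c (C j z.2) + disp j z)
  else C j z.2.

Let dlt_continuous i : continuous (dlt i).
Proof.
have c2 : continuous (fun z : R * R => cl i z.2).
  by apply: continuous_clamp; exact: continuous_snd.
have c1 := @continuous_fst R R.
move=> z; apply: cvgB.
  apply: (@continuous_composition _ _ _ (fun z : R * R => (z.1, cl i z.2)) (E i)) => //.
  exact: continuous_pair_fun.
apply: (@continuous_composition _ _ _ (fun z : R * R => (0, cl i z.2)) (E i)) => //.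
apply: continuous_pair_fun => //; exact: cst_continuous.
Qed.

Let disp_continuous j : continuous (disp j).
Proof.
apply: continuous_plane_sum => i; have := @continuous_frac R _ (dlt i) (p i) (@dlt_continuous i).
apply=> u; rewrite /dlt /= /cl /clamp.
have /andP[h1 /ltW h2] := pq i.
rewrite (min_r (ltW h1)) maxxx Ep subrr (min_l h2) max_r ?(ltW h1) //.
by rewrite Eq subrr.
Qed.

Let disp_off j u s : off_arcs j s -> disp j (u, s) = 0.
Proof.
move=> off; apply: big1 => i /eqP ki; rewrite /dlt /= /cl /fr.
by rewrite (clamp_frac_off (pq i)) ?Eq ?subrr //; exact: off.
Qed.

Let disp_on i u s : p i <= s <= q i -> disp (k i) (u, s) = E i (u, s) - E i (0, s).
Proof.
move=> si; rewrite /disp (bigD1 i) //= big1 ?addr0.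
  by rewrite /dlt /= /fr (frac_on_arc (pq i) si) /cl clamp_id.
move=> l /andP[/eqP kl li]; rewrite /dlt /= /cl /fr (clamp_frac_off (pq l)) ?Eq ?subrr //.
have [_ _ _ D _] := S; move=> ol; move/eqP: li; apply.
exact: (D l i s kl ol (on_arc_itv si)).
Qed.

Let C_cdom i s : p i <= s <= q i ->
  cdom c (C (k i) s) /\ cmap c (C (k i) s) = E i (0, s).
Proof.
move=> si; have [_ _ ->] := CU => //; rewrite -E0 //.
by apply: cinvP; apply: sq; exact: Esq.
Qed.

Let K_on i u s : p i <= s <= q i -> K (k i) (u, s) = cinv c (E i (u, s)).
Proof.
move=> si; have [cC mC] := C_cdom si.
by rewrite /K /= asboolT // disp_on // mC addrC subrK.
Qed.

Let K_off j u s : off_arcs j s -> K j (u, s) = C j s.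
Proof.
move=> off; rewrite /K /= disp_off // addr0; case: asboolP => // cC.
by have [_ _ -> //] := atlas_chart ac.
Qed.

Let C_loop j : loop (C j). Proof. by have [] := CU. Qed.

Let disp_int j u s (m : int) : disp j (u, s + m%:~R) = disp j (u, s).
Proof.
apply: eq_bigr => i _; congr (dlt i (_, _)); rewrite /fr /=.
have -> : Num.floor (s + m%:~R - p i) = Num.floor (s - p i) + m.
  by rewrite addrAC floorDrz ?intr_int // intrKfloor.
by rewrite intrD; ring.
Qed.

Let K_int j u s (m : int) : K j (u, s + m%:~R) = K j (u, s).
Proof. by rewrite /K /= disp_int (loop_int _ _ (C_loop j)). Qed.

(** If [C j s0] is in the chart, the displaced point is in the image of the chart both on and off
    the arcs, and the first branch is continuous. Otherwise [s0] is off the arcs together with a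
    neighbourhood, where [K j] is [C j]. *)
Let K_continuous j : continuous (K j).
Proof.
move=> [u0 s0].
have [C_cont _] := C_loop j.
have [oc _ _ _ _] := atlas_chart ac.
have [cC|nC] := pselect (cdom c (C j s0)).
- have img : cimg c (cmap c (C j s0) + disp j (u0, s0)).
    have [off|[i [m [ki si]]]] := off_or_on j s0.
      by rewrite disp_off // addr0; exists (C j s0).
    rewrite -(loop_int s0 m (C_loop j)) -(disp_int j u0 s0 m) -ki disp_on //.
    by have [_ ->] := C_cdom si; rewrite addrC subrK; apply: sq; exact: Esq.
  have nC : \forall z \near (u0, s0), cdom c (C j z.2).
    have h : {for (u0, s0), continuous (fun z : R * R => C j z.2)}.
      exact: (continuous_composition (@continuous_snd R R) C_cont).
    exact: (h (cdom c) (open_nbhs_nbhs (conj oc cC))).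
  have cont : {for (u0, s0), continuous
     (fun z : R * R => cinv c (cmap c (C j z.2) + disp j z))}.
    apply: (@continuous_comp _ _ _ (fun z : R * R => cmap c (C j z.2) + disp j z));
      last exact: cinv_continuous.
    apply: cvgD; last exact: disp_continuous.
    apply: (@continuous_comp _ _ _ (fun z : R * R => C j z.2));
      last exact: cmap_continuous.
    exact: (continuous_composition (@continuous_snd R R) C_cont).
  rewrite /continuous_at {2}/K /= asboolT //.
  apply: cvg_trans cont; apply: near_eq_cvg; near=> z.
  by rewrite /K asboolT //; near: z.
have off : off_arcs j s0.
  have [//|[i [m [ki si]]]] := off_or_on j s0.
  by exfalso; apply: nC; rewrite -(loop_int s0 m (C_loop j)) -ki; have [] := C_cdom si.
rewrite /continuous_at K_off //.
have cont : {for (u0, s0), continuous (fun z : R * R => C j z.2)}.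
  exact: (continuous_composition (@continuous_snd R R) C_cont).
apply: cvg_trans cont; apply: near_eq_cvg.
have h : \forall z \near (u0, s0), off_arcs j z.2.
  exact: (@continuous_snd R R (u0, s0) _ (off_arcs_near off)).
by apply: filterS h => -[u s] /= h; rewrite K_off.
Unshelve. all: by end_near. Qed.

Lemma arc_homotopy : exists K : 'I_2 -> R * R -> M, forall j,
  [/\ continuous (K j), forall u s (m : int), K j (u, s + m%:~R) = K j (u, s),
      forall s, K j (0, s) = C j s,
      forall u s, off_arcs j s -> K j (u, s) = C j s &
      forall i u s, k i = j -> p i <= s <= q i -> K j (u, s) = cinv c (E i (u, s))].
Proof.
exists K => j; split=> //.
- move=> s; have [off|[i [m [ki si]]]] := off_or_on j s; first exact: K_off.
  rewrite -(K_int j 0 s m) -ki K_on // E0 //.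
  by have [_ _ <- //] := CU; rewrite loop_int.
- exact: K_off.
- by move=> i u s <- si; exact: K_on.
Qed.

End Homotopy.
End System.
End ArcSystems.

Section MoveHomotopy.
Variables (R : realType) (M : surface R) (n : nat).
Variables (c : chart R M) (k : 'I_n -> 'I_2) (p q : 'I_n -> R) (th : 'I_n -> R -> R).
Hypothesis S : arc_system c k p q th.

Lemma th_monotone i :
  {in `[p i, q i] &, {homo th i : x y / x < y}} \/
  {in `[p i, q i] &, {homo th i : x y /~ x < y}}.
Proof.
have [_ _ _ _ /(_ i)[ct [_ thi _]]] := S.
apply: itv_continuous_inj_mono ct _.
by move=> x y xp yp; apply: thi; rewrite inE.
Qed.

(** A monotone bijection of intervals maps ends to ends. Absolute values cover both directions of
    traversal, and the two tangles agree at either end. *)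
Lemma th_end i : `|th i (p i)| = 2 /\ `|th i (q i)| = 2.
Proof.
have [_ _ pq _ /(_ i)[_ [tho _ ths]]] := S.
have pqi : p i <= q i by exact: (arc_ltW S).
have pin : p i \in `[p i, q i] by rewrite in_itv /= lexx.
have qin : q i \in `[p i, q i] by rewrite in_itv /= lexx pqi.
have tp := tho _ pin; have tq := tho _ qin; rewrite /= !in_itv /= in tp tq.
have [s1 s1i s1E] : exists2 s, s \in `[p i, q i] & th i s = 2.
  by have [|s ? ?] := ths 2; [rewrite /= in_itv /=; lra|exists s].
have [s2 s2i s2E] : exists2 s, s \in `[p i, q i] & th i s = -2.
  by have [|s ? ?] := ths (-2); [rewrite /= in_itv /=; lra|exists s].
have p1 : p i <= s1 <= q i by move: s1i; rewrite in_itv.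
have p2 : p i <= s2 <= q i by move: s2i; rewrite in_itv.
case/andP: p1 => p1 q1; case/andP: p2 => p2 q2.
have [/ltW_homo_in mo|/ltW_nhomo_in mo] := th_monotone i.
  have := mo _ _ pin s2i p2; have := mo _ _ s1i qin q1; rewrite s1E s2E => a b.
  have -> : th i (p i) = -2 by lra.
  have -> : th i (q i) = 2 by lra.
  by rewrite normrN ger0_norm.
have := mo _ _ s1i pin p1; have := mo _ _ qin s2i q2; rewrite s1E s2E => a b.
have -> : th i (p i) = 2 by lra.
have -> : th i (q i) = -2 by lra.
by rewrite normrN ger0_norm.
Qed.

Variables (C C' : 'I_2 -> R -> M) (U U' : tangle R n).
Hypothesis CU : carries c k p q th C U.
Hypothesis CU' : carries c k p q th C' U'.
Hypothesis Usq : tangle_in_square U.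
Hypothesis Usq' : tangle_in_square U'.
Hypothesis Uend : forall i t, `|t| = 2 -> tnth U i t = tnth U' i t.
Hypothesis CC' : forall j s, off_arcs k p q j s -> C' j s = C j s.

Definition straight i (u s : R) : plane R :=
  let t := th i (clamp (p i) (q i) s) in
  (1 - u) *: tnth U i t + u *: tnth U' i t.

Lemma straight_continuous i : continuous (fun z : R * R => straight i z.1 z.2).
Proof.
have c1 := @continuous_fst R R; have c2 := @continuous_snd R R.
have [cU _] := Usq i; have [cU' _] := Usq' i.
have ct := continuous_composition c2 (th_continuous S (i := i)).
apply: continuous_planeD; apply: continuous_scale => //.
- by apply: continuous_subR => //; exact: cst_continuous.
- exact: (continuous_composition ct cU).
- exact: (continuous_composition ct cU').
Qed.

Section Pull.
Variables (lam : 'I_n -> R -> R) (W : R -> plane R).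
Hypothesis lamc : forall i, continuous (lam i).
Hypothesis lamp : forall i, lam i (p i) = 0.
Hypothesis lamq : forall i, lam i (q i) = 0.
Hypothesis Wc : continuous W.
Hypothesis W0 : W 0 = 0.
Hypothesis W1 : W 1 = 0.

Definition pulled i u s : plane R := clampsq (straight i u s + lam i s *: W u).

Lemma move_homotopy : exists K : 'I_2 -> R * R -> M, forall j,
  [/\ continuous (K j), forall u s (m : int), K j (u, s + m%:~R) = K j (u, s),
      (fun s => K j (0, s)) = C j /\ (fun s => K j (1, s)) = C' j,
      forall u s, off_arcs k p q j s -> K j (u, s) = C j s &
      forall i u s, k i = j -> p i <= s <= q i ->
        K j (u, s) = cinv c (pulled i u s)].
Proof.
have s0 i s : p i <= s <= q i -> pulled i 0 s = tnth U i (th i s).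
  move=> si; rewrite /pulled /straight W0 scaler0 addr0 subr0 scale1r scale0r addr0.
  rewrite clamp_id // clampsq_id //; apply: (Usq i).2; exact: (th_itv S).
have s1 i s : p i <= s <= q i -> pulled i 1 s = tnth U' i (th i s).
  move=> si; rewrite /pulled /straight W1 scaler0 addr0 subrr scale1r scale0r add0r.
  rewrite clamp_id // clampsq_id //; apply: (Usq' i).2; exact: (th_itv S).
have pqi i := arc_ltW S i.
have lin i s u : `|th i s| = 2 -> p i <= s <= q i -> straight i u s = tnth U i (th i s).
  move=> ts si; rewrite /straight clamp_id // -Uend // -scalerDl subrK.
  by rewrite scale1r.
have [|||||K KP] := @arc_homotopy R M n c k p q th S C U
  (fun i (z : R * R) => pulled i z.1 z.2) CU.
- move=> i; apply: continuous_clampsq; apply: continuous_planeD.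
    exact: straight_continuous.
  apply: continuous_scale.
    exact: (continuous_composition (@continuous_snd R R) (@lamc i)).
  exact: (continuous_composition (@continuous_fst R R) Wc).
- by move=> i s; exact: s0.
- move=> i u; rewrite /pulled /= lamp !scale0r !addr0 !lin ?lexx ?pqi //.
    by case: (th_end i).
  by case: (th_end i).
- move=> i u; rewrite /pulled /= lamq !scale0r !addr0 !lin ?lexx ?pqi //.
    by case: (th_end i).
  by case: (th_end i).
- by move=> i u s _; exact: clampsq_square.
exists K => j; have [Kc Kp K0 Koff Kon] := KP j; split=> //.
split; first by apply/funext => s; rewrite K0.
apply/funext => s; have [off|[i [m [ki si]]]] := off_or_on k p q j s.
  by rewrite Koff // CC'.
rewrite -(Kp 1 s m) (Kon i) // s1 //.
by have [l _ E] := CU'; rewrite -E // ki loop_int.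
Qed.

End Pull.

(** With zero correction the homotopy fixes everything off the arcs, in particular the crossing. *)
Lemma outer_homotopy s t : off_arcs k p q 0 s -> off_arcs k p q 1 t ->
  C 0 s = C 1 t ->
  freely_homotopic (figure_eight (C 0) (C 1) s t) (figure_eight (C' 0) (C' 1) s t).
Proof.
move=> os ot st.
have [||||||K KP] := @move_homotopy (fun _ => cst 0) (cst 0) => //.
- by move=> i; exact: cst_continuous.
- exact: cst_continuous.
have [c0 p0 [a0 b0] o0 _] := KP 0; have [c1 p1 [a1 b1] o1 _] := KP 1.
rewrite -b0 -b1 -{1}a0 -{1}a1.
apply: (@figure_eight_homotopy R M (K 0) (K 1) (cst s) (cst t)) => //.
- exact: cst_continuous.
- exact: cst_continuous.
- by move=> u s'; rewrite -(p0 u s' 1).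
- by move=> u s'; rewrite -(p1 u s' 1).
- by move=> u _; rewrite /= (o0 _ _ os) (o1 _ _ ot).
Qed.

(* Strand [j] is pulled, by a correction [lam *: W] supported inside its arc and
   zero at both ends of the homotopy, so as to keep meeting strand [i]. *)
Lemma inner_homotopy i j s t s' t' : k i = 0 -> k j = 1 ->
  p i <= s <= q i -> p i <= s' <= q i -> p j < t < q j -> p j < t' < q j ->
  tnth U i (th i s) = tnth U j (th j t) ->
  tnth U' i (th i s') = tnth U' j (th j t') ->
  freely_homotopic (figure_eight (C 0) (C 1) s t) (figure_eight (C' 0) (C' 1) s' t').
Proof.
move=> ki kj si si' tj tj' E E'.
have ij : i != j by apply: contraPneq ki => ->; rewrite kj.
pose sg u : R := (1 - u) * s + u * s'.
pose ta u : R := (1 - u) * t + u * t'.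
have cvx (a b x y u : R) : 0 <= u <= 1 -> a <= x <= b -> a <= y <= b ->
    a <= (1 - u) * x + u * y <= b.
  by move=> /andP[u0 u1] /andP[ax xb] /andP[ay yb]; apply/andP; split; nra.
(* Inside the arc, [mu] is the distance to its ends. Since [ta] moves linearly from [t] to [t'],
   [mu] is at least [dl] along it, so [lam] equals 1 at every [ta u] and the full correction acts at
   the crossing. *)
pose mu (x : R) := Num.min (x - p j) (q j - x).
pose dl := Num.min (mu t) (mu t').
have dl0 : 0 < dl by rewrite /dl /mu !lt_min !subr_gt0 tj.
pose lam (l : 'I_n) (x : R) : R := if l == j then Num.min 1 (mu x / dl) else 0.
(* The position of strand [i] at its moving parameter, clamped as in [pulled]; [W] is what strand
   [j] lacks to reach it. *)
pose V u := clampsq (straight i u (sg u)).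
pose W u := V u - straight j u (ta u).
have caff (x y : R) : continuous (fun u : R => (1 - u) * x + u * y).
  have ci : continuous (fun u : R => u) by move=> ?.
  apply: continuous_addR; apply: continuous_mulR => //; try exact: cst_continuous.
  by apply: continuous_subR => //; exact: cst_continuous.
have cst i' x y : continuous (fun u => straight i' u ((1 - u) * x + u * y)).
  apply: (@continuous_composition _ _ _ (fun u : R => (u, (1 - u) * x + u * y)) _ _
    (straight_continuous (i := i'))).
  by apply: continuous_pair_fun => // ?.
have wi x : p j < x < q j -> p j <= x <= q j.
  by move=> /andP[/ltW -> /ltW ->].
have e0 l x : p l <= x <= q l -> straight l 0 x = tnth U l (th l x).
  by move=> lx; rewrite /straight subr0 scale1r scale0r addr0 clamp_id.
have e1 l x : p l <= x <= q l -> straight l 1 x = tnth U' l (th l x).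
  by move=> lx; rewrite /straight subrr scale1r scale0r add0r clamp_id.
have [||||||K KP] := @move_homotopy lam W.
- move=> l; rewrite /lam; case: eqP => _; last exact: cst_continuous.
  apply: continuous_minR; first exact: cst_continuous.
  apply: continuous_mulR; last exact: cst_continuous.
  by apply: continuous_minR; apply: continuous_subR => //; try exact: cst_continuous; move=> ?.
- move=> l; rewrite /lam; case: eqP => // ->.
  have -> : mu (p j) = 0 by rewrite /mu subrr min_l // subr_ge0 (arc_ltW S).
  by rewrite mul0r min_r.
- move=> l; rewrite /lam; case: eqP => // ->.
  have -> : mu (q j) = 0 by rewrite /mu subrr min_r // subr_ge0 (arc_ltW S).
  by rewrite mul0r min_r.
- apply: continuous_planeB; last exact: (cst j t t').
  exact: (continuous_clampsq (cst i s s')).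
- rewrite /W /V /sg /ta !subr0 !mul1r !mul0r !addr0 !e0 ?wi // clampsq_id.
    by rewrite E subrr.
  by apply: (Usq i).2; exact: (th_itv S).
- rewrite /W /V /sg /ta !subrr !mul1r !mul0r !add0r !e1 ?wi // clampsq_id.
    by rewrite E' subrr.
  by apply: (Usq' i).2; exact: (th_itv S).
have [c0 p0 [<- <-] _ n0] := KP 0; have [c1 p1 [<- <-] _ n1] := KP 1.
have -> : s = sg 0 by rewrite /sg subr0 mul1r mul0r addr0.
have -> : t = ta 0 by rewrite /ta subr0 mul1r mul0r addr0.
have -> : s' = sg 1 by rewrite /sg subrr mul1r mul0r add0r.
have -> : t' = ta 1 by rewrite /ta subrr mul1r mul0r add0r.
apply: (@figure_eight_homotopy R M (K 0) (K 1) sg ta) => //.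
- exact: caff.
- exact: caff.
- by move=> u x; rewrite -(p0 u x 1).
- by move=> u x; rewrite -(p1 u x 1).
move=> u u01; rewrite (n0 i) ?(n1 j) ?cvx ?wi //; congr (cinv c _).
rewrite /pulled {1}/lam (negbTE ij) scale0r addr0 /lam eqxx.
have -> : Num.min 1 (mu (ta u) / dl) = 1.
  rewrite min_l // ler_pdivlMr // mul1r.
  have h1 : dl <= mu t by rewrite /dl ge_min lexx.
  have h2 : dl <= mu t' by rewrite /dl ge_min lexx orbT.
  move: h1 h2; rewrite /mu !le_min /ta => /andP[a1 a2] /andP[b1 b2].
  by case/andP: u01 => u0 u1; apply/andP; split; nra.
by rewrite scale1r /W addrC subrK /V [RHS]clampsq_id //; exact: clampsq_square.
Qed.

End MoveHomotopy.

(** * Crossings under a local move *)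

Section Periodicity.
Variables (R : realType) (M : surface R).
Implicit Types (C : lcurve M) (c : chart R M) (s : R) (m : int).

Lemma figure_eight_int (C D : R -> M) s t m l : loop C -> loop D ->
  figure_eight C D (s + m%:~R) (t + l%:~R) = figure_eight C D s t.
Proof.
move=> lC lD; apply/funext => u; rewrite /figure_eight; case: ifP => _;
  by rewrite addrAC loop_int.
Qed.

Lemma velocity_int c (C : R -> M) s m : loop C ->
  velocity c C (s + m%:~R) = velocity c C s.
Proof.
move=> lC; rewrite /velocity /derive1 (_ : (fun h => _) =
  fun h => h^-1 *: ((cmap c \o C) (h + s) - (cmap c \o C) s)) //.
by apply/funext => h /=; rewrite addrA !loop_int.
Qed.

(** The band is periodic only in the strip, so the Jacobians are compared through directional
    derivatives of two maps that agree near the axis. *)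
Lemma side_int c C s m : labeled_curve C -> atlas c -> cdom c (C s) ->
  side c C (s + m%:~R) = side c C s.
Proof.
move=> LC ac cs; have cC := lcurve_cabling LC; have [_ _ B0 Bd] := cC.
have df u : cdom c (C u) -> differentiable (cmap c \o band C) (pt u 0).
  by move=> cu; have [] := Bd c ac (pt u 0) (strip_axis u); rewrite ?B0.
have csm : cdom c (C (s + m%:~R)) by rewrite (loop_int _ _ (lcurve_loop LC)).
have ns := near_strip s.
apply: (congr1 determinant); apply/row_matrixP => i.
set v := delta_mx 0 i : plane R.
apply: (etrans (rowE _ _)).
apply: (etrans (esym (@deriveEjacobian _ _ _ _ _ v (df _ csm)))).
apply: (etrans _ (etrans (@deriveEjacobian _ _ _ _ _ v (df _ cs)) (esym (rowE _ _)))).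
transitivity ('D_v (fun w => (cmap c \o band C) (w + pt m%:~R 0)) (pt s 0)).
  have -> : pt (s + m%:~R) 0 = pt s 0 + pt m%:~R 0 by rewrite ptD addr0.
  rewrite /derive; set f := cmap c \o band C.
  rewrite (_ : (fun h => _) = fun h : R => h^-1 *:
    (((fun w => f (w + pt m%:~R 0)) \o shift (pt s 0)) (h *: v) -
     f (pt s 0 + pt m%:~R 0))) //.
  by apply/funext => h /=; rewrite addrA.
apply: near_eq_derive; apply: filterS ns => w; rewrite /strip /= => w1.
by rewrite -[w]pt_eta ptD addr0 (band_int _ _ cC) // pt_eta.
Qed.

End Periodicity.

(** * Constancy of the side along a curve *)

Section SideSign.
Variables (R : realType) (M : surface R).
Implicit Types (C : lcurve M) (c : chart R M) (s : R).

Lemma side_continuous c C s : labeled_curve C -> atlas c -> cdom c (C s) ->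
  {for s, continuous (side c C)}.
Proof.
move=> LC ac cs; have [_ _ B0 Bd] := lcurve_cabling LC.
have cB : cdom c (band C (pt s 0)) by rewrite B0.
have [_ cJ _] := Bd c ac _ (strip_axis s) cB.
have cpt : {for s, continuous (fun u : R => pt u 0)}.
  by apply: differentiable_continuous; apply/derivable1_diffP; have := is_derive_axis s.
have cJs : {for s, continuous (fun u => 'J (cmap c \o band C) (pt u 0))}.
  exact: (@continuous_comp _ _ _ (fun u : R => pt u 0)).
have ce i j : {for s, continuous (fun u => 'J (cmap c \o band C) (pt u 0) i j)}.
  apply: (@continuous_comp _ _ _ _ (fun N : 'M[R]_2 => N i j)) => //.
  exact: coord_continuous.
rewrite /side (_ : (fun u => \det _) = (fun u =>
  'J (cmap c \o band C) (pt u 0) 0 0 * 'J (cmap c \o band C) (pt u 0) 1 1 -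
  'J (cmap c \o band C) (pt u 0) 0 1 * 'J (cmap c \o band C) (pt u 0) 1 0)).
  by apply: cvgB; apply: cvgM; exact: ce.
by apply/funext => u; move: ('J _ _) => A; rewrite det_rows /det2 !mxE.
Qed.

Lemma same_sign_itv (f : R -> R) a b : a <= b ->
  (forall s, a <= s <= b -> {for s, continuous f}) ->
  (forall s, a <= s <= b -> f s != 0) -> 0 < f a * f b.
Proof.
move=> ab cf f0.
rewrite lt_neqAle eq_sym mulf_neq0 ?f0 ?lexx ?ab //= leNgt; apply/negP => neg.
have cw : {within `[a, b], continuous f}.
  by apply: continuous_in_subspaceT => s; rewrite inE /= in_itv /= => sab; exact: cf.
have [|s] := IVT ab cw (v := 0).
  have [fa|fa|fa] := ltrgtP (f a) 0; last by move: neg; rewrite fa mul0r ltxx.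
    have fb : 0 < f b by move: neg; rewrite nmulr_rlt0.
    by rewrite ge_min le_max (ltW fa) (ltW fb) orbT.
  have fb : f b < 0 by move: neg; rewrite pmulr_rlt0.
  by rewrite ge_min le_max (ltW fa) (ltW fb) orbT.
by rewrite in_itv /= => sab /eqP; apply/negP; exact: f0.
Qed.

Lemma mul_gt0_trans (x y z : R) : 0 < x * y -> 0 < y * z -> 0 < x * z.
Proof.
move=> xy yz; have y2 : 0 < y * y.
  by rewrite -expr2 exprn_even_gt0 //=; apply: contraTneq xy => ->; rewrite mulr0 ltxx.
rewrite -(pmulr_rgt0 _ y2).
have -> : y * y * (x * z) = (x * y) * (y * z) by ring.
exact: mulr_gt0.
Qed.

(** Equality near [s], and not only at [s], gives equal velocities; [side_transport] then applies
    with factor 1. *)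
Lemma same_side_sign c C C' s : labeled_curve C -> labeled_curve C' ->
  atlas c -> cdom c (C s) -> (\forall u \near s, C' u = C u) ->
  same_side C C' s ->
  velocity c C' s = velocity c C s /\ 0 < side c C s * side c C' s.
Proof.
move=> LC LC' ac cs CC' SS.
have E : C' s = C s := nbhs_singleton CC'.
have cs' : cdom c (C' s) by rewrite E.
have cC := lcurve_cabling LC; have cC' := lcurve_cabling LC'.
have [_ _ B0 Bd] := cC; have [_ _ B0' Bd'] := cC'.
have cB : cdom c (band C (pt s 0)) by rewrite B0.
have cB' : cdom c (band C' (pt s 0)) by rewrite B0'.
have [dF _ _] := Bd c ac _ (strip_axis s) cB.
have [dG _ _] := Bd' c ac _ (strip_axis s) cB'.
have vE : velocity c C' s = velocity c C s.
  rewrite /velocity !derive1E; apply: near_eq_derive.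
  by apply: filterS CC' => u /= ->.
split=> //.
have FG : (cmap c \o band C) (pt s 0) = (cmap c \o band C') (pt s 0).
  by rewrite /= B0 B0' E.
have str d : 0 < d -> \forall e \near 0^'+, exists s' e',
     [/\ `|s' - s| < d, 0 < e' < d &
       (cmap c \o band C') (pt s e) = (cmap c \o band C) (pt s' e')].
  move=> d0; apply: filterS (SS d d0) => e [s' [e' [h1 h2 h3]]].
  by exists s', e'; split=> //=; rewrite h3.
have rG : row 0 ('J (cmap c \o band C') (pt s 0)) =
    1 *: row 0 ('J (cmap c \o band C) (pt s 0)).
  by apply: (etrans (esym (velocityE cC' ac cs'))); rewrite vE scale1r velocityE.
exact: (side_transport dF dG FG str ltr01 rG (side_neq0 cC ac cs) (side_neq0 cC' ac cs')).
Qed.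

End SideSign.

Section StrandVelocity.
Variables (R : realType) (M : surface R) (n : nat).
Variables (c : chart R M) (k : 'I_n -> 'I_2) (p q : 'I_n -> R) (th : 'I_n -> R -> R).
Hypothesis S : arc_system c k p q th.

(** Strands that are graphs over the first coordinate, with slopes [dy]. The parameter of a strand
    can then be read off from the chart, and two strands can meet only at equal parameters. *)
Definition graph_tangle (U : tangle R n) (dy : 'I_n -> R -> R) : Prop :=
  forall i t, tnth U i t 0 0 = t /\
    is_derive t 1 (fun u : R => tnth U i u 0 1) (dy i t).

Let ac : atlas c. Proof. by have [] := S. Qed.

Lemma arc_cdom (C : 'I_2 -> R -> M) U i s : carries c k p q th C U ->
  tangle_in_square U -> p i <= s <= q i ->
  cdom c (C (k i) s) /\ cmap c (C (k i) s) = tnth U i (th i s).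
Proof.
move=> [_ _ CU] Usq si; rewrite CU //; apply: (cinvP S).
have [_ sq _ _ _] := S; apply: sq; apply: (Usq i).2; exact: (th_itv S).
Qed.

Section Strand.
Variables (C : 'I_2 -> lcurve M) (U : tangle R n) (dy : 'I_n -> R -> R).
Hypothesis L : forall j, labeled_curve (C j).
Hypothesis CU : carries c k p q th (fun j => crv (C j)) U.
Hypothesis Usq : tangle_in_square U.
Hypothesis Ug : graph_tangle U dy.
Variables (i : 'I_n) (s : R).
Hypothesis si : p i < s < q i.

Let near_itv : \forall u \near s, p i < u < q i.
Proof.
have [_ sq_ pq_ _ _] := S; case/andP: si => ps sq.
have h1 : \forall u \near s, p i < u.
  by apply: open_nbhs_nbhs; split; [exact: open_gt|].
have h2 : \forall u \near s, u < q i.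
  by apply: open_nbhs_nbhs; split; [exact: open_lt|].
by near=> u; apply/andP; split; near: u.
Unshelve. all: by end_near. Qed.

Let near_cmap : \forall u \near s, (cmap c \o C (k i)) u = tnth U i (th i u).
Proof.
apply: filterS near_itv => u /andP[/ltW pu /ltW uq].
by have [|_ E] := arc_cdom CU Usq (i := i) (s := u); rewrite ?pu.
Qed.

Let v := velocity c (C (k i)) s.

Let dC : is_derive s 1 (cmap c \o C (k i) : R -> plane R) v.
Proof.
case/andP: si => /ltW ps /ltW sq.
have [|cs _] := arc_cdom CU Usq (i := i) (s := s); first by rewrite ps.
rewrite /v (velocityE (lcurve_cabling (L _)) ac cs).
exact: (is_derive_velocity (lcurve_cabling (L _)) ac cs).
Qed.

(** [th i] is given as a continuous bijection only; on a graph it is the first coordinate of the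
    curve in the chart and inherits its derivative. *)
Lemma strand_th_derive : is_derive s 1 (th i) (v 0 0).
Proof.
apply: near_eq_is_derive (is_derive_entry 0 dC).
apply: filterS near_cmap => u ->.
by have [] := Ug i (th i u).
Qed.

Lemma strand_velocity : v = v 0 0 *: pt 1 (dy i (th i s)).
Proof.
apply: plane_ext; rewrite !mxE /= ?mulr1 //.
have h1 : is_derive s 1 (fun u => tnth U i (th i u) 0 1) (v 0 1).
  by apply: near_eq_is_derive (is_derive_entry 1 dC); apply: filterS near_cmap => u ->.
have [_ h2] := Ug i (th i s).
have h3 := is_derive1_comp h2 strand_th_derive.
have e1 := @derive_val _ _ _ _ _ _ _ h1; have e2 := @derive_val _ _ _ _ _ _ _ h3.
by rewrite -e1 -[in RHS]mulrC -e2.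
Qed.

End Strand.

(** Both speeds are derivatives of the same monotone [th i]. Only a weak sign results;
    transversality makes it strict in [mirror_term]. *)
Lemma strand_speed_sign (C C' : 'I_2 -> lcurve M) U U' dy dy' i s s' :
  (forall j, labeled_curve (C j)) -> (forall j, labeled_curve (C' j)) ->
  carries c k p q th (fun j => crv (C j)) U ->
  carries c k p q th (fun j => crv (C' j)) U' ->
  tangle_in_square U -> tangle_in_square U' ->
  graph_tangle U dy -> graph_tangle U' dy' ->
  p i < s < q i -> p i < s' < q i ->
  0 <= velocity c (C (k i)) s 0 0 * velocity c (C' (k i)) s' 0 0.
Proof.
move=> L L' CU CU' Usq Usq' Ug Ug' si si'.
have d1 := strand_th_derive L CU Usq Ug si.
have d2 := strand_th_derive L' CU' Usq' Ug' si'.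
rewrite -(@derive_val _ _ _ _ _ _ _ d1) -(@derive_val _ _ _ _ _ _ _ d2) -!derive1E.
have dth x : p i < x < q i -> derivable (th i) x 1.
  by move=> xi; have := strand_th_derive L CU Usq Ug xi.
have [mo|mo] := th_monotone S i.
  by apply: mulr_ge0; apply: (@incr_derive1_ge0_itv _ _ true false (p i) (q i)) => //;
    rewrite ?in_itv // => x; rewrite inE /= in_itv; exact: dth.
by apply: mulr_le0; apply: (@decr_derive1_le0_itv _ _ true false (p i) (q i)) => //;
  rewrite ?in_itv // => x; rewrite inE /= in_itv; exact: dth.
Qed.

End StrandVelocity.

Section LocalMoves.
Variables (R : realType) (M : surface R).
Implicit Types (C : 'I_2 -> lcurve M).

(** The arcs of a move need not lie in [0, 1), so the sign is needed at any parameters of the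
    crossing. *)
Lemma crossing_sign_at (C1 C2 : lcurve M) x s t (c : chart R M) :
  admissible C1 C2 -> crossings C1 C2 x -> C1 s = x -> C2 t = x ->
  atlas c -> cdom c x ->
  let X := det2 (velocity c C1 s) (velocity c C2 t) in
  X != 0 /\ sign2f C1 C2 x =
    label_sign (label_of (side c C1 s * X < 0)) (label_of (0 < side c C2 t * X)).
Proof.
move=> A xX sx tx ac cx; have [LC1 LC2 _ _] := A.
have [_ e1 _ e2] := crossing_param A xX.
have [m ->] := crossing_param1 A xX sx; have [l ->] := crossing_param2 A xX tx.
rewrite (velocity_int _ _ _ (lcurve_loop LC1)) (velocity_int _ _ _ (lcurve_loop LC2)).
rewrite !side_int ?e1 ?e2 //; split; first exact: crossing_transverse.
exact: crossing_sign.
Qed.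

Lemma smoothing_at (C1 C2 : lcurve M) x s t :
  admissible C1 C2 -> crossings C1 C2 x -> C1 s = x -> C2 t = x ->
  smoothing C1 C2 x = figure_eight C1 C2 s t.
Proof.
move=> A xX sx tx; have [LC1 LC2 _ _] := A.
have [m ->] := crossing_param1 A xX sx; have [l ->] := crossing_param2 A xX tx.
by rewrite figure_eight_int //; exact: lcurve_loop.
Qed.

Section System.
Variables (n : nat) (c : chart R M) (k : 'I_n -> 'I_2) (p q : 'I_n -> R).
Variable th : 'I_n -> R -> R.
Hypothesis S : arc_system c k p q th.

Definition disc : set M := cinv c @` @square R.

Let ac : atlas c. Proof. by have [] := S. Qed.
Let sq : @square R `<=` cimg c. Proof. by have [] := S. Qed.

Section OneFamily.
Variables (C : 'I_2 -> lcurve M) (U : tangle R n).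
Hypothesis L : forall j, labeled_curve (C j).
Hypothesis CU : carries c k p q th (fun j => crv (C j)) U.
Hypothesis Usq : tangle_in_square U.

Lemma off_arcs_disc j s : ~ disc (C j s) -> off_arcs k p q j s.
Proof.
move=> nd; have [//|[i [m [ki si]]]] := off_or_on k p q j s.
exfalso; apply: nd; have [_ _ E] := CU.
rewrite -(loop_int s m (lcurve_loop (L j))) -ki E //.
by exists (tnth U i (th i (s + m%:~R))) => //; apply: (Usq i).2; exact: (th_itv S).
Qed.

Lemma inner_arcs x : crossings (C 0) (C 1) x -> disc x -> exists i j s t,
  [/\ k i = 0 /\ k j = 1, p i <= s <= q i /\ p j <= t <= q j,
      C 0 s = x /\ C 1 t = x,
      cdom c x & cmap c x = tnth U i (th i s) /\ cmap c x = tnth U j (th j t)].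
Proof.
move=> [[s0 _ s0x] [t0 _ t0x]] dx; have [_ D _] := CU.
have [|i ki [m si]] := D 0 s0; first by rewrite s0x.
have [|j kj [l tj]] := D 1 t0; first by rewrite t0x.
exists i, j, (s0 + m%:~R), (t0 + l%:~R).
have e1 : C 0 (s0 + m%:~R) = x by rewrite (loop_int _ _ (lcurve_loop (L 0))).
have e2 : C 1 (t0 + l%:~R) = x by rewrite (loop_int _ _ (lcurve_loop (L 1))).
have [cx h1] := arc_cdom S CU Usq si; have [_ h2] := arc_cdom S CU Usq tj.
by rewrite ki e1 in cx h1; rewrite kj e2 in h2.
Qed.

Lemma side_sign_arc i s t : p i <= s <= q i -> p i <= t <= q i ->
  0 < side c (C (k i)) s * side c (C (k i)) t.
Proof.
wlog st : s t / s <= t.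
  move=> H si ti; have [st|/ltW ts] := leP s t; first exact: (H s t st si ti).
  exact: (eq_ind _ (fun z => 0 < z) (H t s ts ti si) _ (mulrC _ _)).
move=> /andP[ps _] /andP[_ tq]; apply: same_sign_itv => // u /andP[su ut].
  have ui : p i <= u <= q i by rewrite (le_trans ps su) (le_trans ut tq).
  by apply: side_continuous => //; have [] := arc_cdom S CU Usq ui.
have ui : p i <= u <= q i by rewrite (le_trans ps su) (le_trans ut tq).
apply: side_neq0 => //; first exact: lcurve_cabling.
by have [] := arc_cdom S CU Usq ui.
Qed.

(** A crossing of the two curves in the disc lies on strands with different values of [k], hence on
    different strands. This serves for the single strand of [R1] and for the disjoint strands of
    [R2_before]. *)
Lemma inner_empty : (forall i j a b, i != j -> tnth U i a <> tnth U j b) ->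
  crossings (C 0) (C 1) `&` disc = set0.
Proof.
move=> nU; rewrite -subset0 => x [xX dx].
have [i [j [s [t [[ki kj] _ _ _ [-> ]]]]]] := inner_arcs xX dx.
by apply: nU; apply: contraPneq ki => ->; rewrite kj.
Qed.

End OneFamily.

(** * Symmetries of the tangles and the crossings inside the disc *)

Section Reflection.
Variables (C C' : 'I_2 -> lcurve M) (U U' : tangle R n) (rho : plane R -> plane R).
Hypothesis L : forall j, labeled_curve (C j).
Hypothesis L' : forall j, labeled_curve (C' j).
Hypothesis CU : carries c k p q th (fun j => crv (C j)) U.
Hypothesis CU' : carries c k p q th (fun j => crv (C' j)) U'.
Hypothesis Usq : tangle_in_square U.
Hypothesis Usq' : tangle_in_square U'.
Hypothesis Ux : forall i t, tnth U i t 0 0 = t.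
Hypothesis Uends : forall i j t, i != j -> `|t| = 2 -> tnth U i t <> tnth U j t.
Hypothesis Urho : forall i t, tnth U' i (- t) = rho (tnth U i t).

(* [rho] is a symmetry of the square carrying [U] to [U'] and reversing all
   strands. *)
Definition mirror (x : M) : M := cinv c (rho (cmap c x)).

(** Strands being graphs, a crossing has one tangle parameter on both strands, and its mirror image
    has the opposite one. Different strands have different ends, so all the parameters are interior
    to the arcs, where velocities can be computed. *)
Lemma mirror_inner x : crossings (C 0) (C 1) x -> disc x -> exists i j s t s' t',
  [/\ k i = 0 /\ k j = 1, p i < s < q i /\ p j < t < q j,
      p i < s' < q i /\ p j < t' < q j,
      [/\ C 0 s = x, C 1 t = x, C' 0 s' = mirror x & C' 1 t' = mirror x] &
      [/\ th i s' = - th i s, th j t' = - th j t, th i s = th j t,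
          cmap c x = tnth U i (th i s) & cmap c x = tnth U j (th j t)]].
Proof.
move=> xX dx.
have [i [j [s [t [[ki kj] [si tj] [e1 e2] cx [h1 h2]]]]]] := inner_arcs L CU Usq xX dx.
have thE : th i s = th j t by rewrite -(Ux i (th i s)) -h1 h2 Ux.
have ij : i != j by apply: contraPneq ki => ->; rewrite kj.
have a2 : `|th i s| != 2.
  apply/eqP => a2; apply: (Uends ij a2).
  by rewrite -h1 h2 thE.
have inner_pt l u : p l <= u <= q l -> `|th l u| != 2 -> p l < u < q l.
  move=> /andP[pu uq] au; have [tp tq] := th_end S l.
  rewrite !lt_neqAle pu uq !andbT; apply/andP; split.
    by apply: contraNneq au => <-; rewrite tp.
  by apply: contraNneq au => ->; rewrite tq.
have preim l u : p l <= u <= q l -> exists2 u', p l <= u' <= q l & th l u' = - th l u.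
  move=> ul; have [_ _ _ _ /(_ l)[_ [_ _ sur]]] := S.
  have := th_itv S ul; rewrite ler_norml => /andP[a1 a3].
  have [|u' u'l u'E] := sur (- th l u); first by rewrite /= in_itv /=; lra.
  by exists u' => //; move: u'l; rewrite /= in_itv.
have [s' s'i s'E] := preim i s si; have [t' t'j t'E] := preim j t tj.
exists i, j, s, t, s', t'; split=> //.
- by rewrite !inner_pt // -thE.
- by rewrite !inner_pt // ?s'E ?t'E ?normrN // -thE.
- have [_ _ E'] := CU'; split=> //.
    by have := E' i s' s'i; rewrite ki s'E Urho -h1.
  by have := E' j t' t'j; rewrite kj t'E Urho -h2.
Qed.

Lemma mirror_mem x : crossings (C 0) (C 1) x -> disc x ->
  [/\ crossings (C' 0) (C' 1) (mirror x), disc (mirror x),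
      square (rho (cmap c x)) & cdom c x].
Proof.
move=> xX dx; have := mirror_inner xX dx.
move=> [i [j [s [t [s' [t' [[ki kj] [si tj] [s'i t'j] [e1 e2 e3 e4] [h1 h2 h3 h4 h5]]]]]]]].
have sqr : square (rho (cmap c x)).
  rewrite h4 -Urho -h1; apply: (Usq' i).2; apply: (th_itv S).
  by case/andP: s'i => /ltW -> /ltW ->.
split=> //.
- by split; [exists s'|exists t'].
- by exists (rho (cmap c x)).
- have si' : p i <= s <= q i by case/andP: si => /ltW -> /ltW ->.
  by have [] := arc_cdom S CU Usq si'; rewrite ki e1.
Qed.

End Reflection.

Section Compare.
Variables (C C' : 'I_2 -> lcurve M) (U U' : tangle R n) (rho : plane R -> plane R).
Variables (dy dy' : 'I_n -> R -> R) (eps : bool).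
Hypothesis A : admissible (C 0) (C 1).
Hypothesis A' : admissible (C' 0) (C' 1).
Hypothesis CU : carries c k p q th (fun j => crv (C j)) U.
Hypothesis CU' : carries c k p q th (fun j => crv (C' j)) U'.
Hypothesis Usq : tangle_in_square U.
Hypothesis Usq' : tangle_in_square U'.
Hypothesis Ug : graph_tangle U dy.
Hypothesis Ug' : graph_tangle U' dy'.
Hypothesis Uends : forall i j t, i != j -> `|t| = 2 -> tnth U i t <> tnth U j t.
Hypothesis UU' : forall i t, `|t| = 2 -> tnth U i t = tnth U' i t.
Hypothesis rhoK : involutive rho.
Hypothesis Urho : forall i t, tnth U' i (- t) = rho (tnth U i t).
Hypothesis dyE : forall i t, dy' i (- t) = (-1) ^+ eps * dy i t.
Hypothesis off : forall j s, off_arcs k p q j s -> C' j s = C j s.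
Hypothesis sides : forall i s, p i <= s <= q i ->
  0 < side c (C (k i)) s * side c (C' (k i)) s.

Let L j : labeled_curve (C j).
Proof. by have [L0 L1 _ _] := A; elim/ord2P: j. Qed.
Let L' j : labeled_curve (C' j).
Proof. by have [L0 L1 _ _] := A'; elim/ord2P: j. Qed.
Let Ux i t : tnth U i t 0 0 = t. Proof. by have [] := Ug i t. Qed.
Let Ux' i t : tnth U' i t 0 0 = t. Proof. by have [] := Ug' i t. Qed.
Let Uends' i j t : i != j -> `|t| = 2 -> tnth U' i t <> tnth U' j t.
Proof. by move=> ij t2; rewrite -!UU' //; exact: Uends. Qed.
Let Urho' i t : tnth U i (- t) = rho (tnth U' i t).
Proof. by rewrite -[in RHS](opprK t) Urho rhoK. Qed.

Let term x := sign2f (C 0) (C 1) x *: cls (smoothing (C 0) (C 1) x).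
Let term' x := sign2f (C' 0) (C' 1) x *: cls (smoothing (C' 0) (C' 1) x).

(* Strand speeds keep their signs, and the determinant of the two velocities is
   multiplied by the sign [(-1) ^+ eps] up to a positive factor. *)
Lemma mirror_term x : crossings (C 0) (C 1) x -> disc x ->
  term' (mirror rho x) = (-1) ^+ eps *: term x.
Proof.
move=> xX dx.
have [i [j [s [t [s' [t' [[ki kj] [si tj] [s'i t'j] [e1 e2 e3 e4] [h1 h2 h3 h4 h5]]]]]]]] :=
  mirror_inner L CU CU' Usq Ux Uends Urho xX dx.
have [xX' dx' _ cx] := mirror_mem L CU CU' Usq Usq' Ux Uends Urho xX dx.
have wi l u : p l < u < q l -> p l <= u <= q l by move=> /andP[/ltW -> /ltW ->].
have cls_eq : cls (smoothing (C' 0) (C' 1) (mirror rho x)) =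
    cls (smoothing (C 0) (C 1) x).
  rewrite (smoothing_at A xX e1 e2) (smoothing_at A' xX' e3 e4).
  apply/esym/freely_homotopic_cls.
  apply: (inner_homotopy S CU CU' Usq Usq' UU' off ki kj (wi _ _ si) (wi _ _ s'i) tj t'j).
    by rewrite -h4.
  by rewrite h1 h2 !Urho -h4 h5.
rewrite /term' /term cls_eq scalerA; congr (_ *: _).
have cx' : cdom c (mirror rho x).
  by have [] := arc_cdom S CU' Usq' (wi _ _ s'i); rewrite ki e3.
have [X0 ->] := crossing_sign_at A xX e1 e2 ac cx.
have [X0' ->] := crossing_sign_at A' xX' e3 e4 ac cx'.
have v1 := strand_velocity S L CU Usq Ug si; rewrite ki in v1.
have v2 := strand_velocity S L CU Usq Ug tj; rewrite kj in v2.
have v1' := strand_velocity S L' CU' Usq' Ug' s'i; rewrite ki h1 dyE in v1'.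
have v2' := strand_velocity S L' CU' Usq' Ug' t'j; rewrite kj h2 dyE in v2'.
have k1 := strand_speed_sign S L L' CU CU' Usq Usq' Ug Ug' si s'i; rewrite ki in k1.
have k2 := strand_speed_sign S L L' CU CU' Usq Usq' Ug Ug' tj t'j; rewrite kj in k2.
have d0 := side_sign_arc L CU Usq (wi _ _ si) (wi _ _ s'i).
have d1 := mul_gt0_trans d0 (sides (wi _ _ s'i)).
have d2 := mul_gt0_trans (side_sign_arc L CU Usq (wi _ _ tj) (wi _ _ t'j))
  (sides (wi _ _ t'j)).
rewrite ki in d1; rewrite kj in d2.
move: X0 X0' d1 d2; rewrite v1 v2 v1' v2' !det2Zl !det2Zr.
move: (velocity c (C 0) s 0 0) (velocity c (C 1) t 0 0) (velocity c (C' 0) s' 0 0)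
  (velocity c (C' 1) t' 0 0) k1 k2 => x1 x2 x1' x2' k1 k2.
move: (dy i _) (dy j _) => a b.
have detE e : det2 (pt 1 (e * a)) (pt 1 (e * b)) = e * (b - a).
  by rewrite /det2 !ptE0 !ptE1; ring.
have := detE 1; rewrite !mul1r => ->; rewrite detE.
move: (side c (C 0) s) (side c (C 1) t) (side c (C' 0) s') (side c (C' 1) t').
move=> D1 D2 D1' D2'.
set X := x1 * _; set X' := x1' * _ => X0 X0' d1 d2.
(* The product is nonzero by transversality of both crossings, and is a product of squares and of
   the two weakly positive speed products. *)
have XX : 0 < X * ((-1) ^+ eps * X').
  have nz : X * ((-1) ^+ eps * X') != 0.
    by apply: mulf_neq0 => //; apply: mulf_neq0 => //; rewrite signr_eq0.
  rewrite lt_neqAle eq_sym nz /=.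
  have -> : X * ((-1) ^+ eps * X') =
      ((-1) ^+ eps) ^+ 2 * ((x1 * x1') * (x2 * x2') * (b - a) ^+ 2).
    by rewrite /X /X'; ring.
  by rewrite mulr_ge0 ?sqr_ge0 // mulr_ge0 ?sqr_ge0 // mulr_ge0.
rewrite -(same_sign_lt0 X' d1) -(same_sign_gt0 X' d2) ![_ * X']mulrC ![_ * X]mulrC.
have D10 : D1 != 0 by apply: contraTneq d1 => ->; rewrite mul0r ltxx.
have D20 : D2 != 0 by apply: contraTneq d2 => ->; rewrite mul0r ltxx.
clearbody X X'; rewrite (same_sign_lt0 D1 XX) (same_sign_gt0 D2 XX).
(* For [eps = true] both labels are exchanged, which negates [label_sign]; the products being
   nonzero, reversing the strict inequalities negates the tests. *)
case: eps => /=; last by rewrite !mul1r.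
rewrite !mulN1r !mulNr oppr_lt0 oppr_gt0.
have P1 : X' * D1 != 0 by rewrite mulf_neq0.
have P2 : X' * D2 != 0 by rewrite mulf_neq0.
by case: (ltrgtP (X' * D1) 0) P1 => // _ _; case: (ltrgtP (X' * D2) 0) P2.
Qed.

(** Since [rho] is an involution, surjectivity is [mirror_mem] with the two families exchanged. *)
Lemma mirror_bij : set_bij (crossings (C 0) (C 1) `&` disc)
  (crossings (C' 0) (C' 1) `&` disc) (mirror rho).
Proof.
have key x : crossings (C 0) (C 1) x -> disc x ->
    cdom c (mirror rho x) /\ cmap c (mirror rho x) = rho (cmap c x).
  move=> xX dx; have [_ _ sr _] := mirror_mem L CU CU' Usq Usq' Ux Uends Urho xX dx.
  by apply: (cinvP S); exact: sq.
split.
- move=> x [xX dx]; have [] := mirror_mem L CU CU' Usq Usq' Ux Uends Urho xX dx.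
  by split.
- move=> x y /set_mem[xX dx] /set_mem[yX dy_] E.
  have [_ _ _ cx] := mirror_mem L CU CU' Usq Usq' Ux Uends Urho xX dx.
  have [_ _ _ cy] := mirror_mem L CU CU' Usq Usq' Ux Uends Urho yX dy_.
  have [_ ex] := key x xX dx; have [_ ey] := key y yX dy_.
  apply: (chart_inj ac cx cy); apply: (inv_inj rhoK).
  by rewrite -ex -ey E.
- move=> x [xX dx].
  have [xX' dx' sr cx] := mirror_mem L' CU' CU Usq' Usq Ux' Uends' Urho' xX dx.
  exists (mirror rho x) => //.
  have [_ e] := cinvP S (sq sr).
  rewrite /mirror e rhoK.
  by have [_ _ K _ _] := atlas_chart ac; rewrite K.
Qed.

Lemma inner_sum :
  \sum_(x \in crossings (C' 0) (C' 1) `&` disc) term' x =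
  \sum_(x \in crossings (C 0) (C 1) `&` disc) ((-1) ^+ eps *: term x).
Proof.
rewrite (reindex_fsbig _ _ _ _ mirror_bij).
by apply: eq_fsbigr => x /set_mem[xX dx]; exact: mirror_term.
Qed.

End Compare.
End System.
End LocalMoves.

Lemma no_int_between01 (R : numDomainType) (m : int) :
  0 < m%:~R :> R -> m%:~R < 1 :> R -> False.
Proof. by rewrite ltr0z (ltr_int R m 1); lia. Qed.

(** * Crossings outside the disc and labels along the arcs *)

Section MoveSetup.
Variables (R : realType) (M : surface R) (n : nat).
Variables (c : chart R M) (k : 'I_n -> 'I_2) (p q : 'I_n -> R) (th : 'I_n -> R -> R).
Variables (C C' : 'I_2 -> lcurve M) (U U' : tangle R n).
Hypothesis S : arc_system c k p q th.
Hypothesis A : admissible (C 0) (C 1).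
Hypothesis A' : admissible (C' 0) (C' 1).
Hypothesis CU : carries c k p q th (fun j => crv (C j)) U.
Hypothesis CU' : carries c k p q th (fun j => crv (C' j)) U'.
Hypothesis Usq : tangle_in_square U.
Hypothesis Usq' : tangle_in_square U'.
Hypothesis UU' : forall i t, `|t| = 2 -> tnth U i t = tnth U' i t.
Hypothesis off : forall j s, off_arcs k p q j s ->
  C' j s = C j s /\ same_side (C j) (C' j) s.

Let ac : atlas c. Proof. by have [] := S. Qed.
Let L j : labeled_curve (C j).
Proof. by have [L0 L1 _ _] := A; elim/ord2P: j. Qed.
Let L' j : labeled_curve (C' j).
Proof. by have [L0 L1 _ _] := A'; elim/ord2P: j. Qed.

(** Being off the arcs is an open condition, so the curves agree near [s], as [same_side_sign]
    requires. *)
Let off_sign d j s : off_arcs k p q j s -> atlas d -> cdom d (C j s) ->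
  velocity d (C' j) s = velocity d (C j) s /\ 0 < side d (C j) s * side d (C' j) s.
Proof.
move=> os ad ds; apply: same_side_sign => //; last exact: (off os).2.
by apply: filterS (off_arcs_near S os) => u /off[].
Qed.

(* The labels outside of the disc determine them inside, since [side] cannot
   change sign along an arc. *)
Lemma arc_sides i s : p i <= s <= q i ->
  0 < side c (C (k i)) s * side c (C' (k i)) s.
Proof.
move=> si; have [_ _ pq dis _] := S.
have pqi := arc_ltW S i.
have pin : p i <= p i <= q i by rewrite lexx.
have [cp _] := arc_cdom S CU Usq pin; have [cp' _] := arc_cdom S CU' Usq' pin.
have [oc _ _ _ _] := atlas_chart ac.
have ncdom (D : R -> M) : continuous D -> cdom c (D (p i)) ->
    \forall u \near p i, cdom c (D u).
  by move=> cD Dp; exact: (cD (p i) (cdom c) (open_nbhs_nbhs (conj oc Dp))).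
have [cC _] := lcurve_loop (L (k i)); have [cC' _] := lcurve_loop (L' (k i)).
have noth : \forall u \near p i, forall l, k l = k i -> l != i ->
    ~ on_arc (p l) (q l) u.
  have : forall l, \forall u \near p i, k l = k i -> l != i -> ~ on_arc (p l) (q l) u.
    move=> l; have [/andP[/eqP kl li]|nh] := boolP ((k l == k i) && (l != i)).
      have : ~ on_arc (p l) (q l) (p i).
        move=> ol; move/eqP: li; apply; exact: (dis l i _ kl ol (on_arc_itv pin)).
      by move=> /(off_arc_near (pq l)); apply: filterS => u.
    by near=> u => kl li; rewrite kl eqxx li in nh.
  by move=> /filter_forall; apply: filterS => u h l; exact: h.
have /nbhs_normP[d d0 Hd] : \forall u \near p i,
   [/\ cdom c (C (k i) u), cdom c (C' (k i) u) &
       forall l, k l = k i -> l != i -> ~ on_arc (p l) (q l) u].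
  near=> u; split; near: u => //; exact: ncdom.
have /andP[pqlt qp1] := pq i.
(* [p i - e] is off all arcs: it stays in the gap before the arc [i], and near enough to [p i] to
   avoid the other arcs of the curve. From there to [q i] both curves remain in the chart, so
   neither side changes sign. *)
pose e := Num.min (d / 2) ((p i + 1 - q i) / 2).
have e0 : 0 < e by rewrite lt_min !divr_gt0 // subr_gt0.
have ed : e <= d / 2 by rewrite ge_min lexx.
have eq1 : e <= (p i + 1 - q i) / 2 by rewrite ge_min lexx orbT.
have cseg (D : 'I_2 -> lcurve M) V : carries c k p q th (fun j => crv (D j)) V ->
    tangle_in_square V ->
    (forall u, p i - e <= u <= p i -> cdom c (D (k i) u)) ->
    forall u, p i - e <= u <= q i -> cdom c (D (k i) u).
  move=> DV Vsq h u /andP[u1 u2]; have [up|pu] := leP u (p i).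
    by apply: h; rewrite u1.
  by have [|? _] := arc_cdom S DV Vsq (i := i) (s := u); first by rewrite ltW.
have near_p u : p i - e <= u <= p i -> [/\ cdom c (C (k i) u), cdom c (C' (k i) u) &
       forall l, k l = k i -> l != i -> ~ on_arc (p l) (q l) u].
  move=> /andP[u1 u2]; apply: Hd => /=; rewrite ger0_norm; last by rewrite subr_ge0.
  have := d0; rewrite /=; lra.
have cC1 := cseg C U CU Usq (fun u h => let: And3 h1 _ _ := near_p u h in h1).
have cC2 := cseg C' U' CU' Usq' (fun u h => let: And3 _ h2 _ := near_p u h in h2).
have pe : p i - e <= p i - e <= p i by rewrite lexx /= gerBl ltW.
have ope : off_arcs k p q (k i) (p i - e).
  move=> l kl; have [->|li] := eqVneq l i; last by have [_ _] := near_p _ pe; apply.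
  move=> [m /andP[m1 m2]].
  have h1 : 0 < m%:~R :> R by lra.
  have h2 : m%:~R < 1 :> R by lra.
  exact: (no_int_between01 h1 h2).
have [c1 c2 _] := near_p _ pe.
have [_ sg] := off_sign ope ac c1.
have sgn (D : 'I_2 -> lcurve M) : (forall j, labeled_curve (D j)) ->
    (forall u, p i - e <= u <= q i -> cdom c (D (k i) u)) ->
    0 < side c (D (k i)) (p i - e) * side c (D (k i)) s.
  move=> LD cD; case/andP: si => ps sq.
  apply: same_sign_itv => [|u /andP[u1 u2]|u /andP[u1 u2]].
  - by rewrite (le_trans _ ps) // gerBl ltW.
  - by apply: side_continuous => //; apply: cD; rewrite u1 (le_trans u2).
  - apply: side_neq0 => //; first exact: lcurve_cabling.
    by apply: cD; rewrite u1 (le_trans u2).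
have g1 := sgn C L cC1; have g2 := sgn C' L' cC2.
have g1' := eq_ind _ (fun z => 0 < z) g1 _ (mulrC _ _).
exact: (mul_gt0_trans (mul_gt0_trans g1' sg) g2).
Unshelve. all: by end_near. Qed.

Let X := crossings (C 0) (C 1).
Let X' := crossings (C' 0) (C' 1).
Let term x := sign2f (C 0) (C 1) x *: cls (smoothing (C 0) (C 1) x).
Let term' x := sign2f (C' 0) (C' 1) x *: cls (smoothing (C' 0) (C' 1) x).

Lemma outer_crossings : X `&` ~` disc c = X' `&` ~` disc c.
Proof.
apply/seteqP; split=> x [[[s _ sx] [t _ tx]] nd]; split=> //.
  have os : off_arcs k p q 0 s by apply: (off_arcs_disc S L CU Usq); rewrite sx.
  have ot : off_arcs k p q 1 t by apply: (off_arcs_disc S L CU Usq); rewrite tx.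
  by split; [exists s|exists t] => //; rewrite (proj1 (off _)).
have os : off_arcs k p q 0 s by apply: (off_arcs_disc S L' CU' Usq'); rewrite sx.
have ot : off_arcs k p q 1 t by apply: (off_arcs_disc S L' CU' Usq'); rewrite tx.
by split; [exists s|exists t] => //; rewrite -(proj1 (off _)).
Qed.

Lemma outer_term x : X x -> ~ disc c x -> term' x = term x.
Proof.
move=> xX nd.
have [xX' _] : (X' `&` ~` disc c) x by rewrite -outer_crossings.
have [_ e1 _ e2] := crossing_param A xX.
move: (param (C 0) x) (param (C 1) x) e1 e2 => s t e1 e2.
have os : off_arcs k p q 0 s by apply: (off_arcs_disc S L CU Usq); rewrite e1.
have ot : off_arcs k p q 1 t by apply: (off_arcs_disc S L CU Usq); rewrite e2.
have e1' : C' 0 s = x by rewrite (proj1 (off os)).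
have e2' : C' 1 t = x by rewrite (proj1 (off ot)).
rewrite /term /term'; congr (_ *: _).
  (* The crossing may lie outside the domain of [c], so any chart at [x] is taken. *)
  have [d ad dx] := atlas_cover x.
  have [_ ->] := crossing_sign_at A xX e1 e2 ad dx.
  have [_ ->] := crossing_sign_at A' xX' e1' e2' ad dx.
  have [|v1 s1] := off_sign os ad; first by rewrite e1.
  have [|v2 s2] := off_sign ot ad; first by rewrite e2.
  move: v1 v2 s1 s2.
  move: (velocity d (C' 0) s) (velocity d (C' 1) t) => w1 w2 -> -> s1 s2.
  move: (side d (C 0) s) (side d (C 1) t) (side d (C' 0) s) (side d (C' 1) t)
    (det2 _ _) s1 s2 => D1 D2 D1' D2' Y s1 s2.
  by rewrite -(same_sign_lt0 Y s1) -(same_sign_gt0 Y s2).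
rewrite (smoothing_at A xX e1 e2) (smoothing_at A' xX' e1' e2').
apply/esym/freely_homotopic_cls.
apply: (outer_homotopy S CU CU' Usq Usq' UU') => //.
  by move=> j u /off[].
by rewrite e1 e2.
Qed.

Lemma move_bracket :
  \sum_(x \in X `&` disc c) term x = \sum_(x \in X' `&` disc c) term' x ->
  bracket (C 0) (C 1) = bracket (C' 0) (C' 1).
Proof.
move=> inner; have [_ _ fX _] := A; have [_ _ fX' _] := A'.
apply: (etrans (fsbigID (disc c) _ _ fX)).
apply: (etrans _ (esym (fsbigID (disc c) _ _ fX'))).
apply: (f_equal2 (fun a b => a + b)); first exact: inner.
rewrite outer_crossings; apply: eq_fsbigr => x.
by rewrite -outer_crossings => /set_mem[xX nd]; rewrite [RHS](outer_term xX nd).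
Qed.

End MoveSetup.

Lemma local_move_bracket (R : realType) (M : surface R) n (U U' : tangle R n)
    (C1 C2 C1' C2' : lcurve M) :
  admissible C1 C2 -> admissible C1' C2' ->
  tangle_in_square U -> tangle_in_square U' ->
  (forall i t, `|t| = 2 -> tnth U i t = tnth U' i t) ->
  local_move U U' (pair_of C1 C2) (pair_of C1' C2') ->
  (forall c k p q th, arc_system c k p q th ->
     carries c k p q th (fun j => crv (pair_of C1 C2 j)) U ->
     carries c k p q th (fun j => crv (pair_of C1' C2' j)) U' ->
     (forall j s, off_arcs k p q j s -> pair_of C1' C2' j s = pair_of C1 C2 j s) ->
     (forall i s, p i <= s <= q i ->
        0 < side c (pair_of C1 C2 (k i)) s * side c (pair_of C1' C2' (k i)) s) ->
     \sum_(x \in crossings C1 C2 `&` disc c)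
        (sign2f C1 C2 x *: cls (smoothing C1 C2 x)) =
     \sum_(x \in crossings C1' C2' `&` disc c)
        (sign2f C1' C2' x *: cls (smoothing C1' C2' x))) ->
  bracket C1 C2 = bracket C1' C2'.
Proof.
move=> A A' Usq Usq' UU' [c [k [p [q [th [[ac sq] [pq dis] thP D [E off]]]]]]] inner.
have S : arc_system c k p q th by split.
have [L1 L2 _ _] := A; have [L1' L2' _ _] := A'.
have L j : loop (pair_of C1 C2 j) by elim/ord2P: j; exact: lcurve_loop.
have L' j : loop (pair_of C1' C2' j) by elim/ord2P: j; exact: lcurve_loop.
have CU : carries c k p q th (fun j => crv (pair_of C1 C2 j)) U.
  by split=> // i s /E[].
have CU' : carries c k p q th (fun j => crv (pair_of C1' C2' j)) U'.
  (* [local_move] describes the preimage of the disc under [C] only. Off the arcs the new curve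
     coincides with the old one, so it enters the disc only where the old one does. *)
  split=> // [j s ds|i s /E[]//].
  have [[i h]|no] := pselect (exists i, k i = j /\ on_arc (p i) (q i) s).
    by exists i; case: h.
  have os : off_arcs k p q j s by move=> i ki oi; apply: no; exists i.
  by apply: D; rewrite -(proj1 (off j s os)).
apply: (@move_bracket R M n c k p q th (pair_of C1 C2) (pair_of C1' C2') U U') => //.
apply: (inner c k p q th) => //; first by move=> j s /off[].
exact: (@arc_sides R M n c k p q th (pair_of C1 C2) (pair_of C1' C2') U U').
Qed.

(** * The Reidemeister tangles *)

Section Bump.
Variable R : realType.

Lemma is_derive_sqr (x : R) : is_derive x 1 (fun u : R => u ^+ 2) (2 * x).
Proof.
have h := @is_deriveX R _ id 2 x 1 1 (is_derive_id x 1).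
rewrite (_ : (fun u : R => u ^+ 2) = id ^+ 2); last by apply/funext => u; rewrite !expr2.
by apply: is_derive_eq h _; rewrite /GRing.scale /= expr1 mulr1.
Qed.

(** Squaring removes the corner at 0, where the difference quotient is at most [|h|]. This makes
    [bump], the square of a positive part, differentiable at [t = 1] and [t = -1]. *)
Lemma is_derive_pos_part_sqr (x : R) :
  is_derive x 1 (fun u : R => Num.max 0 u ^+ 2) (2 * Num.max 0 x).
Proof.
have [x0|x0|->] := ltrgtP x 0.
- rewrite mulr0; apply: (@near_eq_is_derive _ _ _ (cst (0 : R))).
  have : \forall u \near x, u < 0.
    by apply: open_nbhs_nbhs; split; [exact: open_lt|].
  by apply: filterS => u u0; rewrite max_l ?expr0n //= ltW.
- apply: (@near_eq_is_derive _ _ _ (fun u : R => u ^+ 2)).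
    have : \forall u \near x, 0 < u.
      by apply: open_nbhs_nbhs; split; [exact: open_gt|].
    by apply: filterS => u u0; rewrite max_r // ltW.
  exact: is_derive_sqr.
rewrite mulr0; set f := fun u : R => _.
have H : h^-1 *: (f (h *: 1 + 0) - f 0) @[h --> 0^'] --> (0 : R).
  apply/cvgrPdist_lt => e e0; near=> h.
  have h0 : h != 0 by near: h; exact: nbhs_dnbhs_neq.
  have he : `|h| < e by near: h; exact: dnbhs0_lt.
  have -> : f (h *: 1 + 0) - f 0 = Num.max 0 h ^+ 2.
    by rewrite /f addr0 /GRing.scale /= mulr1 maxxx expr0n subr0.
  rewrite sub0r normrN /GRing.scale /= normrM normfV normrX expr2; apply: le_lt_trans he.
  have mh : `|Num.max 0 h| <= `|h|.
    have [h1|h1] := leP 0 h; first by rewrite lexx.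
    by rewrite normr0.
  have hp : 0 < `|h| by rewrite normr_gt0.
  by rewrite mulrC ler_pdivrMr // ler_pM.
apply: DeriveDef; first by apply/cvg_ex; exists 0.
by rewrite /derive; apply: cvg_lim.
Unshelve. all: by end_near. Qed.

(* [bump] alone would denote [fintype.bump]. *)
Lemma bumpE (t : R) : Defs.bump t = Num.max 0 (1 - t ^+ 2) ^+ 2.
Proof.
have tE : (`|t| <= 1) = (0 <= 1 - t ^+ 2).
  by rewrite subr_ge0 -[t ^+ 2]real_normK ?num_real // -{2}(expr1n R 2) ler_sqr ?nnegrE.
by rewrite /Defs.bump tE; case: leP => // _; rewrite expr0n.
Qed.

Definition bump' (t : R) : R := - (4 * t * Num.max 0 (1 - t ^+ 2)).

Lemma is_derive_bump (t : R) : is_derive t 1 (@Defs.bump R) (bump' t).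
Proof.
have h1 : is_derive t 1 (fun u : R => 1 - u ^+ 2) (- (2 * t)).
  by have := is_deriveB (is_derive_cst (1 : R) t 1) (is_derive_sqr t); rewrite sub0r.
have := @is_derive1_comp R (fun u => Num.max 0 u ^+ 2) (fun u => 1 - u ^+ 2) t _ _
  (is_derive_pos_part_sqr (1 - t ^+ 2)) h1.
rewrite (_ : _ \o _ = @Defs.bump R); last by apply/funext => u; rewrite bumpE.
by rewrite (_ : _ * _ = bump' t) // /bump'; ring.
Qed.

Lemma continuous_bump : continuous (@Defs.bump R).
Proof.
move=> t; apply: differentiable_continuous; apply/derivable1_diffP.
by have := is_derive_bump t.
Qed.

Lemma bump_itv (t : R) : 0 <= Defs.bump t <= 1.
Proof.
rewrite bumpE sqr_ge0 /=; have t2 : 0 <= t ^+ 2 by exact: sqr_ge0.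
rewrite -{2}(expr1n R 2) ler_sqr ?nnegrE ?ler01 ?le_max ?lexx //.
by rewrite ge_max ler01 /= gerBl.
Qed.

Lemma bumpN (t : R) : Defs.bump (- t) = Defs.bump t. Proof. by rewrite !bumpE sqrrN. Qed.

Lemma bump'N (t : R) : bump' (- t) = - bump' t.
Proof. by rewrite /bump' sqrrN; ring. Qed.

Lemma bump_end (t : R) : `|t| = 2 -> Defs.bump t = 0.
Proof. by move=> t2; rewrite /Defs.bump t2 ifF // ; lra. Qed.

End Bump.

Section Tangles.
Variable R : realType.

Lemma ord1P (P : 'I_1 -> Prop) : P ord0 -> forall i, P i.
Proof. by move=> P0 i; rewrite ord1. Qed.

Lemma ord3P (P : 'I_3 -> Prop) :
  P ord0 -> P (inord 1) -> P (inord 2) -> forall i, P i.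
Proof.
move=> P0 P1 P2 [[|[|[|//]]] Hi].
- by rewrite (_ : Ordinal Hi = ord0) //; apply: val_inj.
- by rewrite (_ : Ordinal Hi = inord 1) //; apply: val_inj; rewrite /= inordK.
- by rewrite (_ : Ordinal Hi = inord 2) //; apply: val_inj; rewrite /= inordK.
Qed.

Let T0 : R -> plane R := fun _ => 0.

Let id_cont : continuous (fun t : R => t). Proof. by move=> ?. Qed.
Let cst_cont (x : R) : continuous (fun _ : R => x). Proof. exact: cst_continuous. Qed.
Let bump_cont := @continuous_bump R.

Let square_pt (x y : R) : `|x| <= 2 -> `|y| <= 2 -> square (pt x y).
Proof. by rewrite /square /= ptE0 ptE1. Qed.

Let n0 : `|0 : R| <= 2. Proof. by rewrite normr0. Qed.

Lemma R1_before_square : tangle_in_square (@R1_before R).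
Proof.
elim/ord1P; rewrite (tnth_nth T0) /=; split; first exact: continuous_pt.
by move=> t t2; apply: square_pt.
Qed.

Lemma R1_after_square : tangle_in_square (@R1_after R).
Proof.
elim/ord1P; rewrite (tnth_nth T0) /=; split.
  apply: continuous_pt => //; apply: continuous_subR => //.
  by apply: continuous_mulR => //; apply: continuous_mulR.
move=> t t2; have /andP[b0 b1] := bump_itv t; apply: square_pt; last first.
  by rewrite ger0_norm //; lra.
have [t1|t1] := leP `|t| 1; last first.
  have -> : Defs.bump t = 0 by rewrite /Defs.bump ifF // leNgt t1.
  by rewrite mulr0 subr0.
have -> : t - 3 * t * Defs.bump t = t * (1 - 3 * Defs.bump t) by ring.
(* The factor lies in [-2, 1], so the loop of the kink needs [|t| <= 1] to fit in the square. *)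
have h : `|1 - 3 * Defs.bump t| <= 2 by rewrite ler_norml; apply/andP; split; lra.
by rewrite normrM -[leRHS]mul1r ler_pM.
Qed.

Lemma R1_ends i t : `|t| = 2 -> tnth (@R1_before R) i t = tnth (@R1_after R) i t.
Proof.
elim/ord1P: i => t2; rewrite !(tnth_nth T0) /= bump_end //.
by congr pt; ring.
Qed.

Lemma R2_before_square : tangle_in_square (@R2_before R).
Proof.
elim/ord2P; rewrite (tnth_nth T0) /=; split; try exact: continuous_pt.
  by move=> t t2; apply: square_pt.
by move=> t t2; apply: square_pt => //; rewrite ger0_norm //; lra.
Qed.

Lemma R2_after_square : tangle_in_square (@R2_after R).
Proof.
elim/ord2P; rewrite (tnth_nth T0) /=; split.
- exact: continuous_pt.
- by move=> t t2; apply: square_pt.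
- by apply: continuous_pt => //; apply: continuous_subR.
- move=> t t2; apply: square_pt => //; have /andP[b0 b1] := bump_itv t.
  by rewrite ler_norml; apply/andP; split; lra.
Qed.

Lemma R2_ends i t : `|t| = 2 -> tnth (@R2_before R) i t = tnth (@R2_after R) i t.
Proof.
by elim/ord2P: i => t2; rewrite !(tnth_nth T0) /= ?bump_end // subr0.
Qed.

Lemma R2_before_disjoint i j a b :
  i != j -> tnth (@R2_before R) i a <> tnth (@R2_before R) j b.
Proof.
elim/ord2P: i; elim/ord2P: j => //; rewrite !(tnth_nth T0) /= => _;
  move=> /(congr1 (fun z : plane R => z 0 1)); rewrite !ptE1; lra.
Qed.

Definition R2_slope (i : 'I_2) (t : R) : R := if i == 0 then 0 else - bump' t.

Lemma R2_graph : graph_tangle (@R2_after R) R2_slope.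
Proof.
elim/ord2P => t; rewrite (tnth_nth T0) /= /R2_slope /=; split; rewrite ?ptE0 //.
  by under eq_fun do rewrite ptE1; exact: is_derive_cst.
under eq_fun do rewrite ptE1.
by have := is_deriveB (is_derive_cst (2^-1 : R) t 1) (is_derive_bump t); rewrite sub0r.
Qed.

Lemma R2_after_ends i j t :
  i != j -> `|t| = 2 -> tnth (@R2_after R) i t <> tnth (@R2_after R) j t.
Proof.
move=> ij t2; rewrite -!R2_ends //; exact: R2_before_disjoint.
Qed.

Definition flip (z : plane R) : plane R := pt (- z 0 0) (z 0 1).

Lemma flipK : involutive flip.
Proof. by move=> z; rewrite /flip ptE0 ptE1 opprK pt_eta. Qed.

Lemma R2_flip i t : tnth (@R2_after R) i (- t) = flip (tnth (@R2_after R) i t).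
Proof.
by elim/ord2P: i; rewrite !(tnth_nth T0) /= /flip ptE0 ptE1 ?bumpN.
Qed.

Lemma R2_slopeN i t : R2_slope i (- t) = (-1) ^+ true * R2_slope i t.
Proof.
by rewrite /R2_slope; case: ifP => _; rewrite ?mulr0 // bump'N expr1 mulN1r.
Qed.

Let inord1 : (inord 1 : 'I_3) = 1%N :> nat. Proof. by rewrite inordK. Qed.
Let inord2 : (inord 2 : 'I_3) = 2%N :> nat. Proof. by rewrite inordK. Qed.

Lemma R3_before_square : tangle_in_square (@R3_before R).
Proof.
elim/ord3P; rewrite (tnth_nth T0) ?inord1 ?inord2 /=; split.
- exact: continuous_pt.
- by move=> t t2; apply: square_pt.
- by apply: continuous_pt => // t; apply: continuousN.
- by move=> t t2; apply: square_pt; rewrite ?normrN.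
- by apply: continuous_pt => //; apply: continuous_mulR.
- move=> t t2; apply: square_pt => //; have /andP[b0 b1] := bump_itv t.
  by rewrite ler_norml; apply/andP; split; lra.
Qed.

Lemma R3_after_before i t :
  tnth (@R3_after R) i (- t) = - tnth (@R3_before R) i t.
Proof.
elim/ord3P: i; rewrite !(tnth_nth T0) ?inord1 ?inord2 /= ?bumpN;
  by apply: plane_ext; rewrite !mxE ?opprK.
Qed.

Lemma R3_after_square : tangle_in_square (@R3_after R).
Proof.
move=> i; have [ci si] := R3_before_square i.
have E t : tnth (@R3_after R) i t = - tnth (@R3_before R) i (- t).
  by rewrite -R3_after_before opprK.
split.
  rewrite (_ : tnth _ i = fun t => - tnth (@R3_before R) i (- t)); last exact/funext.
  move=> t; apply: cvgN; apply: (@continuous_comp _ _ _ (fun t : R => - t)).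
    exact: opp_continuous.
  exact: ci.
move=> t t2; rewrite E; have [] := si (- t); first by rewrite normrN.
by rewrite /square /= !mxE !normrN.
Qed.

Lemma R3_ends i t : `|t| = 2 -> tnth (@R3_before R) i t = tnth (@R3_after R) i t.
Proof.
by elim/ord3P: i => t2; rewrite !(tnth_nth T0) ?inord1 ?inord2 /= ?bump_end ?mul0r ?oppr0.
Qed.

(** At the ends the heights of the strands are [t], [- t] and 0. *)
Lemma R3_before_ends i j t :
  i != j -> `|t| = 2 -> tnth (@R3_before R) i t <> tnth (@R3_before R) j t.
Proof.
move=> ij t2 /(congr1 (fun z : plane R => z 0 1)) E.
have t0 : t != 0 by rewrite -normr_eq0 t2.
move: ij E; elim/ord3P: i; elim/ord3P: j; rewrite ?eqxx // => _;
  rewrite !(tnth_nth T0) ?inord1 ?inord2 /= !ptE1 ?bump_end ?mul0r //;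
  move/eqP: t0; lra.
Qed.

Definition R3_slope (e : R) (i : 'I_3) (t : R) : R :=
  nth 0 [:: 1; -1; e * bump' t / 2] i.

Lemma R3_slopeN i t : R3_slope (-1) i (- t) = (-1) ^+ false * R3_slope 1 i t.
Proof.
rewrite expr0 mul1r /R3_slope bump'N mulN1r opprK mul1r.
by elim/ord3P: i; rewrite ?inord1 ?inord2.
Qed.

Let bump2 (t : R) : is_derive t 1 (fun u : R => Defs.bump u / 2) (bump' t / 2).
Proof.
rewrite mulrC; under eq_fun do rewrite mulrC.
have := @is_deriveZ _ _ _ (@Defs.bump R) (2^-1) t 1 _ (is_derive_bump t).
by rewrite /GRing.scale.
Qed.

Lemma R3_before_graph : graph_tangle (@R3_before R) (R3_slope 1).
Proof.
rewrite /R3_slope; elim/ord3P => t; rewrite (tnth_nth T0) ?inord1 ?inord2 /=;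
  (split; [by rewrite ptE0|under eq_fun do rewrite ptE1]).
- exact: is_derive_id.
- exact: is_deriveN.
- by rewrite mul1r.
Qed.

Lemma R3_after_graph : graph_tangle (@R3_after R) (R3_slope (-1)).
Proof.
rewrite /R3_slope; elim/ord3P => t; rewrite (tnth_nth T0) ?inord1 ?inord2 /=;
  (split; [by rewrite ptE0|under eq_fun do rewrite ptE1]).
- exact: is_derive_id.
- exact: is_deriveN.
- by rewrite mulN1r mulNr; exact: is_deriveN.
Qed.

End Tangles.

(** * The three Reidemeister moves *)

Section Moves.
Variables (R : realType) (M : surface R).
Implicit Types (C : lcurve M).

(** There is no 2-torsion, as the coefficients have integer components. *)
Lemma A1_eqN_eq0 (x : A1 M) : x = - x -> x = 0.
Proof.
move=> xN; apply/monalg.malgP => k; rewrite monalg.mcoeff0.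
have := congr1 (fun y => monalg.mcoeff k y) xN; rewrite /= monalg.mcoeffN.
case: (monalg.mcoeff k x) => a b [ha hb]; congr Gauss; lia.
Qed.

(** The disc contains a single strand, so its kink is a self-crossing of one curve and contributes
    no term before or after. *)
Lemma R1_bracket C1 C2 C1' C2' : admissible C1 C2 -> admissible C1' C2' ->
  local_move (@R1_before R) (@R1_after R) (pair_of C1 C2) (pair_of C1' C2') \/
  local_move (@R1_after R) (@R1_before R) (pair_of C1 C2) (pair_of C1' C2') ->
  bracket C1 C2 = bracket C1' C2'.
Proof.
move=> A A'; have [L1 L2 _ _] := A; have [L1' L2' _ _] := A'.
have L j : labeled_curve (pair_of C1 C2 j) by elim/ord2P: j.
have L' j : labeled_curve (pair_of C1' C2' j) by elim/ord2P: j.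
have one (U : tangle R 1) (i j : 'I_1) (a b : R) : i != j -> tnth U i a <> tnth U j b.
  by rewrite !ord1.
have inner (U U' : tangle R 1) : tangle_in_square U -> tangle_in_square U' ->
    forall c k p q th, arc_system c k p q th ->
     carries c k p q th (fun j => crv (pair_of C1 C2 j)) U ->
     carries c k p q th (fun j => crv (pair_of C1' C2' j)) U' ->
     crossings C1 C2 `&` disc c = set0 /\ crossings C1' C2' `&` disc c = set0.
  move=> Usq Usq' c k p q th S CU CU'; split.
    exact: (inner_empty S L CU Usq (@one U)).
  exact: (inner_empty S L' CU' Usq' (@one U')).
have sb := @R1_before_square R; have sa := @R1_after_square R.
case=> mv.
  apply: (local_move_bracket A A' sb sa (@R1_ends R) mv) => c k p q th S CU CU' _ _.
  by have [-> ->] := inner _ _ sb sa _ _ _ _ _ S CU CU'; rewrite !fsbig_set0.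
apply: (local_move_bracket A A' sa sb _ mv) => [i t t2|c k p q th S CU CU' _ _].
  by rewrite R1_ends.
by have [-> ->] := inner _ _ sa sb _ _ _ _ _ S CU CU'; rewrite !fsbig_set0.
Qed.

(* [flip] exchanges the two crossings of the bigon and reverses the determinant
   of the velocities, so the sum is its own opposite. *)
Lemma R2_inner_sum C1 C2 (c : chart R M) k p q th : admissible C1 C2 ->
  arc_system c k p q th ->
  carries c k p q th (fun j => crv (pair_of C1 C2 j)) (@R2_after R) ->
  \sum_(x \in crossings C1 C2 `&` disc c)
    (sign2f C1 C2 x *: cls (smoothing C1 C2 x)) = 0.
Proof.
move=> A S CU; have [L1 L2 fX _] := A.
have L j : labeled_curve (pair_of C1 C2 j) by elim/ord2P: j.
have [ac _ _ _ _] := S.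
have sides i s : p i <= s <= q i ->
    0 < side c (pair_of C1 C2 (k i)) s * side c (pair_of C1 C2 (k i)) s.
  by move=> si; exact: (side_sign_arc S L CU (@R2_after_square R) si si).
have sqa := @R2_after_square R.
(* The comparison of two pictures is used here with the same picture twice. *)
have := inner_sum (C := pair_of C1 C2) (C' := pair_of C1 C2) S A A CU CU sqa sqa
  (@R2_graph R) (@R2_graph R) (@R2_after_ends R) (fun i t _ => erefl) (@flipK R)
  (@R2_flip R) (@R2_slopeN R) (fun j s _ => erefl) sides.
rewrite /= => E; apply: A1_eqN_eq0; rewrite {1}E.
have fI : finite_set (crossings C1 C2 `&` disc c) by exact: finite_setIl.
rewrite !fsbig_finite //= -sumrN; apply: eq_bigr => x _.
by rewrite expr1 scaleN1r.
Qed.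

Lemma R2_bracket C1 C2 C1' C2' : admissible C1 C2 -> admissible C1' C2' ->
  local_move (@R2_before R) (@R2_after R) (pair_of C1 C2) (pair_of C1' C2') \/
  local_move (@R2_after R) (@R2_before R) (pair_of C1 C2) (pair_of C1' C2') ->
  bracket C1 C2 = bracket C1' C2'.
Proof.
move=> A A'; have [L1 L2 _ _] := A; have [L1' L2' _ _] := A'.
have L j : labeled_curve (pair_of C1 C2 j) by elim/ord2P: j.
have L' j : labeled_curve (pair_of C1' C2' j) by elim/ord2P: j.
have sb := @R2_before_square R; have sa := @R2_after_square R.
case=> mv.
  apply: (local_move_bracket A A' sb sa (@R2_ends R) mv) => c k p q th S CU CU' _ _.
  rewrite (R2_inner_sum A' S CU').
  by have /= -> := inner_empty S L CU sb (@R2_before_disjoint R); rewrite fsbig_set0.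
apply: (local_move_bracket A A' sa sb _ mv) => [i t t2|c k p q th S CU CU' _ _].
  by rewrite R2_ends.
rewrite (R2_inner_sum A S CU).
by have /= -> := inner_empty S L' CU' sb (@R2_before_disjoint R); rewrite fsbig_set0.
Qed.

Lemma R3_bracket C1 C2 C1' C2' : admissible C1 C2 -> admissible C1' C2' ->
  local_move (@R3_before R) (@R3_after R) (pair_of C1 C2) (pair_of C1' C2') \/
  local_move (@R3_after R) (@R3_before R) (pair_of C1 C2) (pair_of C1' C2') ->
  bracket C1 C2 = bracket C1' C2'.
Proof.
move=> A A'.
have sb := @R3_before_square R; have sa := @R3_after_square R.
have oppK : involutive (fun z : plane R => - z) by exact: opprK.
case=> mv.
  apply: (local_move_bracket A A' sb sa (@R3_ends R) mv) => c k p q th S CU CU' off sides.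
  have := inner_sum (C := pair_of C1 C2) (C' := pair_of C1' C2') S A A' CU CU' sb sa
    (@R3_before_graph R) (@R3_after_graph R) (@R3_before_ends R) (@R3_ends R) oppK
    (@R3_after_before R) (@R3_slopeN R) off sides.
  move=> E; apply: (etrans _ (esym E)).
  by apply: eq_fsbigr => x _; rewrite expr0 scale1r.
apply: (local_move_bracket A A' sa sb _ mv) => [i t t2|c k p q th S CU CU' off sides].
  by rewrite R3_ends.
have ends i t : `|t| = 2 -> tnth (@R3_after R) i t = tnth (@R3_before R) i t.
  by move=> t2; rewrite R3_ends.
have aends i j t : i != j -> `|t| = 2 -> tnth (@R3_after R) i t <> tnth (@R3_after R) j t.
  by move=> ij t2; rewrite !ends //; exact: R3_before_ends.
have rho i t : tnth (@R3_before R) i (- t) = - tnth (@R3_after R) i t.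
  by rewrite -[in RHS](opprK t) R3_after_before opprK.
have slopes i (t : R) : R3_slope 1 i (- t) = (-1) ^+ false * R3_slope (-1) i t.
  by rewrite -[in RHS](opprK t) R3_slopeN expr0 !mul1r.
have := inner_sum (C := pair_of C1 C2) (C' := pair_of C1' C2') S A A' CU CU' sa sb
  (@R3_after_graph R) (@R3_before_graph R) aends ends oppK rho slopes off sides.
move=> E; apply: (etrans _ (esym E)).
by apply: eq_fsbigr => x _; rewrite expr0 scale1r.
Qed.

End Moves.

Theorem mainTheorem4 (R : realType) (M : surface R) (hM : ~ orientable M) :
  (forall C1 C2 C1' C2' : lcurve M,
     admissible C1 C2 -> admissible C1' C2' ->
     flat_move C1 C2 C1' C2' -> bracket C1 C2 = bracket C1' C2') /\
  (forall C1 C2 : lcurve M, admissible C1 C2 ->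
     forall x, crossings C1 C2 x ->
       [/\ sign2f (relabel C1) C2 x = gauss_swap (- sign2f C1 C2 x),
           sign2f C1 (relabel C2) x = gauss_swap (sign2f C1 C2 x) &
           sign2f (relabel C1) (relabel C2) x = - sign2f C1 C2 x]).
Proof.
split; last by move=> C1 C2 A x; exact: sign2f_relabel.
move=> C1 C2 C1' C2' A A' [] mv.
- exact: isotopy_bracket mv.
- by apply: (R1_bracket A A'); left.
- by apply: (R1_bracket A A'); right.
- by apply: (R2_bracket A A'); left.
- by apply: (R2_bracket A A'); right.
- by apply: (R3_bracket A A'); left.
- by apply: (R3_bracket A A'); right.
Qed.
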